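(* The constructions $\mathcal G\mapsto\mathrm{Germ}(\mathcal G)$ (groupoid of germs of a Boolean inverse semigroup) and $G\mapsto\mathrm{Bis}(G)$ (ample semigroup of a Boolean groupoid) are functorial and give an equivalence of the category of Boolean inverse semigroups and the category of Boolean groupoids.
   Context: Inverse semigroup: a semigroup in which each $s$ has a unique $s^*$ with $ss^*s=s$, $s^*ss^*=s^*$; $\mathcal G^{(0)}$ is the set of idempotents, $d(s)=s^*s$, $r(s)=ss^*$, and $s\le t$ iff $s=te$ for some idempotent $e$. A pair $(s,t)$ is orthogonal if $s^*t=st^*=0$. An inverse semigroup (with zero) is Boolean if $\mathcal G^{(0)}$ is a Boolean algebra (not assumed to have a unit, i.e. a generalized Boolean algebra) and every orthogonal pair has a join. Category of Boolean inverse semigroups: objects are Boolean inverse semigroups; arrows are Boolean inverse semigroup morphisms, i.e. inverse semigroup homomorphisms $j:\mathcal H\to\mathcal G$ whose restriction to the idempotents $j^{(0)}:\mathcal H^{(0)}\to\mathcal G^{(0)}$ is a Boolean algebra homomorphism. A Boolean space is a locally compact Hausdorff totally disconnected space. An étale groupoid is a locally compact groupoid (not necessarily Hausdorff) whose range and domain maps $r,d$ to the unit space are local homeomorphisms. A Boolean groupoid is an étale groupoid whose unit space is a Boolean space. Category of Boolean groupoids: objects are Boolean groupoids; an arrow from $H$ to $G$ is a multiplier action of $H$ on $G$ with proper anchor. A multiplier action of $H$ on $G$ is a continuous left action of $H$ on the space $G$, with continuous moment map $\rho:G\to H^{(0)}$ and action map $(\eta,\gamma)\mapsto\eta\gamma$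 defined when $d(\eta)=\rho(\gamma)$ (with $\rho(\gamma)\gamma=\gamma$, $\rho(\eta\gamma)=r(\eta)$, $\eta(\eta'\gamma)=(\eta\eta')\gamma$), which commutes with the right multiplication action of $G$: $\eta(\gamma\gamma')=(\eta\gamma)\gamma'$. Then $\rho=\rho^{(0)}\circ r$ where $\rho^{(0)}=\rho_{|G^{(0)}}:G^{(0)}\to H^{(0)}$; the action has proper anchor if $\rho^{(0)}$ is a proper map. If $H$ acts on $G$ with moment map $\rho$ and $K$ acts on $H$ with moment map $\sigma$, the composed action of $K$ on $G$ has moment map $\sigma^{(0)}\circ\rho$ and is $\kappa\gamma=(\kappa\rho(\gamma))\gamma$. $\mathrm{Bis}(G)$ is the inverse semigroup, under set-theoretical product, of compact open bisections of $G$. On arrows, a multiplier action of $H$ on $G$ with proper anchor gives $j:\mathrm{Bis}(H)\to\mathrm{Bis}(G)$, $j(S)=SG^{(0)}=\{\eta x:\eta\in S,x\in G^{(0)},\rho^{(0)}(x)=d(\eta)\}$. $\mathrm{Germ}(\mathcal G)$: let $X$ be the dual Boolean space of $\mathcal G^{(0)}$, so that $\mathcal G^{(0)}$ is the Boolean algebra of compact open subsets of $X$; each $s\in\mathcal G$ defines a homeomorphism $\varphi_s:\mathrm{dom}(s)\to\mathrm{ran}(s)$ between the compact open sets corresponding to $d(s),r(s)$, dual to $e\mapsto ses^*$. $\mathrm{Germ}(\mathcal G)$ is the set of classes $[s,x]$ of pairs $(s,x)$, $s\in\mathcal G$, $x\in\mathrm{dom}(s)$, where $(s,x)\sim(t,y)$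 iff $x=y$ and $se=te$ for some $e\in\mathcal G^{(0)}$ containing $x$; $[s,\varphi_t(x)][t,x]=[st,x]$, $[s,x]^{-1}=[s^*,\varphi_s(x)]$; basic open sets $\{[s,x]:x\in U\cap\mathrm{dom}(s)\}$, $U\subset X$ open. On arrows, $j:\mathcal H\to\mathcal G$ gives the multiplier action with anchor $\rho^{(0)}$ dual to $j^{(0)}$ and $[s,\rho^{(0)}\circ\varphi_t(x)][t,x]=[j(s)t,x]$ for $s\in\mathcal H$, $t\in\mathcal G$.
   Formalization: Morphisms of Boolean inverse semigroups are also required to be non-degenerate: every idempotent of the target lies below the image of an idempotent (the unit-free form of j(1)=1). Otherwise {0}→G is a morphism with no dual anchor map, since the empty groupoid cannot act on a nonempty one. *)

(* Defs.v *)
From HB Require Import structures.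
From mathcomp Require Import all_boot all_order.
From mathcomp Require Import all_classical topology.

Set Implicit Arguments.
Unset Strict Implicit.
Unset Printing Implicit Defensive.

Import Order.TTheory.

Local Open Scope classical_set_scope.

Record category := Category {
  ob :> Type;
  hom : ob -> ob -> Type;
  idm : forall a, hom a a;
  comp : forall a b c, hom b c -> hom a b -> hom a c;
  comp_idl : forall a b (f : hom a b), comp (idm b) f = f;
  comp_idr : forall a b (f : hom a b), comp f (idm a) = f;
  compA : forall a b c d (h : hom c d) (g : hom b c) (f : hom a b),
    comp h (comp g f) = comp (comp h g) f }.

Arguments idm {_} _.
Arguments comp {_ _ _ _} _ _.

Record is_functor (C D : category) (F : C -> D)
    (Fm : forall a b, hom a b -> hom (F a) (F b)) : Prop := IsFunctor {
  is_fmap_id : forall a, Fm _ _ (idm a) = idm (F a);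
  is_fmap_comp : forall a b c (g : hom b c) (f : hom a b),
    Fm _ _ (comp g f) = comp (Fm _ _ g) (Fm _ _ f) }.

Record functor (C D : category) := Functor {
  fob :> C -> D;
  fmap : forall a b, hom a b -> hom (fob a) (fob b);
  fmapP : is_functor fmap }.

Lemma functor_id_subproof (C : category) :
  @is_functor C C id (fun _ _ f => f).
Proof. by split. Qed.

Definition functor_id C := Functor (functor_id_subproof C).

Lemma functor_comp_subproof (C D E : category) (G : functor D E)
    (F : functor C D) :
  @is_functor C E (fun a => G (F a)) (fun _ _ f => fmap G (fmap F f)).
Proof.
case: F G => F Fm [Fid Fco] [G Gm [Gid Gco]]; split=> /=.
- by move=> a; rewrite Fid Gid.
- by move=> a b c g f; rewrite Fco Gco.
Qed.

Definition functor_comp C D E G F := Functor (@functor_comp_subproof C D E G F).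

Definition isomorphism (C : category) (a b : C) (f : hom a b) :=
  exists g : hom b a, comp g f = idm a /\ comp f g = idm b.

Definition naturally_isomorphic (C D : category) (F G : functor C D) :=
  exists eta : forall a, hom (F a) (G a),
    (forall a, isomorphism (eta a)) /\
    (forall a b (f : hom a b),
       comp (eta b) (fmap F f) = comp (fmap G f) (eta a)).

Definition equivalence_of_categories (C D : category)
    (F : functor C D) (G : functor D C) :=
  naturally_isomorphic (functor_comp G F) (functor_id C) /\
  naturally_isomorphic (functor_comp F G) (functor_id D).

Section InverseSemigroup.
Local Open Scope group_scope.
Context (T : semigroupType).
Implicit Types s t u e f g z : T.

Definition inverses s : set T := [set t | s * t * s = s /\ t * s * t = t].

Definition is_inverse_semigroup := forall s, exists! t, inverses s t.

(* [star s] is the inverse of [s] in an inverse semigroup; it is a junk value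
   in a semigroup in which [s] has no inverse. *)
Definition star s : T := xget s (inverses s).

Definition idem : set T := [set e | e * e = e].

Definition sdom s := star s * s.
Definition sran s := s * star s.

Definition sle s t := exists2 e, idem e & s = t * e.

Definition is_zero z := forall s, z * s = z /\ s * z = z.

Definition orthogonal s t := is_zero (star s * t) /\ is_zero (s * star t).

Definition is_join_in (A : set T) s t u :=
  [/\ A u, sle s u, sle t u &
    forall v, A v -> sle s v -> sle t v -> sle u v].

(* A [cbDistrLatticeType] is a distributive lattice with bottom and relative
   complements, i.e. a generalized Boolean algebra. *)
Definition boolean_idempotents :=
  exists (d : Order.disp_t) (L : cbDistrLatticeType d) (phi : idem -> L),
    bijective phi /\
    forall e f : idem, sle (val e) (val f) <-> (phi e <= phi f)%O.

Definition is_boolean_inverse_semigroup :=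
  [/\ is_inverse_semigroup,
      exists z, is_zero z,
      boolean_idempotents &
      forall s t, orthogonal s t -> exists u, is_join_in setT s t u].

End InverseSemigroup.

Record boolInvSemigroup := BoolInvSemigroup {
  bsort :> semigroupType;
  bsortP : is_boolean_inverse_semigroup bsort }.

(* The restriction of [j] to the idempotents is a homomorphism of generalized
   Boolean algebras: it preserves meets (products of idempotents, by [bmorM]),
   the bottom and joins, hence relative complements, and, in place of the
   preservation of the unit, which need not exist, every idempotent of [G] is
   below an idempotent in the image of [j].  This last condition amounts to
   [j 1 = 1] when [H] and [G] have units, and says that the restriction of every
   point of the dual space of [G] along [j] is a point of the dual space of [H],
   i.e. is not identically zero. *)
Record is_bis_morphism (H G : boolInvSemigroup) (j : H -> G) : Prop :=
  IsBisMorphism {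
    bmorM : forall s t, j (s * t)%g = (j s * j t)%g;
    bmor0 : forall z, is_zero z -> is_zero (j z);
    bmorU : forall e f g, idem e -> idem f -> is_join_in (@idem H) e f g ->
      is_join_in (@idem G) (j e) (j f) (j g);
    bmor_nondeg : forall e : G, idem e -> exists2 f : H, idem f & sle e (j f) }.

Record bis_morphism (H G : boolInvSemigroup) := BisMorphism {
  bmor :> H -> G;
  bmorP : is_bis_morphism bmor }.

Section InverseSemigroupTheory.
Local Open Scope group_scope.
Context (T : semigroupType) (isT : is_inverse_semigroup T).
Implicit Types s t u e f g z : T.

Lemma star_inv s : inverses s (star s).
Proof. by have [t [ht _]] := isT s; apply: xgetPex; exists t. Qed.

Lemma mulVs s : s * star s * s = s. Proof. by case: (star_inv s). Qed.
Lemma mulsV s : star s * s * star s = star s. Proof. by case: (star_inv s). Qed.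
Let mulVsA u s : u * s * star s * s = u * s.
Proof. by rewrite -2!mulgA [s * (_ * _)]mulgA mulVs. Qed.
Let mulsVA u s : u * star s * s * star s = u * star s.
Proof. by rewrite -2!mulgA [star s * (_ * _)]mulgA mulsV. Qed.
Let idA u e : idem e -> u * e * e = u * e.
Proof. by move=> ee; rewrite -mulgA ee. Qed.

Lemma star_uniq s t : inverses s t -> star s = t.
Proof.
by have [u [_ uu]] := isT s => /uu <-; rewrite (uu _ (star_inv s)).
Qed.

Lemma starK s : star (star s) = s.
Proof. by apply: star_uniq; split; [exact: mulsV | exact: mulVs]. Qed.

Lemma star_idem e : idem e -> star e = e.
Proof. by move=> ee; apply: star_uniq; split; rewrite !ee. Qed.

Lemma idemM e f : idem e -> idem f -> idem (e * f).
Proof.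
move=> ee ff; set x := star (e * f).
have := star_inv (e * f); rewrite /inverses/= -/x !mulgA => -[h1 h2].
have hx : x = f * x * e.
  apply: star_uniq; split; rewrite !mulgA.
    by rewrite (idA _ ff) (idA _ ee).
  rewrite (idA _ ee) (idA _ ff).
  by have := congr1 (fun y => f * y * e) h2; rewrite !mulgA.
have xx : idem x.
  rewrite /idem/= {1 2}hx !mulgA.
  by have := congr1 (fun y => f * y * e) h2; rewrite !mulgA => ->; rewrite -hx.
by rewrite -(starK (e * f)) -/x star_idem.
Qed.

Lemma idemC e f : idem e -> idem f -> e * f = f * e.
Proof.
move=> ee ff; have ef := idemM ee ff; have fe := idemM ff ee.
have {}ef : e * f * e * f = e * f by rewrite -mulgA.
have {}fe : f * e * f * e = f * e by rewrite -mulgA.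
rewrite -(star_idem (idemM ee ff)); apply: star_uniq.
by split; rewrite !mulgA ?(idA _ ee) ?(idA _ ff).
Qed.

Lemma idem_dom s : idem (sdom s).
Proof. by rewrite /idem/= /sdom mulgA mulsV. Qed.

Lemma idem_ran s : idem (sran s).
Proof. by rewrite /idem/= /sran mulgA mulVs. Qed.

Lemma mul_dom s : s * sdom s = s. Proof. by rewrite /sdom mulgA mulVs. Qed.
Lemma mul_ran s : sran s * s = s. Proof. exact: mulVs. Qed.

Let mul_idem u e s : idem e -> u * e * s * star s = u * s * star s * e.
Proof.
by move=> ee; rewrite -!mulgA; congr (u * _);
   rewrite [RHS]mulgA -idemC//; exact: idem_ran.
Qed.

Lemma starM s t : star (s * t) = star t * star s.
Proof.
have h u : u * t * star t * star s * s = u * star s * s * t * star t.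
  rewrite -!mulgA; congr (u * _).
  by have := idemC (idem_ran t) (idem_dom s); rewrite /sran /sdom !mulgA.
apply: star_uniq; split; rewrite !mulgA.
  by rewrite h mulVs mulVsA.
by rewrite -h mulsV mulsVA.
Qed.

Lemma idem_conj s e : idem e -> idem (star s * e * s).
Proof.
by move=> ee; rewrite /idem/= !mulgA mul_idem// mulsV (idA _ ee).
Qed.

Lemma idem_mul e s : idem e -> e * s = s * (star s * e * s).
Proof.
move=> ee; have := idemC ee (idem_ran s); rewrite /sran !mulgA => <-.
by rewrite mulVsA.
Qed.

Lemma sle_refl s : sle s s.
Proof. by exists (sdom s); [exact: idem_dom | rewrite mul_dom]. Qed.

Lemma sle_trans s t u : sle s t -> sle t u -> sle s u.
Proof.
by move=> [e ee ->] [f ff ->]; exists (f * e); [exact: idemM | rewrite mulgA].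
Qed.

Lemma sle_idemE e f : idem e -> idem f -> sle e f <-> f * e = e.
Proof.
move=> ee ff; split=> [[g gg ->]|<-]; last by exists e.
by rewrite mulgA ff.
Qed.

Lemma sle_idem e f : idem f -> sle e f -> idem e.
Proof. by move=> ff [g gg ->]; exact: idemM. Qed.

Lemma sle_conj s e f : idem e -> idem f -> sle e f ->
  sle (star s * e * s) (star s * f * s).
Proof.
move=> ee ff /(sle_idemE ee ff) h; exists (star s * e * s).
  exact: idem_conj.
have {h}h u : u * f * e = u * e by rewrite -mulgA h.
by rewrite !mulgA mul_idem// mulsV h.
Qed.

End InverseSemigroupTheory.

Section BisCategory.

Lemma bis_morphism_eq (H G : boolInvSemigroup) (j k : bis_morphism H G) :
  bmor j = bmor k -> j = k.
Proof.
by case: j k => [j jP] [k kP] /= jk; case: _ / jk kP => kP;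
   rewrite (Prop_irrelevance jP kP).
Qed.

Lemma bis_morphism_id (G : boolInvSemigroup) : @is_bis_morphism G G id.
Proof.
have [isG _ _ _] := bsortP G.
by split=> // e ee; exists e => //; exact: sle_refl.
Qed.

Lemma bmor_idem (H G : boolInvSemigroup) (j : H -> G) e :
  is_bis_morphism j -> idem e -> idem (j e).
Proof. by move=> jP ee; rewrite /idem/= -(bmorM jP) ee. Qed.

Lemma bmor_sle (H G : boolInvSemigroup) (j : H -> G) s t :
  is_bis_morphism j -> sle s t -> sle (j s) (j t).
Proof.
move=> jP [e ee ->]; exists (j e); first exact: bmor_idem.
by rewrite (bmorM jP).
Qed.

Lemma bmor_star (H G : boolInvSemigroup) (j : H -> G) s :
  is_bis_morphism j -> star (j s) = j (star s).
Proof.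
move=> jP; have [isH _ _ _] := bsortP H; have [isG _ _ _] := bsortP G.
apply: star_uniq => //.
by split; rewrite -!(bmorM jP) ?mulVs ?mulsV.
Qed.

Lemma bis_morphism_comp (K H G : boolInvSemigroup) (j : H -> G) (k : K -> H) :
  is_bis_morphism j -> is_bis_morphism k -> is_bis_morphism (j \o k).
Proof.
move=> jP kP; have [isG _ _ _] := bsortP G; split=> /=.
- by move=> s t; rewrite (bmorM kP) (bmorM jP).
- by move=> z z0; apply: (bmor0 jP); exact: (bmor0 kP).
- by move=> e f g ee ff efg; apply: (bmorU jP);
    [exact: bmor_idem | exact: bmor_idem | exact: (bmorU kP)].
- move=> e ee; have [f ff ef] := bmor_nondeg jP ee.
  have [g gg fg] := bmor_nondeg kP ff; exists g => //.
  by apply: (sle_trans isG ef); exact: bmor_sle.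
Qed.

Definition bis_idm (G : boolInvSemigroup) := BisMorphism (bis_morphism_id G).

Definition bis_comp (K H G : boolInvSemigroup) (j : bis_morphism H G)
    (k : bis_morphism K H) :=
  BisMorphism (bis_morphism_comp (bmorP j) (bmorP k)).

Lemma bis_comp_idl (H G : boolInvSemigroup) (j : bis_morphism H G) :
  bis_comp (bis_idm G) j = j.
Proof. exact: bis_morphism_eq. Qed.

Lemma bis_comp_idr (H G : boolInvSemigroup) (j : bis_morphism H G) :
  bis_comp j (bis_idm H) = j.
Proof. exact: bis_morphism_eq. Qed.

Lemma bis_compA (K L H G : boolInvSemigroup) (j : bis_morphism H G)
    (k : bis_morphism L H) (l : bis_morphism K L) :
  bis_comp j (bis_comp k l) = bis_comp (bis_comp j k) l.
Proof. exact: bis_morphism_eq. Qed.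

Definition bis_cat : category := Category bis_comp_idl bis_comp_idr bis_compA.

End BisCategory.

Section Dual.
Local Open Scope group_scope.
Context (G : boolInvSemigroup).
Implicit Types s t e f g z : G.

Let isG : is_inverse_semigroup G. Proof. by case: (bsortP G). Qed.

Record prime_filter (x : set G) : Prop := PrimeFilter {
  pf_idem : forall e, x e -> idem e;
  pf_ex : exists e, x e;
  pf_zero : forall z, is_zero z -> ~ x z;
  pf_mul : forall e f, x e -> x f -> x (e * f);
  pf_up : forall e f, x e -> idem f -> sle e f -> x f;
  pf_prime : forall e f g, idem e -> idem f -> is_join_in (@idem G) e f g ->
    x g -> x e \/ x f }.

(* The Stone dual of the idempotents of [G]: the point [x] belongs to the compact
   open set corresponding to the idempotent [e] when [x e]. *)
Record dual := Dual { dpt :> G -> Prop; dptP : prime_filter dpt }.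

HB.instance Definition _ := gen_eqMixin dual.
HB.instance Definition _ := gen_choiceMixin dual.
HB.instance Definition _ := isSubBaseTopological.Build dual
  [set U | exists2 e, idem e & U = [set x : dual | x e]] id.

Lemma dual_eq (x y : dual) : dpt x = dpt y -> x = y.
Proof.
by case: x y => [x xP] [y yP] /= xy; case: _ / xy yP => yP;
   rewrite (Prop_irrelevance xP yP).
Qed.

Lemma is_join_mull e f g r : idem e -> idem f -> idem r ->
  is_join_in (@idem G) e f g -> is_join_in (@idem G) (r * e) (r * f) (r * g).
Proof.
move=> ee ff rr [gg eg fg glub].
have [_ _ [d [L [phi [[psi phiK psiK] phiE]]]] _] := bsortP G.
have le1 (a b : G) : idem a -> idem b -> sle (a * b) a by move=> ? ?; exists b.
have le2 (a b : G) : idem a -> idem b -> sle (a * b) b.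
  by move=> aa bb; rewrite idemC//; exists a.
have le3 (a b c : G) : idem a -> idem b -> idem c ->
    sle c a -> sle c b -> sle c (a * b).
  move=> aa bb cc /(sle_idemE cc aa) ca /(sle_idemE cc bb) cb.
  by apply/sle_idemE => //; [exact: idemM | rewrite -mulgA cb].
have mono a b : idem a -> idem b -> sle a b -> sle (r * a) (r * b).
  move=> aa bb ab; apply: le3 => //; [exact: idemM | exact: le1 |].
  by apply: sle_trans ab => //; exact: le2.
split; [exact: idemM | exact: mono | exact: mono |].
move=> v vv rev rfv.
pose P a : idem a -> L := fun h => phi (exist _ a (mem_set h)).
have PE a b (ha : idem a) (hb : idem b) : sle a b <-> (P a ha <= P b hb)%O.
  exact: (phiE (exist _ a (mem_set ha)) (exist _ b (mem_set hb))).
have PS (l : L) : {a | {h : idem a | P a h = l}}.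
  exists (val (psi l)); have h := set_mem (valP (psi l)); exists h.
  rewrite /P -[RHS]psiK; congr phi; exact/val_inj.
have PM a b (ha : idem a) (hb : idem b) (hab : idem (a * b)) :
    (P a ha `&` P b hb)%O = P (a * b) hab.
  apply/eqP; rewrite eq_le; apply/andP; split; last first.
    by rewrite lexI; apply/andP; split; apply/PE;
      [exact: le1 | exact: le2].
  have [c [hc hcE]] := PS (P a ha `&` P b hb)%O.
  rewrite -hcE; apply/PE; apply: le3 => //; apply/PE; rewrite hcE.
    exact: leIl.
  exact: leIr.
have [c [hc hcE]] := PS (P e ee `|` P f ff)%O.
have gc : sle g c.
  apply: glub => //; apply/PE; rewrite hcE.
    exact: leUl.
  exact: leUr.
have re := idemM isG rr ee; have rf := idemM isG rr ff.
have rc := idemM isG rr hc.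
apply: (@sle_trans _ isG _ (r * c)); first exact: mono.
apply/PE; rewrite -(PM _ _ rr hc) hcE meetUr.
by rewrite (PM _ _ rr ee re) (PM _ _ rr ff rf) leUx;
   apply/andP; split; apply/PE.
Unshelve. all: by [].
Qed.

Lemma sdomM s t : sdom (s * t) = star t * sdom s * t.
Proof. by rewrite /sdom starM// !mulgA. Qed.

Lemma is_join_conj s e f g : idem e -> idem f -> is_join_in (@idem G) e f g ->
  is_join_in (@idem G) (star s * e * s) (star s * f * s) (star s * g * s).
Proof.
move=> ee ff efg; have [gg eg fg _] := efg.
split; [exact: idem_conj | exact: sle_conj | exact: sle_conj |].
move=> v vv ev fv.
have rr := idem_ran isG s; have [_ _ _ glub] := is_join_mull ee ff rr efg.
have conjr a : idem a -> s * (star s * a * s) * star s = sran s * a.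
  move=> aa; have -> : s * (star s * a * s) * star s = sran s * a * sran s.
    by rewrite /sran !mulgA.
  by rewrite -mulgA (idemC isG aa rr) mulgA rr.
have conjs a : idem a -> sle (star s * a * s) v ->
    sle (sran s * a) (s * v * star s).
  move=> aa av; have := sle_conj isG (star s) (idem_conj isG s aa) vv av.
  by rewrite starK// conjr.
have sv : idem (s * v * star s).
  by have := idem_conj isG (star s) vv; rewrite starK.
have := glub _ sv (conjs _ ee ev) (conjs _ ff fv).
move=> /(sle_conj isG s (idemM isG rr gg) sv).
have -> : star s * (sran s * g) * s = star s * g * s.
  by rewrite /sran !mulgA mulsV.
have -> : star s * (s * v * star s) * s = v * sdom s.
  have -> : star s * (s * v * star s) * s = sdom s * v * sdom s.
    by rewrite /sdom !mulgA.
  by rewrite (idemC isG (idem_dom isG s) vv) -mulgA idem_dom.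
move=> h; apply: sle_trans h _ => //.
by exists (sdom s) => //; exact: idem_dom.
Qed.

Definition phi_set s (x : set G) : set G :=
  [set f | idem f /\ x (star s * f * s)].

Lemma prime_filter_phi s (x : dual) (xs : x (sdom s)) :
  prime_filter (phi_set s x).
Proof.
have xP := dptP x; split.
- by move=> e [].
- exists (sran s); split; first exact: idem_ran.
  by rewrite /sran mulgA mulsV.
- move=> z z0 [_]; rewrite (z0 _).2 (z0 _).1; exact: pf_zero.
- move=> e f [ee xe] [ff xf]; split; first exact: idemM.
  suff -> : star s * (e * f) * s = star s * e * s * (star s * f * s).
    exact: pf_mul.
  rewrite -!mulgA; congr (_ * (_ * _)).
  by have := idem_mul isG s ff; rewrite -!mulgA.
- move=> e f [ee xe] ff ef; split=> //.
  apply: (pf_up xP xe); first exact: idem_conj.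
  exact: (sle_conj isG).
- move=> e f g ee ff efg [gg xg].
  have [] := pf_prime xP _ _ (is_join_conj s ee ff efg) xg; try exact: idem_conj.
    by left.
  by right.
Qed.

(* The homeomorphism dual to [e |-> s e s^*]: the open set corresponding to an
   idempotent [f] is pulled back by it to the one corresponding to [s^* f s]. *)
Definition phi s (x : dual) (xs : x (sdom s)) : dual :=
  Dual (prime_filter_phi xs).

Record pregerm := Pregerm {
  pg_elt : G;
  pg_pt : dual;
  pg_in : pg_pt (sdom pg_elt) }.

HB.instance Definition _ := gen_eqMixin pregerm.
HB.instance Definition _ := gen_choiceMixin pregerm.

Definition germ_equiv : rel pregerm := fun p q =>
  `[< pg_pt p = pg_pt q /\
      exists e, [/\ idem e, pg_pt p e & pg_elt p * e = pg_elt q * e] >].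

Lemma germ_equiv_refl : reflexive germ_equiv.
Proof.
move=> p; apply/asboolP; split=> //; exists (sdom (pg_elt p)).
by split=> //; [exact: idem_dom | exact: pg_in].
Qed.

Lemma germ_equiv_sym : symmetric germ_equiv.
Proof.
by move=> p q; apply/asboolP/asboolP => -[pq [e [ee pe h]]];
   split=> //; exists e; split=> //; rewrite ?pq -?pq.
Qed.

Lemma germ_equiv_trans : transitive germ_equiv.
Proof.
move=> q p r /asboolP[pq [e [ee pe he]]] /asboolP[qr [f [ff qf hf]]].
apply/asboolP; split; first by rewrite pq.
exists (e * f); split; first exact: idemM.
  by apply: (pf_mul (dptP _)) => //; rewrite pq.
by rewrite mulgA he -mulgA (idemC isG ee ff) mulgA hf -mulgA (idemC isG ff ee)
  mulgA.
Qed.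

Canonical germ_equiv_rel :=
  EquivRel germ_equiv germ_equiv_refl germ_equiv_sym germ_equiv_trans.

Definition germ := {eq_quot germ_equiv}%qT.

HB.instance Definition _ := Choice.on germ.

Definition germ_of (p : pregerm) : germ := (\pi_germ p)%qT.

Definition mkgerm s (x : dual) (xs : x (sdom s)) : germ := germ_of (Pregerm xs).

(* These sets form a base: the subbase topology has them as basic open sets. *)
HB.instance Definition _ := isSubBaseTopological.Build germ
  [set B : set germ | exists (s : G) (U : set dual), open U /\
     B = [set g | exists (x : dual) (xs : x (sdom s)), U x /\ g = mkgerm xs]] id.

Lemma germP (g : germ) : exists s (x : dual) (xs : x (sdom s)), g = mkgerm xs.
Proof.
exists (pg_elt (repr g)), (pg_pt (repr g)), (pg_in (repr g)).
by rewrite /mkgerm /germ_of; case: (repr g) (reprK g) => s x xs /= ->.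
Qed.

Lemma eq_germ s t (x y : dual) (xs : x (sdom s)) (yt : y (sdom t)) :
  mkgerm xs = mkgerm yt <->
  x = y /\ exists e, [/\ idem e, x e & s * e = t * e].
Proof.
by split=> [/eqquotP/asboolP//|h]; apply/eqquotP/asboolP.
Qed.

End Dual.

Section FiberProduct.
Context (X Y Z : topologicalType) (f : X -> Z) (g : Y -> Z).

Definition fibprod : set (X * Y) := [set p | f p.1 = g p.2].

(* A partially defined operation, as a function on the subspace [fibprod] of
   the product. *)
Definition on_fibprod (W : Type) (m : forall x y, f x = g y -> W) (p : fibprod)
  : W := m _ _ (set_mem (valP p)).

Definition fibpair x y (h : f x = g y) : fibprod :=
  exist _ (x, y) (mem_set (h : fibprod (x, y))).

Lemma on_fibprodE (W : Type) (m : forall x y, f x = g y -> W) x y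
  (h : f x = g y) : on_fibprod m (fibpair h) = m x y h.
Proof. by rewrite /on_fibprod /=; congr m; exact: Prop_irrelevance. Qed.

Lemma fibprod_fst : continuous (fun p : fibprod => (val p).1).
Proof.
move=> p; apply: (@continuous_comp _ _ _ (val : fibprod -> X * Y) fst).
  exact: (@initial_continuous _ _ (val : fibprod -> X * Y)).
exact: cvg_fst.
Qed.

Lemma fibprod_snd : continuous (fun p : fibprod => (val p).2).
Proof.
move=> p; apply: (@continuous_comp _ _ _ (val : fibprod -> X * Y) snd).
  exact: (@initial_continuous _ _ (val : fibprod -> X * Y)).
exact: cvg_snd.
Qed.

Lemma fibpair_continuous (W : topologicalType) (u : W -> X) (v : W -> Y)
  (h : forall w, f (u w) = g (v w)) :
  continuous u -> continuous v -> continuous (fun w => fibpair (h w)).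
Proof.
move=> cu cv; apply: (@continuous_comp_initial _ W (X * Y)%type
  (val : fibprod -> X * Y)).
by move=> w; apply: cvg_pair; [exact: cu | exact: cv].
Qed.

End FiberProduct.

(* The unit space is a separate space [gobj], embedded in the space of arrows by
   [gunit]; when [gunit] and [gdom] are continuous, [gunit] is a homeomorphism
   onto its image since [gdom \o gunit = id].  The product of [g] and [h] is
   defined when the domain of [g] is the range of [h]. *)
Record groupoid_data := GroupoidData {
  gobj : topologicalType;
  garr :> topologicalType;
  gdom : garr -> gobj;
  gcod : garr -> gobj;
  gunit : gobj -> garr;
  ginv : garr -> garr;
  gmul : forall g h, gdom g = gcod h -> garr }.

Arguments gmul {_} g h _.

Record is_groupoid (G : groupoid_data) : Prop := IsGroupoid {
  gdom_unit : forall x, gdom (gunit x) = x :> gobj G;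
  gcod_unit : forall x, gcod (gunit x) = x :> gobj G;
  gdom_mul : forall (g h : G) p, gdom (gmul g h p) = gdom h;
  gcod_mul : forall (g h : G) p, gcod (gmul g h p) = gcod g;
  gmulA : forall (g h k : G) p q p' q',
    gmul g (gmul h k q) p' = gmul (gmul g h p) k q';
  gmul1 : forall (g : G) p, gmul g (gunit (gdom g)) p = g;
  g1mul : forall (g : G) p, gmul (gunit (gcod g)) g p = g;
  gdom_inv : forall g : G, gdom (ginv g) = gcod g;
  gcod_inv : forall g : G, gcod (ginv g) = gdom g;
  gmulV : forall (g : G) p, gmul g (ginv g) p = gunit (gcod g);
  gmulVl : forall (g : G) p, gmul (ginv g) g p = gunit (gdom g) }.

Arguments gmulA {G} _ {g h k} p q p' q'.

Record is_topological_groupoid (G : groupoid_data) : Prop :=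
  IsTopologicalGroupoid {
    tgroupoid : is_groupoid G;
    gdom_cts : continuous (@gdom G);
    gcod_cts : continuous (@gcod G);
    gunit_cts : continuous (@gunit G);
    ginv_cts : continuous (@ginv G);
    gmul_cts : continuous (on_fibprod (@gmul G)) }.

Definition local_homeomorphism (X Y : topologicalType) (f : X -> Y) :=
  forall x, exists U : set X,
    [/\ open U, U x, {in U &, injective f}, {within U, continuous f} &
      forall V, open V -> V `<=` U -> open (f @` V)].

Definition boolean_space (X : topologicalType) :=
  [/\ locally_compact [set: X], hausdorff_space X &
      totally_disconnected [set: X]].

(* The compact neighborhoods of [lcpt_arr] are not required to be closed, as
   they are in the library predicate [locally_compact], since the space of arrows
   need not be Hausdorff. *)
Record is_boolean_groupoid (G : groupoid_data) : Prop := IsBooleanGroupoid {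
  btgroupoid : is_topological_groupoid G;
  lcpt_arr : forall g : G, exists2 K, nbhs g K & compact K;
  gdom_lhomeo : local_homeomorphism (@gdom G);
  gcod_lhomeo : local_homeomorphism (@gcod G);
  boolean_obj : boolean_space (gobj G) }.

Record boolGroupoid := BoolGroupoid {
  bgdata :> groupoid_data;
  bgdataP : is_boolean_groupoid bgdata }.

Record action_data (H G : groupoid_data) := ActionData {
  moment : G -> gobj H;
  act : forall (eta : H) (g : G), gdom eta = moment g -> G }.

Arguments act {_ _} a eta g _.

(* [moment_mul] and [dom_act] say that both sides of [actC] are defined when
   [act a eta g] and the product of [g] and [g'] are. *)
Record is_multiplier_action (H G : groupoid_data) (a : action_data H G)
  : Prop := IsMultiplierAction {
    moment_cts : continuous (moment a);
    act_cts : continuous (on_fibprod (@act _ _ a));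
    act_unit : forall g p, act a (gunit (moment a g)) g p = g;
    moment_act : forall eta g p, moment a (act a eta g p) = gcod eta;
    actA : forall eta eta' g p q p' q',
      act a eta (act a eta' g q) p' = act a (gmul eta eta' p) g q';
    moment_mul : forall g g' p, moment a (gmul g g' p) = moment a g;
    dom_act : forall eta g p, gdom (act a eta g p) = gdom g;
    actC : forall eta g g' p q p' q',
      act a eta (gmul g g' p) p' = gmul (act a eta g q) g' q' }.

Arguments actA {H G a} _ {eta eta' g} p q p' q'.
Arguments actC {H G a} _ {eta g g'} p q p' q'.

Definition moment0 (H G : groupoid_data) (a : action_data H G) :
  gobj G -> gobj H := fun x => moment a (gunit x).

Definition proper_map (X Y : topologicalType) (f : X -> Y) :=
  continuous f /\ forall K, compact K -> compact (f @^-1` K).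

Definition is_proper_multiplier_action (H G : groupoid_data)
    (a : action_data H G) :=
  is_multiplier_action a /\ proper_map (moment0 a).

Record multiplier (H G : boolGroupoid) := Multiplier {
  mact :> action_data H G;
  mactP : is_proper_multiplier_action mact }.

Section GroupoidCategory.

Lemma action_data_eq (H G : groupoid_data) (a b : action_data H G) :
  moment a = moment b ->
  (forall eta g p q, act a eta g p = act b eta g q) -> a = b.
Proof.
case: a b => [r a] [r' b] /= rr'; case: _ / rr' b => b ab; congr ActionData.
apply: functional_extensionality_dep => eta.
apply: functional_extensionality_dep => g.
by apply: functional_extensionality_dep => p.
Qed.

Lemma multiplier_eq (H G : boolGroupoid) (a b : multiplier H G) :
  moment a = moment b ->
  (forall eta g p q, act a eta g p = act b eta g q) -> a = b.
Proof.
move=> h1 h2; have := action_data_eq h1 h2.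
case: a b {h1 h2} => [a aP] [b bP] /= ab; case: _ / ab bP => bP.
by rewrite (Prop_irrelevance aP bP).
Qed.

Definition act_congr (H G : groupoid_data) (a : action_data H G)
  eta eta' g g' p p' : eta = eta' -> g = g' ->
  act a eta g p = act a eta' g' p'.
Proof. by move=> e1 e2; subst; congr act; exact: Prop_irrelevance. Qed.

Lemma gmul_congr (G : groupoid_data) (g g' h h' : G) p p' :
  g = g' -> h = h' -> gmul g h p = gmul g' h' p'.
Proof. by move=> e1 e2; subst; congr gmul; exact: Prop_irrelevance. Qed.

Definition action_id (G : groupoid_data) : action_data G G :=
  ActionData (@gmul G).

Lemma action_idP (G : boolGroupoid) :
  is_proper_multiplier_action (action_id G).
Proof.
have [[gG gdc gcc guc gic gmc] _ _ _ _] := bgdataP G.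
have m0 : moment0 (action_id G) = id.
  by apply/funext => x; rewrite /moment0 /= gcod_unit.
split; last by rewrite m0; split => // x; exact: cvg_id.
split=> //=.
- exact: g1mul.
- by move=> *; exact: gcod_mul.
- by move=> *; exact: gmulA.
- by move=> *; exact: gcod_mul.
- by move=> *; exact: gdom_mul.
- by move=> *; exact: gmulA.
Qed.

Definition multiplier_id (G : boolGroupoid) := Multiplier (action_idP G).

Lemma moment_cod (H G : boolGroupoid) (a : multiplier H G) g :
  moment a g = moment0 a (gcod g).
Proof.
have gG := tgroupoid (btgroupoid (bgdataP G)).
have h : gdom (gunit (gcod g)) = gcod g by rewrite (gdom_unit gG).
by rewrite -{1}(g1mul gG h) (moment_mul (mactP a).1).
Qed.

Section Composition.
Context (K H G : boolGroupoid) (a : multiplier H G) (b : multiplier K H).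

Let aM : is_multiplier_action a := (mactP a).1.
Let bM : is_multiplier_action b := (mactP b).1.
Let gH : is_groupoid H := tgroupoid (btgroupoid (bgdataP H)).

Lemma action_comp_subproof kappa g
  (p : gdom kappa = moment0 b (moment a g)) :
  gdom (act b kappa (gunit (moment a g)) p) = moment a g.
Proof. by rewrite (dom_act bM) (gdom_unit gH). Qed.

Definition action_comp : action_data K G :=
  @ActionData K G (fun g => moment0 b (moment a g))
    (fun kappa g p =>
       act a (act b kappa (gunit (moment a g)) p) g (action_comp_subproof p)).

Lemma action_compP : is_proper_multiplier_action action_comp.
Proof.
have [[_ gdc gcc guc gic gmc] _ _ _ _] := bgdataP H.
have c0 : continuous (moment0 action_comp).
  have [_ [ca _]] := mactP a; have [_ [cb _]] := mactP b.
  by move=> x; apply: (continuous_comp (ca x)); exact: cb.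
split; last first.
  split=> // C cC; have [_ [_ pa]] := mactP a; have [_ [_ pb]] := mactP b.
  by have := pa _ (pb _ cC).
have cm : continuous (@gunit H \o moment a).
  by move=> g; apply: continuous_comp; [exact: (moment_cts aM) | exact: guc].
split.
- move=> g; apply: (@continuous_comp _ _ _ (moment a) (moment0 b)).
    exact: (moment_cts aM).
  by have [_ [cb _]] := mactP b; exact: cb.
- pose F := fibprod (@gdom K) (moment action_comp).
  have h (z : F) : gdom (val z).1 = moment b (gunit (moment a (val z).2)).
    exact: (set_mem (valP z)).
  have h' (z : F) := action_comp_subproof (h z).
  pose u (z : F) := act b _ _ (h z).
  have cu : continuous u.
    have -> : u = on_fibprod (@act _ _ b) \o (fun z => fibpair (h z)).
      by apply/funext => z; rewrite /= on_fibprodE.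
    move=> z; apply: continuous_comp; last exact: (act_cts bM).
    apply: fibpair_continuous; first exact: fibprod_fst.
    move=> w; apply: (@continuous_comp _ _ _ (fun z : F => (val z).2)
      (@gunit H \o moment a)).
      exact: fibprod_snd.
    exact: cm.
  have -> : on_fibprod (@act _ _ action_comp) =
      on_fibprod (@act _ _ a) \o (fun z => fibpair (h' z)).
    apply/funext => z; rewrite /= on_fibprodE /on_fibprod /=.
    by apply: act_congr => //; exact: act_congr.
  move=> z; apply: continuous_comp; last exact: (act_cts aM).
  by apply: fibpair_continuous => //; exact: fibprod_snd.
- move=> g p /=; have h : gdom (gunit (moment a g)) = moment a g.
    by rewrite (gdom_unit gH).
  rewrite -[RHS](act_unit aM h); apply: act_congr => //.
  by rewrite -[RHS](act_unit bM p); exact: act_congr.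
- move=> kappa g p /=.
  by rewrite (moment_act aM) -moment_cod (moment_act bM).
- move=> k k' g p q p' q' /=.
  have e : moment a (act a (act b k' (gunit (moment a g)) q) g
      (action_comp_subproof q)) = gcod (act b k' (gunit (moment a g)) q).
    by rewrite (moment_act aM).
  set x := act b k' _ q in e *.
  have k1 : gdom k = moment b x by rewrite (moment_act bM).
  have k2 : gdom (gunit (gcod x)) = gcod x by rewrite (gdom_unit gH).
  have k3 : gdom k = moment b (gunit (gcod x)) by rewrite p' /= e.
  have k4 : gdom (act b k (gunit (gcod x)) k3) = gcod x.
    by rewrite (dom_act bM) k2.
  have k5 : gdom (gmul _ _ k4) = moment a g.
    by rewrite (gdom_mul gH) (dom_act bM) (gdom_unit gH).
  transitivity (act a (gmul _ _ k4) g k5).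
    have xg : gdom x = moment a g := action_comp_subproof q.
    have k6 : gdom (act b k (gunit (gcod x)) k3) = moment a (act a x g xg).
      by rewrite k4 (moment_act aM).
    rewrite -(actA aM k4 xg k6 k5).
    by apply: act_congr; [apply: act_congr => //; rewrite e | exact: act_congr].
  apply: act_congr => //.
  have k7 : gdom k = moment b (gmul _ _ k2) by rewrite (g1mul gH).
  rewrite -(actC bM k2 k3 k7 k4) -(actA bM p q k1 q').
  by apply: act_congr => //; rewrite (g1mul gH).
- move=> g g' p /=; by rewrite (moment_mul aM).
- by move=> k g p /=; rewrite (dom_act aM).
- move=> k g g' p q p' q' /=.
  have k2 : gdom (act b k _ q) = moment a (gmul g g' p).
    by rewrite (moment_mul aM) action_comp_subproof.
  rewrite -(actC aM p (action_comp_subproof q) k2 q').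
  by apply: act_congr => //; apply: act_congr => //; rewrite (moment_mul aM).
Qed.

Definition multiplier_comp := Multiplier action_compP.

End Composition.

Lemma multiplier_comp_idl (H G : boolGroupoid) (a : multiplier H G) :
  multiplier_comp (multiplier_id G) a = a.
Proof.
have [aM _] := mactP a; have gG := tgroupoid (btgroupoid (bgdataP G)).
apply: multiplier_eq => /=; first by apply/funext => g; rewrite -moment_cod.
move=> eta g p q; have h : gdom (gunit (gcod g)) = gcod g.
  by rewrite (gdom_unit gG).
have q0 : gdom eta = moment a (gunit (gcod g)) := p.
have q1 : gdom eta = moment a (gmul _ _ h) by rewrite (moment_mul aM).
have q2 : gdom (act a eta (gunit (gcod g)) q0) = gcod g.
  by rewrite (dom_act aM).
transitivity (gmul (act a eta _ q0) g q2).
  by apply: gmul_congr => //; exact: act_congr.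
rewrite -(actC aM h q0 q1 q2); apply: act_congr => //; exact: (g1mul gG).
Qed.

Lemma multiplier_comp_idr (H G : boolGroupoid) (a : multiplier H G) :
  multiplier_comp a (multiplier_id H) = a.
Proof.
have gH := tgroupoid (btgroupoid (bgdataP H)).
apply: multiplier_eq => /=.
  by apply/funext => g; rewrite /moment0 /= (gcod_unit gH).
move=> eta g p q; apply: act_congr => //.
have h : gdom eta = gcod (gunit (gdom eta)) by rewrite (gcod_unit gH).
by rewrite -[RHS](gmul1 gH h); apply: gmul_congr => //; rewrite q.
Qed.

Lemma multiplier_compA (K L H G : boolGroupoid) (a : multiplier H G)
    (b : multiplier L H) (c : multiplier K L) :
  multiplier_comp a (multiplier_comp b c) =
  multiplier_comp (multiplier_comp a b) c.
Proof.
by apply: multiplier_eq => //= k g p q; do ?apply: act_congr.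
Qed.

Definition bgroupoid_cat : category :=
  Category multiplier_comp_idl multiplier_comp_idr multiplier_compA.

End GroupoidCategory.

Section GermGroupoid.
Local Open Scope group_scope.
Context (G : boolInvSemigroup).
Implicit Types (s t e f : G) (x y : dual G) (g h : germ G).

Let isG : is_inverse_semigroup G. Proof. by case: (bsortP G). Qed.

Lemma sdom_idem e : idem e -> sdom e = e.
Proof. by move=> ee; rewrite /sdom star_idem. Qed.

Lemma germ_inv_subproof s x (xs : x (sdom s)) : phi xs (sdom (star s)).
Proof.
split; first exact: idem_dom.
by rewrite {1}/sdom starK// !mulgA mulsV.
Qed.

Lemma germ_mul_subproof s t x (xt : x (sdom t)) :
  phi xt (sdom s) -> x (sdom (s * t)).
Proof. by case=> _; rewrite sdomM. Qed.

(* The operations are computed on the representatives chosen by [repr]; that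
   they do not depend on them is the content of [germ_domE], [germ_codE],
   [germ_unitE], [germ_invE] and [germ_mulE] below. *)
Definition germ_dom g : dual G := pg_pt (repr g).

Definition germ_cod g : dual G := phi (pg_in (repr g)).

Definition germ_inv g : germ G := mkgerm (germ_inv_subproof (pg_in (repr g))).

Lemma germ_unit_subproof x e : x e -> x (sdom e).
Proof. by move=> xe; rewrite sdom_idem//; exact: (pf_idem (dptP x)). Qed.

Definition germ_unit x : germ G :=
  mkgerm (germ_unit_subproof (proj2_sig (cid (pf_ex (dptP x))))).

Definition germ_mul g h (p : germ_dom g = germ_cod h) : germ G :=
  mkgerm (germ_mul_subproof
    (eq_ind _ (fun x : dual G => x (sdom (pg_elt (repr g))))
       (pg_in (repr g)) _ p)).

Definition germ_groupoid : groupoid_data :=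
  @GroupoidData (dual G) (germ G) germ_dom germ_cod germ_unit germ_inv germ_mul.

Lemma phi_eq s t x e (xs : x (sdom s)) (xt : x (sdom t)) :
  idem e -> x e -> s * e = t * e -> phi xs = phi xt.
Proof.
move=> ee xe ste; apply: dual_eq; apply/seteqP.
suff main u v : u * e = v * e -> forall f, phi_set u x f -> phi_set v x f.
  by split; apply: main.
move=> uve f [ff xf]; split=> //.
have xP := dptP x.
have h w : e * (star w * f * w) * e = star (w * e) * f * (w * e).
  by rewrite starM// (star_idem isG ee) !mulgA.
have xvf : x (e * (star v * f * v) * e).
  by rewrite h -uve -h; do 2?apply: (pf_mul xP).
have iv := idem_conj isG v ff.
apply: (pf_up xP xvf) => //; move: (star v * f * v) iv => A iv.
apply/sle_idemE => //; first by do 2?apply: (idemM isG).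
by rewrite (idemC isG ee iv) !mulgA iv.
Qed.

Lemma germ_domE s x (xs : x (sdom s)) : germ_dom (mkgerm xs) = x.
Proof.
rewrite /germ_dom.
have : mkgerm (pg_in (repr (mkgerm xs))) = mkgerm xs.
  by rewrite /mkgerm /germ_of; case: (repr _) (reprK (mkgerm xs)).
by move=> /eq_germ[].
Qed.

Lemma germ_reprE s x (xs : x (sdom s)) :
  exists e, [/\ idem e, x e & s * e = pg_elt (repr (mkgerm xs)) * e].
Proof.
have : mkgerm (pg_in (repr (mkgerm xs))) = mkgerm xs.
  by rewrite {1}/mkgerm /germ_of; case: (repr _) (reprK (mkgerm xs)).
by move=> /esym/eq_germ[].
Qed.

Lemma germ_codE s x (xs : x (sdom s)) : germ_cod (mkgerm xs) = phi xs.
Proof.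
have [e [ee xe h]] := germ_reprE xs; rewrite /germ_cod.
move: (pg_in _); rewrite -/(germ_dom _) germ_domE => ys.
by apply: (@phi_eq _ _ _ e).
Qed.

Lemma germ_unitE e x (xe : x e) :
  germ_unit x = mkgerm (germ_unit_subproof xe).
Proof.
rewrite /germ_unit; case: cid => f xf /=; apply/eq_germ; split=> //.
have ee := pf_idem (dptP x) xe; have ff := pf_idem (dptP x) xf.
exists (f * e); split; [exact: idemM | exact: (pf_mul (dptP x)) |].
by rewrite mulgA ff mulgA (idemC isG ee ff) -mulgA ee.
Qed.

Lemma germ_invE s x (xs : x (sdom s)) :
  germ_inv (mkgerm xs) = mkgerm (germ_inv_subproof xs).
Proof.
have [e [ee xe h]] := germ_reprE xs; rewrite /germ_inv.
move: (pg_in _); rewrite -/(germ_dom _) germ_domE => ys.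
apply/eq_germ; split; first by apply/esym; apply: (@phi_eq _ _ _ e).
set t := pg_elt _ in h ys *.
have ese : e * star s = e * star t.
  by have := congr1 (@star G) h; rewrite !(starM isG) (star_idem isG ee).
have sts : s * e * star s = t * e * star t.
  have eE u : u * e * star u = (u * e) * (e * star u).
    by rewrite mulgA -(mulgA u e e) ee.
  by rewrite eE h ese -eE.
have idc u : star u * (u * e * star u) = e * star u.
  rewrite !mulgA -/(sdom u) (idemC isG (idem_dom isG u) ee) -mulgA.
  by rewrite /sdom mulsV.
exists (s * e * star s); split; last by rewrite idc sts idc.
  by have := idem_conj isG (star s) ee; rewrite starK.
split; first by have := idem_conj isG (star s) ee; rewrite starK.
rewrite sts idc -mulgA -/(sdom t).
exact: (pf_mul (dptP x)).
Qed.

Lemma germ_mul_eq s s' t t' e f x (xst : x (sdom (s * t)))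
    (xst' : x (sdom (s' * t'))) (xt : x (sdom t)) :
  idem e -> phi xt e -> s * e = s' * e ->
  idem f -> x f -> t * f = t' * f -> mkgerm xst = mkgerm xst'.
Proof.
move=> ee [_ te] se ff xf tf; apply/eq_germ; split=> //.
have it u : idem (star u * e * u) by exact: idem_conj.
have fE u : star u * e * u * f = star (u * f) * e * (u * f).
  rewrite (starM isG) (star_idem isG ff) !mulgA -(mulgA f) -(mulgA f).
  by rewrite (idemC isG ff (it u)) -!mulgA ff.
exists (star t * e * t * f); split.
- exact: idemM.
- exact: (pf_mul (dptP x)).
- have h u v : u * v * (star v * e * v * f) = u * e * v * f.
    by rewrite -(mulgA u e) (idem_mul isG v ee) !mulgA.
  rewrite h fE tf -fE h -!mulgA tf !mulgA se; congr (_ * _).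
Qed.

Lemma germ_mulE s t x (xt : x (sdom t)) (xs : phi xt (sdom s))
    (p : germ_dom (mkgerm xs) = germ_cod (mkgerm xt)) :
  germ_mul p = mkgerm (germ_mul_subproof xs).
Proof.
rewrite /germ_mul; move: (germ_mul_subproof _).
have [e [ee xe se]] := germ_reprE xs.
have [f [ff xf tf]] := germ_reprE xt.
rewrite -/(germ_dom (mkgerm xt)) germ_domE => xst.
by apply/esym; apply: (germ_mul_eq _ _ ee xe se ff xf tf).
Qed.

End GermGroupoid.

Section GermMap.
Local Open Scope group_scope.
Context (H G : boolInvSemigroup) (j : bis_morphism H G).

Let isG : is_inverse_semigroup G. Proof. by case: (bsortP G). Qed.
Let isH : is_inverse_semigroup H. Proof. by case: (bsortP H). Qed.
Let jP : is_bis_morphism j := bmorP j.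

Lemma bmor_sdom s : sdom (j s) = j (sdom s).
Proof. by rewrite /sdom bmor_star// (bmorM jP). Qed.

Lemma prime_filter_dual_map (x : dual G) :
  prime_filter [set e : H | idem e /\ x (j e)].
Proof.
have xP := dptP x; split.
- by move=> e [].
- have [e xe] := pf_ex xP; have ee := pf_idem xP xe.
  have [f ff ef] := bmor_nondeg jP ee; exists f; split=> //.
  by apply: (pf_up xP xe) => //; exact: bmor_idem.
- by move=> z z0 [_]; apply: (pf_zero xP); exact: (bmor0 jP).
- move=> e f [ee xe] [ff xf]; split; first exact: (idemM isH).
  by rewrite (bmorM jP); exact: (pf_mul xP).
- move=> e f [ee xe] ff ef; split=> //.
  by apply: (pf_up xP xe); [exact: bmor_idem | exact: bmor_sle].
- move=> e f g ee ff efg [gg xg].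
  have [] := pf_prime xP (bmor_idem jP ee) (bmor_idem jP ff)
    (bmorU jP ee ff efg) xg; first by left.
  by right.
Qed.

Definition dual_map (x : dual G) : dual H := Dual (prime_filter_dual_map x).

Lemma germ_act_subproof s t (x : dual G) (xt : x (sdom t)) :
  dual_map (phi xt) (sdom s) -> x (sdom (j s * t)).
Proof. by case=> _ [_]; rewrite -bmor_sdom sdomM. Qed.

(* [germ_actE] below shows that the choice of representatives is immaterial. *)
Definition germ_act (eta : germ_groupoid H) (g : germ_groupoid G)
    (p : gdom eta = dual_map (gcod g)) : germ_groupoid G :=
  mkgerm (germ_act_subproof
    (eq_ind _ (fun x : dual H => x (sdom (pg_elt (repr eta))))
       (pg_in (repr eta)) _ p)).

Definition germ_action : action_data (germ_groupoid H) (germ_groupoid G) :=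
  ActionData germ_act.

Lemma germ_actE s t (x : dual G) (xt : x (sdom t))
    (xs : dual_map (phi xt) (sdom s))
    (p : gdom (mkgerm xs : germ_groupoid H) =
         dual_map (gcod (mkgerm xt : germ_groupoid G))) :
  germ_act p = mkgerm (germ_act_subproof xs).
Proof.
rewrite /germ_act; move: (germ_act_subproof _).
have [e [ee [_ xe] se]] := germ_reprE xs.
have [f [ff xf tf]] := germ_reprE xt.
rewrite -/(germ_dom (mkgerm xt)) germ_domE => xst.
apply/esym; apply: (germ_mul_eq _ _ (bmor_idem jP ee) xe _ ff xf tf).
by rewrite -!(bmorM jP) se.
Qed.

End GermMap.

Definition compact_open_bisection (G : groupoid_data) (S : set G) :=
  [/\ compact S, open S, set_inj S (@gdom G) & set_inj S (@gcod G)].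

Definition gset_mul (G : groupoid_data) (S T : set G) : set G :=
  [set g | exists h k (p : gdom h = gcod k), [/\ S h, T k & g = gmul h k p]].

Definition gset_act (H G : groupoid_data) (a : action_data H G)
    (S : set H) (T : set G) : set G :=
  [set g | exists eta h (p : gdom eta = moment a h),
     [/\ S eta, T h & g = act a eta h p]].

Section Bisections.

Lemma lhomeo_open (X Y : topologicalType) (f : X -> Y) (A : set X) :
  local_homeomorphism f -> open A -> open (f @` A).
Proof.
move=> fl oA; rewrite openE => _ [x Ax <-].
have [U [oU Ux _ _ fU]] := fl x.
apply: (@filterS _ _ _ (f @` (A `&` U))).
  by move=> _ [y [Ay _] <-]; exists y.
apply: open_nbhs_nbhs; split; last by exists x.
by apply: fU; [exact: openI | move=> y []].
Qed.

Lemma closed_diagonal (X : topologicalType) :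
  hausdorff_space X -> closed [set p : X * X | p.1 = p.2].
Proof.
move=> hX [x y] clxy /=; apply: hX => A B nA nB.
have [[z z'] [/= zz' [/= Az Bz]]] : ([set p : X * X | p.1 = p.2] `&` A `*` B) !=set0.
  by apply: clxy; exists (A, B).
by exists z; split=> //; rewrite zz'.
Qed.

Lemma open_comp_cts (X Y : topologicalType) (f : X -> Y) (A : set Y) :
  continuous f -> open A -> open (f @^-1` A).
Proof. by move=> /continuousP; exact. Qed.

Lemma unit_open (G : boolGroupoid) (W : set (gobj G)) :
  open W -> open (@gunit G @` W).
Proof.
move=> oW; have [[gG gdc gcc guc gic gmc] _ gdl _ _] := bgdataP G.
rewrite openE => _ [x Wx <-].
have [U [oU Ux Uinj _ _]] := gdl (gunit x).
have oV : open (W `&` @gunit G @^-1` U).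
  by apply: openI => //; exact: open_comp_cts.
apply: (@filterS _ _ _ (U `&` @gdom G @^-1` (W `&` @gunit G @^-1` U))).
  move=> g [Ug [Wg Ugg]]; exists (gdom g) => //.
  by apply: Uinj; rewrite ?inE// (gdom_unit gG).
apply: open_nbhs_nbhs; split; last by rewrite /= (gdom_unit gG).
by apply: openI => //; exact: open_comp_cts.
Qed.

Lemma unit_bisection (G : boolGroupoid) (W : set (gobj G)) :
  compact W -> open W -> compact_open_bisection (@gunit G @` W).
Proof.
move=> cW oW; have [[gG gdc gcc guc gic gmc] _ _ _ _] := bgdataP G.
split.
- by apply: continuous_compact => //; apply: continuous_subspaceT.
- exact: unit_open.
- move=> _ _ /set_mem[x _ <-] /set_mem[y _ <-].
  by rewrite !(gdom_unit gG) => ->.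
- move=> _ _ /set_mem[x _ <-] /set_mem[y _ <-].
  by rewrite !(gcod_unit gG) => ->.
Qed.

Lemma gset_act_open (H G : boolGroupoid) (a : multiplier H G) S T :
  open S -> open T -> open (gset_act a S T).
Proof.
move=> oS oT; have [aM _] := mactP a.
have [[gH hdc hcc huc hic hmc] _ hdl hcl _] := bgdataP H.
rewrite openE => _ [eta [h [p [Seta Th ->]]]].
pose F := fibprod (fun z : H => gcod z) (moment a).
have invd (z : H) k : gcod z = moment a k -> gdom (ginv z) = moment a k.
  by rewrite (gdom_inv gH).
pose m (z : F) := act a (ginv (val z).1) (val z).2 (invd _ _ (set_mem (valP z))).
have cm : continuous m.
  have h1 (z : F) : gdom (ginv (val z).1) = moment a (val z).2.
    exact: (invd _ _ (set_mem (valP z))).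
  have -> : m = on_fibprod (@act _ _ a) \o (fun z : F => fibpair (h1 z)).
    by apply/funext => z; rewrite /= on_fibprodE; exact: act_congr.
  move=> z; apply: continuous_comp; last exact: (act_cts aM).
  apply: fibpair_continuous; last exact: fibprod_snd.
  move=> w; apply: (@continuous_comp _ _ _ (fun z : F => (val z).1) (@ginv H)).
    exact: fibprod_fst.
  exact: hic.
have q : gcod eta = moment a (act a eta h p) by rewrite (moment_act aM).
have mE : m (fibpair q) = h.
  have r : gdom (ginv eta) = gcod eta by rewrite (gdom_inv gH).
  have r' : gdom (gmul (ginv eta) eta r) = moment a h.
    by rewrite (gdom_mul gH).
  have r'' : gdom (gunit (gdom eta)) = moment a h by rewrite (gdom_unit gH).
  have -> : m (fibpair q) = act a (ginv eta) (act a eta h p) (etrans r q).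
    exact: act_congr.
  rewrite (actA aM r p (etrans r q) r').
  have u1 : gdom (gunit (moment a h)) = moment a h by rewrite (gdom_unit gH).
  rewrite -[RHS](act_unit aM u1); apply: act_congr => //.
  by rewrite (gmulVl gH) p.
have : nbhs (fibpair q) (m @^-1` T).
  by apply: cm; rewrite mE; exact: open_nbhs_nbhs.
case=> _ [[B oB <-] Bq BT].
move: oB; rewrite openE => /(_ _ Bq)[[/= A1 A2] [/= nA1 nA2] A12].
pose A := (S `&` A1)°.
have oA : open A by exact: open_interior.
have Aeta : A eta.
  by apply: filterI => //; exact: open_nbhs_nbhs.
have SA : A `<=` S `&` A1 by exact: interior_subset.
have ncA : nbhs (moment a (act a eta h p)) (@gcod H @` A).
  rewrite -q; apply: open_nbhs_nbhs; split; last by exists eta.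
  exact: lhomeo_open.
have nA : nbhs (act a eta h p) (moment a @^-1` (@gcod H @` A)).
  exact: (moment_cts aM).
have {}nA2 : nbhs (act a eta h p) A2 by exact: nA2.
apply: (@filterS _ (nbhs (act a eta h p)) _ _ _ _ (filterI nA nA2)).
move=> g [[zeta Az zg] A2g].
have [Sz A1z] := SA _ Az.
have Tg : T (m (fibpair zg)) by apply: BT; exact: (A12 (zeta, g)).
have s : gdom zeta = moment a (m (fibpair zg)).
  by rewrite /m (moment_act aM) (gcod_inv gH).
exists zeta, (m (fibpair zg)), s; split=> //.
have i1 : gdom zeta = gcod (ginv zeta) by rewrite (gcod_inv gH).
have i2 : gdom (gmul zeta (ginv zeta) i1) = moment a g.
  by rewrite (gdom_mul gH) (gdom_inv gH).
rewrite (actA aM i1 _ _ i2).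
have u1 : gdom (gunit (moment a g)) = moment a g by rewrite (gdom_unit gH).
rewrite -[LHS](act_unit aM u1); apply: act_congr => //.
by rewrite (gmulV gH) zg.
Qed.

Lemma gset_act_compact (H G : boolGroupoid) (a : multiplier H G) S T :
  compact S -> compact T -> compact (gset_act a S T).
Proof.
move=> cS cT; have [aM _] := mactP a.
have [[gH hdc hcc huc hic hmc] _ _ _ [_ hausH _]] := bgdataP H.
pose F := fibprod (@gdom H) (moment a).
have clF : closed F.
  have -> : F = (fun p => (gdom p.1, moment a p.2)) @^-1`
      [set p : gobj H * gobj H | p.1 = p.2] by [].
  apply: preimage_closed; last exact: closed_diagonal.
  move=> p _; apply: cvg_pair.
    by apply: (@continuous_comp _ _ _ fst (@gdom H)); [exact: cvg_fst | exact: hdc].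
  apply: (@continuous_comp _ _ _ snd (moment a)); first exact: cvg_snd.
  exact: (moment_cts aM).
have cC : compact (F `&` S `*` T).
  by rewrite setIC; apply: compact_closedI => //; exact: compact_setX.
pose f (p : H * G) : G :=
  if pselect (F p) is left h then act a p.1 p.2 h else p.2.
have cf : {within F, continuous f}.
  apply/subspace_sigL_continuousP.
  have -> : sigL F f = on_fibprod (@act _ _ a).
    apply/funext => z; rewrite /sigL /= /f; case: pselect => [h|[]].
      by rewrite /on_fibprod; exact: act_congr.
    exact: (set_mem (valP z)).
  exact: (act_cts aM).
have -> : gset_act a S T = f @` (F `&` S `*` T).
  apply/seteqP; split=> [_ [eta [h [p [Se Th ->]]]]|_ [[eta h] [p [Se Th]] <-]].
    by exists (eta, h) => //; rewrite /f; case: pselect => // ?;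
      exact: act_congr.
  by exists eta, h, p; split=> //; rewrite /f; case: pselect => // ?;
      exact: act_congr.
apply: continuous_compact cC.
by apply: continuous_subspaceW cf => p [].
Qed.

Lemma back_subproof (H G : boolGroupoid) (a : multiplier H G) e k
    (q : gdom e = moment a k) :
  gdom (ginv e) = moment a (gunit (gcod (act a e k q))).
Proof.
have gH := tgroupoid (btgroupoid (bgdataP H)).
rewrite (gdom_inv gH) -/(moment0 a _) -moment_cod.
by rewrite (moment_act (mactP a).1).
Qed.

Lemma gcod_back (H G : boolGroupoid) (a : multiplier H G) e k
    (q : gdom e = moment a k) :
  gcod k = gcod (act a (ginv e) (gunit (gcod (act a e k q))) (back_subproof q)).
Proof.
have gH := tgroupoid (btgroupoid (bgdataP H)).
have gG := tgroupoid (btgroupoid (bgdataP G)).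
have [aM _] := mactP a; set g := act a e k q.
have gg : gdom (gunit (gcod g)) = gcod g by rewrite (gdom_unit gG).
have q1 : gdom (ginv e) = moment a g by rewrite (gdom_inv gH) (moment_act aM).
have q2 : gdom (ginv e) = moment a (gmul _ _ gg) by rewrite (g1mul gG).
have q3 : gdom (act a (ginv e) _ (back_subproof q)) = gcod g.
  by rewrite (dom_act aM).
rewrite -(gcod_mul gG q3) -(actC aM gg (back_subproof q) q2 q3).
rewrite (act_congr q2 q1 erefl (g1mul gG gg)).
have r : gdom (ginv e) = gcod e by rewrite (gdom_inv gH).
have r' : gdom (gmul (ginv e) e r) = moment a k by rewrite (gdom_mul gH).
rewrite (actA aM r q q1 r').
have u1 : gdom (gunit (moment a k)) = moment a k by rewrite (gdom_unit gH).
rewrite -[in LHS](act_unit aM u1); congr gcod; apply: act_congr => //.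
by rewrite (gmulVl gH) q.
Qed.

Lemma gset_act_bisection (H G : boolGroupoid) (a : multiplier H G) S T :
  compact_open_bisection S -> compact_open_bisection T ->
  compact_open_bisection (gset_act a S T).
Proof.
move=> [cS oS Sd Sc] [cT oT Td Tc]; have [aM _] := mactP a.
have gH := tgroupoid (btgroupoid (bgdataP H)).
split; [exact: gset_act_compact | exact: gset_act_open | |].
- move=> _ _ /set_mem[e [h [p [Se Th ->]]]] /set_mem[e' [h' [p' [Se' Th' ->]]]].
  rewrite !(dom_act aM) => /(Td _ _ (mem_set Th) (mem_set Th')) hh'.
  by apply: act_congr => //; apply: Sd; rewrite ?inE// p p' hh'.
- move=> _ _ /set_mem[e [h [p [Se Th ->]]]] /set_mem[e' [h' [p' [Se' Th' ->]]]].
  move=> cc; have ee' : e = e'.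
    apply: Sc; rewrite ?inE//.
    by rewrite -(moment_act aM p) -(moment_act aM p') !moment_cod cc.
  subst e'; apply: act_congr => //; apply: Tc; rewrite ?inE//.
  have back k (q : gdom e = moment a k) : gcod k = gcod (act a (ginv e)
      (gunit (gcod (act a e k q))) (back_subproof q)).
    exact: gcod_back.
  by rewrite (back _ p) (back _ p'); congr gcod; apply: act_congr => //; rewrite cc.
Qed.

Lemma gset_mul_bisection (G : boolGroupoid) (S T : set G) :
  compact_open_bisection S -> compact_open_bisection T ->
  compact_open_bisection (gset_mul S T).
Proof. exact: (@gset_act_bisection _ _ (multiplier_id G)). Qed.

(* [range gunit] is [G^(0)], and [S G^(0)] is [S V] for the compact
   open set of units [V] on which [S] acts. *)
Lemma gset_act_unit_bisection (H G : boolGroupoid) (a : multiplier H G) S :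
  compact_open_bisection S ->
  compact_open_bisection (gset_act a S (range (@gunit G))).
Proof.
move=> Sb; have [cS oS _ _] := Sb; have [aM [ca pa]] := mactP a.
have [[gH hdc _ _ _ _] _ hdl _ _] := bgdataP H.
pose W := moment0 a @^-1` (@gdom H @` S).
have -> : gset_act a S (range (@gunit G)) = gset_act a S (@gunit G @` W).
  apply/seteqP; split=> g [eta [h [p [Se [x _ xh] ->]]]].
    by exists eta, h, p; split=> //; exists x => //; exists eta => //;
      rewrite p -xh.
  by exists eta, h, p; split=> //; exists x.
apply: gset_act_bisection => //; apply: unit_bisection.
  by apply: pa; apply: continuous_compact => //; exact: continuous_subspaceT.
by apply: open_comp_cts => //; exact: lhomeo_open.
Qed.

End Bisections.

Section Bis.
Context (G : boolGroupoid).

Record Bis := Bisection {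
  bisect :> set G;
  bisectP : compact_open_bisection bisect }.

HB.instance Definition _ := gen_eqMixin Bis.
HB.instance Definition _ := gen_choiceMixin Bis.

Lemma Bis_eq (S T : Bis) : bisect S = bisect T -> S = T.
Proof.
by case: S T => [S SP] [T TP] /= ST; case: _ / ST TP => TP;
   rewrite (Prop_irrelevance SP TP).
Qed.

Definition Bis_mul (S T : Bis) : Bis :=
  Bisection (gset_mul_bisection (bisectP S) (bisectP T)).

Lemma Bis_mulA : associative Bis_mul.
Proof.
have gG := tgroupoid (btgroupoid (bgdataP G)).
move=> S T U; apply: Bis_eq => /=; apply/seteqP; split=> g.
  move=> [h [kl [p [Sh [k [l [q [Tk Ul klE]]]] ->]]]]; subst kl.
  have e : gdom h = gcod k by rewrite p (gcod_mul gG).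
  have e' : gdom (gmul h k e) = gcod l by rewrite (gdom_mul gG).
  by exists (gmul h k e), l, e'; split=> //; [exists h, k, e | exact: gmulA].
move=> [hk [l [p [[h [k [q [Sh Tk hkE]]]] Ul ->]]]]; subst hk.
have e : gdom k = gcod l by rewrite -p (gdom_mul gG).
have e' : gdom h = gcod (gmul k l e) by rewrite (gcod_mul gG).
exists h, (gmul k l e), e'; split=> //; first by exists k, l, e.
by apply/esym; exact: gmulA.
Qed.

HB.instance Definition _ := isSemigroup.Build Bis Bis_mulA.

End Bis.

Definition Bis_map (H G : boolGroupoid) (a : multiplier H G) (S : Bis H)
  : Bis G := Bisection (gset_act_unit_bisection a (bisectP S)).

(* Main.v *)
(* The compact open bisections [B s = {[s, x] : x in dom s}] form a base of the
   space of germs, and a germ is determined by its domain and by any [B s] that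
   contains it, so identities between germs reduce to identities in the inverse
   semigroup.  On the semigroup side [s |-> B s] is a natural isomorphism: it is
   injective because prime filters separate ideals of idempotents from
   idempotents, and surjective because a compact open bisection is covered by
   finitely many [B s], which can be made orthogonal and then joined.  On the
   groupoid side an arrow [g] is sent to the germ at [gdom g] of any bisection
   through [g]; this is an isomorphism of topological groupoids, and an
   isomorphism from [A] to [B] makes [A] act on [B] by left multiplication,
   which gives the natural isomorphism of multiplier actions. *)

From HB Require Import structures.
Require Import Defs.
From mathcomp Require Import all_boot all_order finmap.
From mathcomp Require Import all_classical topology.

Set Implicit Arguments.
Unset Strict Implicit.
Unset Printing Implicit Defensive.

Import Order.Theory.

Local Open Scope classical_set_scope.

(** * Inverse semigroups and generalized Boolean algebras of idempotents *)

(** Two gaps between the definitions and their use shape the proof. Joins of idempotents are given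
    only among idempotents, joins of orthogonal pairs in the whole semigroup. Once [idem_join_le]
    closes this gap, elements that agree on two idempotents agree on their join ([join_agree]), so
    the idempotents on which [s] and [t] agree form an ideal, as separation by prime filters
    requires. On the topological side a Boolean space is only assumed totally disconnected, and its
    base of compact open sets has to be derived ([boolean_space_basis]). The space of arrows need
    not be Hausdorff, so its compact subsets need not be closed; compactness of the basic bisections
    is pulled back from the unit space along the domain map ([compact_lift]). Finally the
    idempotents need not have a unit, and the fact that a compact set of the dual lies below a
    single idempotent ([dual_compact_bounded]) takes its place in properness and nondegeneracy. *)

Section InverseSemigroupOrder.
Local Open Scope group_scope.
Context (T : semigroupType) (isT : is_inverse_semigroup T).
Implicit Types s t u e f g z : T.

Lemma sdom_mulr s e : idem e -> sdom (s * e) = sdom s * e.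
Proof.
move=> ee; rewrite /sdom (starM isT) (star_idem isT ee).
rewrite -(mulgA e) (mulgA (star s)) -/(sdom s) (idemC isT (idem_dom isT s) ee).
by rewrite mulgA ee.
Qed.

(** If [s = t * e] then [sdom s = sdom t * e], so the anonymous idempotent can always be taken to be
    [sdom s]. *)
Lemma sleP s t : sle s t <-> t * sdom s = s.
Proof.
split=> [[e ee ->]|<-]; last by exists (sdom s) => //; exact: idem_dom.
by rewrite sdom_mulr// mulgA mul_dom.
Qed.

Lemma sle_anti s t : sle s t -> sle t s -> s = t.
Proof.
move=> /sleP ts /sleP st; rewrite -{1}ts -{1}st -mulgA.
rewrite (idemC isT (idem_dom isT t) (idem_dom isT s)).
by rewrite mulgA (mul_dom isT).
Qed.

Lemma sle_mulr s e : idem e -> sle (s * e) s.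
Proof. by move=> ee; exists e. Qed.

Lemma sle_mull s e : idem e -> sle (e * s) s.
Proof.
by move=> ee; rewrite (idem_mul isT s ee); apply: sle_mulr; exact: idem_conj.
Qed.

Lemma sle_mul s s' t t' : sle s s' -> sle t t' -> sle (s * t) (s' * t').
Proof.
(* The idempotent [e] crosses [t'] from left to right as its conjugate by [t']. *)
move=> [e ee ->] [f ff ->]; exists ((star t' * e * t') * f).
  by apply: idemM => //; exact: idem_conj.
by rewrite -!mulgA; congr (_ * _); rewrite !mulgA (idem_mul isT t' ee) !mulgA.
Qed.

Lemma sle_star s t : sle s t -> sle (star s) (star t).
Proof.
by move=> [e ee ->]; rewrite (starM isT) (star_idem isT ee); exact: sle_mull.
Qed.

Lemma sle_dom s t : sle s t -> sle (sdom s) (sdom t).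
Proof. by move=> st; apply: sle_mul => //; exact: sle_star. Qed.

Lemma sdom_star s : sdom (star s) = sran s.
Proof. by rewrite /sdom (starK isT). Qed.

Lemma sle_idemM e f g : idem e -> idem f -> idem g ->
  sle g e -> sle g f -> sle g (e * f).
Proof.
move=> ee ff gg /(sle_idemE gg ee) ge /(sle_idemE gg ff) gf.
by apply/(sle_idemE gg (idemM isT ee ff)); rewrite -mulgA gf.
Qed.

Lemma is_zero_uniq z z' : is_zero z -> is_zero z' -> z = z'.
Proof. by move=> z0 z'0; rewrite -(z0 z').1 (z'0 z).2. Qed.

Lemma is_zero_idem z : is_zero z -> idem z.
Proof. by move=> z0; case: (z0 z). Qed.

Lemma is_zero_le z s : is_zero z -> sle z s.
Proof. by move=> z0; exists z; [exact: is_zero_idem | rewrite (z0 _).2]. Qed.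

Lemma le_is_zero s z : is_zero z -> sle s z -> is_zero s.
Proof. by move=> z0 [e _ ->]; rewrite (z0 _).1. Qed.

Lemma is_zero_mull z s : is_zero z -> is_zero (z * s).
Proof. by move=> z0; rewrite (z0 _).1. Qed.

Lemma is_zero_mulr z s : is_zero z -> is_zero (s * z).
Proof. by move=> z0; rewrite (z0 _).2. Qed.

Lemma is_zero_dom s : is_zero (sdom s) -> is_zero s.
Proof. by move=> s0; rewrite -(mul_dom isT s); exact: is_zero_mulr. Qed.

Lemma is_join_uniq (A : set T) s t u v :
  is_join_in A s t u -> is_join_in A s t v -> u = v.
Proof.
move=> [Au su tu ulub] [Av sv tv vlub].
by apply: sle_anti; [exact: ulub | exact: vlub].
Qed.

End InverseSemigroupOrder.

(** * Joins of idempotents and the prime filter theorem *)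

Section BooleanInverseSemigroup.
Local Open Scope group_scope.
Context (G : boolInvSemigroup).
Implicit Types (s t u e f g z : G).

Lemma bis_inv : is_inverse_semigroup G. Proof. by case: (bsortP G). Qed.
Let isG := bis_inv.

Lemma bis_zero : exists z : G, is_zero z. Proof. by case: (bsortP G). Qed.

(** Total maps in place of a bijection on a subtype spare the transport of membership proofs. The
    map [P] built here takes the junk value [\bot] off the idempotents, and every clause uses it on
    idempotents only. *)
Lemma idem_lattice : exists (d : Order.disp_t) (L : cbDistrLatticeType d)
  (P : G -> L) (Q : L -> G),
  [/\ forall l, idem (Q l), forall l, P (Q l) = l,
      forall e, idem e -> Q (P e) = e &
      forall e f, idem e -> idem f -> sle e f <-> (P e <= P f)%O].
Proof.
have [_ _ [d [L [phi [[psi phiK psiK] phiE]]]] _] := bsortP G.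
pose P (e : G) := if pselect (idem e) is left ee
  then phi (exist _ e (mem_set ee)) else \bot%O.
have PE e (ee : idem e) : P e = phi (exist _ e (mem_set ee)).
  by rewrite /P; case: pselect => // h; congr phi; exact: val_inj.
exists d, L, P, (fun l => val (psi l)).
have Qi l : idem (val (psi l)) by exact: set_mem (valP (psi l)).
split=> //.
- by move=> l; rewrite (PE _ (Qi l)) -[RHS]psiK; congr phi; exact: val_inj.
- by move=> e ee; rewrite (PE _ ee) phiK.
- by move=> e f ee ff; rewrite (PE _ ee) (PE _ ff) -phiE.
Qed.

Lemma idem_join e f : idem e -> idem f ->
  exists g, is_join_in (@idem G) e f g.
Proof.
move=> ee ff; have [d [L [P [Q [Qi PK QK PE]]]]] := idem_lattice.
exists (Q (P e `|` P f)%O); split=> //.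
- by apply/PE => //; rewrite PK leUl.
- by apply/PE => //; rewrite PK leUr.
- by move=> v vv /PE ev /PE fv; apply/PE => //; rewrite PK leUx ev// fv.
Qed.

Lemma idem_diff e f : idem e -> idem f -> exists c,
  [/\ idem c, sle c e, is_zero (f * c) & is_join_in (@idem G) (e * f) c e].
Proof.
move=> ee ff; have [d [L [P [Q [Qi PK QK PE]]]]] := idem_lattice.
have ef := idemM isG ee ff.
have PM (a b : G) : idem a -> idem b -> P (a * b) = (P a `&` P b)%O.
  move=> aa bb; have ab := idemM isG aa bb.
  apply/eqP; rewrite eq_le lexI; apply/andP; split.
    apply/andP; split; apply/PE => //; first exact: sle_mulr.
    exact: sle_mull.
  rewrite -[leLHS]PK; apply/PE => //.
  apply: sle_idemM => //; apply/PE => //; rewrite PK; [exact: leIl|exact: leIr].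
have ce : sle (Q (P e `\` P f)%O) e by apply/PE => //; rewrite PK leBx.
exists (Q (P e `\` P f)%O); split=> //.
- have [z z0] := bis_zero; apply: (le_is_zero z0).
  apply/(PE _ _ (idemM isG ff (Qi _)) (is_zero_idem z0)).
  by rewrite PM// PK diffKI le0x.
- split=> //; first exact: sle_mulr.
  move=> v vv /PE - /(_ ef vv) h1 /PE - /(_ (Qi _) vv); rewrite PK => h2.
  by apply/PE => //; rewrite -(joinIB (P f) (P e)) leUx -PM// h1.
Qed.

(* [g] is also the join of the orthogonal pair [e], [f \ e], which has a join
   among all elements; that join is below [g], hence idempotent, hence [g]. *)
Lemma idem_join_le e f g s : idem e -> idem f ->
  is_join_in (@idem G) e f g -> sle e s -> sle f s -> sle g s.
Proof.
move=> ee ff [gg eg fg glub] es fs.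
have [c [cc cf fc0 [_ _ _ flub]]] := idem_diff ff ee.
have ec : orthogonal e c.
  by rewrite /orthogonal !star_idem.
have [_ _ _ orth] := bsortP G.
have [w [_ ew cw wlub]] := orth _ _ ec.
have ww : idem w.
  by apply: (sle_idem isG gg); apply: wlub => //; exact: sle_trans fg.
apply: (sle_trans isG (t := w)).
  apply: glub => //; apply: flub => //.
  by apply: (sle_trans isG) ew; exact: sle_mull.
by apply: wlub => //; exact: sle_trans fs.
Qed.

(** Agreement on [e] puts [sdom t * e] below [star t * s], which need not be idempotent; this is why
    [idem_join_le] compares joins with arbitrary elements. It gives [sdom t * g] below [star t * s],
    and multiplication by [t] gives [t * g] below [s]. The roles of [s] and [t] are then
    exchanged. *)
Lemma join_agree s t e f g : idem e -> idem f -> is_join_in (@idem G) e f g ->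
  s * e = t * e -> s * f = t * f -> s * g = t * g.
Proof.
have main u v : idem e -> idem f -> is_join_in (@idem G) e f g ->
  u * e = v * e -> u * f = v * f -> sle (v * g) u.
  move=> ee ff efg uve uvf; have [gg eg fg _] := efg.
  have dv := idem_dom isG v.
  have h a : idem a -> u * a = v * a -> sle (sdom v * a) (star v * u).
    by move=> aa uva; exists a => //; rewrite /sdom -!mulgA uva.
  have := idem_join_le (idemM isG dv ee) (idemM isG dv ff)
    (is_join_mull ee ff dv efg) (h _ ee uve) (h _ ff uvf).
  move=> k; move: (sle_mul isG (sle_refl isG v) k).
  rewrite mulgA (mul_dom isG) mulgA -/(sran v) => /(sle_trans isG); apply.
  exact: sle_mull (idem_ran isG v).
move=> ee ff efg ste stf; have [gg _ _ _] := efg.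
have h u v : sle (v * g) u -> sle (v * g) (u * g).
  by move=> vu; have := sle_mul isG vu (sle_refl isG g); rewrite -mulgA gg.
by apply: (sle_anti isG); apply: h; apply: main.
Qed.

(** The restriction [u * f] is still above [s] and [t], so minimality of [u] bounds its domain by
    [f]. *)
Lemma orthogonal_join_dom s t u f : is_join_in setT s t u ->
  is_join_in (@idem G) (sdom s) (sdom t) f -> sdom u = f.
Proof.
move=> [_ su tu ulub] [ff sf tf flub].
have du := idem_dom isG u.
apply: (sle_anti isG); last first.
  by apply: flub => //; apply: sle_dom.
have /sle_dom : sle u (u * f).
  have h v : sle v u -> sle (sdom v) f -> sle v (u * f).
    by move=> /(sleP isG) uv vf; rewrite -uv; apply: sle_mul => //; exact: sle_refl.
  by apply: ulub => //; exact: h.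
move=> /(_ isG); rewrite sdom_mulr// => /(sle_trans isG); apply.
exact: sle_mull.
Qed.

Record idem_ideal (I : set G) : Prop := IdemIdeal {
  ii_idem : forall e, I e -> idem e;
  ii_zero : forall z, is_zero z -> I z;
  ii_down : forall e f, I f -> idem e -> sle e f -> I e;
  ii_join : forall e f g, I e -> I f -> is_join_in (@idem G) e f g -> I g }.

(** A filter maximal among those containing [e] and avoiding [I] is prime: if [f] and [g] are both
    outside it, some members [a], [b] satisfy [a * f] in [I] and [b * g] in [I], and then [I]
    contains the product of [a * b] with the join of [f] and [g]. *)
Lemma prime_filter_ex (I : set G) e : idem_ideal I -> idem e -> ~ I e ->
  exists x : dual G, x e /\ forall f, I f -> ~ x f.
Proof.
move=> [Ii I0 Id Ij] ee Ie.
(* The union of the empty chain must satisfy [P] too, hence the condition that only a nonempty [A]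
   has to contain [e]. *)
pose P (A : set G) := [/\ forall f, A f -> idem f /\ ~ I f,
  forall f g, A f -> A g -> A (f * g),
  forall f g, A f -> idem g -> sle f g -> A g & A !=set0 -> A e].
have [|A [[Ai AM Aup Ae] Amax]] := @Zorn_bigcup _ P.
  move=> F FP tot; split.
  - by move=> f [X FX Xf]; have [+ _ _ _] := FP _ FX; apply.
  - move=> f g [X FX Xf] [Y FY Yg]; have [XY|YX] := tot _ _ FX FY.
      by exists Y => //; have [_ + _ _] := FP _ FY; apply=> //; exact: XY.
    by exists X => //; have [_ + _ _] := FP _ FX; apply=> //; exact: YX.
  - by move=> f g [X FX Xf] gg fg; exists X => //;
      have [_ _ + _] := FP _ FX; apply; eauto.
  - by move=> [f [X FX Xf]]; exists X => //; have [_ _ _] := FP _ FX; apply;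
      exists f.
pose up (a : G) : set G := [set f | idem f /\
  exists2 b, (A b \/ b = e) & sle (b * a) f].
(* Otherwise [A] would be empty, and the principal filter of [e] would be strictly larger. *)
have {}Ae : A e.
  apply: contrapT => nAe.
  pose B := [set f | idem f /\ sle e f].
  apply: (Amax B); first split.
  - by move=> f Af; case: nAe; apply: Ae; exists f.
  - by move=> /(_ e) h; apply: nAe; apply: h; split=> //; exact: sle_refl.
  split.
  - by move=> f [ff ef]; split=> // If; apply: Ie; exact: Id If _ _.
  - by move=> f g [ff ef] [gg eg]; split; [exact: idemM | exact: sle_idemM].
  - by move=> f g [ff ef] gg fg; split=> //; exact: sle_trans fg.
  - by move=> _; split=> //; exact: sle_refl.
(* By maximality the filter generated by [A] and [f] has to meet [I]. *)
have ext f : idem f -> ~ A f -> exists2 a, A a & I (a * f).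
  move=> ff nAf; apply: contrapT => nex.
  pose B := [set g | idem g /\ exists2 a, A a & sle (a * f) g].
  apply: (Amax B); first split.
  - move=> g Ag; have [gg _] := Ai _ Ag; split=> //; exists g => //.
    exact: sle_mulr.
  - move=> /(_ f) h; apply: nAf; apply: h; split=> //; exists e => //.
    exact: sle_mull.
  have af a : A a -> idem (a * f).
    by move=> /Ai[aa _]; exact: idemM.
  split.
  - move=> g [gg [a Aa ag]]; split=> // Ig; apply: nex; exists a => //.
    by apply: Id Ig _ _ => //; exact: af.
  - move=> g h [gg [a Aa ag]] [hh [b Ab bh]]; split; first exact: idemM.
    exists (a * b); first exact: AM.
    have [aa _] := Ai _ Aa; have [bb _] := Ai _ Ab.
    have := sle_mul isG ag bh.
    by rewrite -mulgA (mulgA f) (idemC isG ff bb) -(mulgA b) ff mulgA.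
  - move=> g h [gg [a Aa ag]] hh gh; split=> //; exists a => //.
    exact: sle_trans gh.
  - by move=> _; split=> //; exists e => //; exact: sle_mulr.
suff AP : prime_filter A.
  by exists (Dual AP); split=> //= f If Af; case: (Ai _ Af).
split=> //.
- by move=> f /Ai[].
- by exists e.
- by move=> z z0 /Ai[_]; apply; exact: I0.
- move=> f g h ff gg fgh Ah; apply: contrapT => /not_orP[nAf nAg].
  have [a Aa Iaf] := ext _ ff nAf; have [b Ab Ibg] := ext _ gg nAg.
  have [aa _] := Ai _ Aa; have [bb _] := Ai _ Ab; have [hh _ _ _] := fgh.
  have ab := idemM isG aa bb.
  have [_] := Ai _ (AM _ _ (AM _ _ Aa Ab) Ah); apply.
  apply: Ij (is_join_mull ff gg ab fgh).
    apply: Id Iaf _ _; first exact: idemM.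
    by rewrite (idemC isG aa bb) -mulgA; exact: sle_mull.
  apply: Id Ibg _ _; first exact: idemM.
  by rewrite -mulgA; exact: sle_mull.
Qed.

End BooleanInverseSemigroup.

(** * The Stone dual *)

(** The topologies of the dual and of the space of germs are generated by subbases. When the members
    of the subbase around a point are directed downwards, finite intersections bring nothing new at
    that point. *)
Lemma finI_from_base (T : Type) (D : set (set T)) (W : set T) x :
  (exists C, D C /\ C x) ->
  (forall A B, D A -> D B -> A x -> B x ->
    exists C, [/\ D C, C x & C `<=` A `&` B]) ->
  finI_from D id W -> W x -> exists C, [/\ D C, C x & C `<=` W].
Proof.
move=> [C0 [DC0 C0x]] DI [F FD <-] Wx.
suff [C [DC Cx CF]] : exists C, [/\ D C, C x &
    forall A, A \in enum_fset F -> C `<=` A].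
  by exists C; split=> // y Cy A FA; exact: CF Cy.
have {FD}FD A : A \in enum_fset F -> D A by move=> /FD/set_mem.
have {Wx}Fx A : A \in enum_fset F -> A x by move=> FA; exact: Wx.
elim: (enum_fset F) FD Fx => [|A s IH] Ds sx; first by exists C0.
have [B sB|B sB|B [DB Bx Bs]] := IH.
- by apply: Ds; rewrite in_cons sB orbT.
- by apply: sx; rewrite in_cons sB orbT.
have As : A \in A :: s by exact: mem_head.
have [C [DC Cx CAB]] := DI _ _ (Ds _ As) DB (sx _ As) Bx.
exists C; split=> // E; rewrite in_cons => /orP[/eqP ->|sE] y /CAB[] //.
by move=> _; exact: Bs.
Qed.

(** Compactness as an induction principle: a property of sets that is local, hereditary and stable
    under finite unions passes to compact sets. If it failed for [K], the sets whose complement in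
    [K] has the property would form a proper filter without a cluster point in [K]. *)
Lemma compact_ind (X : topologicalType) (P : set X -> Prop) (K : set X) :
  compact K -> P set0 -> (forall A B, A `<=` B -> P B -> P A) ->
  (forall A B, P A -> P B -> P (A `|` B)) ->
  (forall x, K x -> exists2 U, nbhs x U & P U) -> P K.
Proof.
move=> cK P0 PS PU Pnbhs; apply: contrapT => nPK.
pose F : set_system X := [set A | P (K `\` A)].
have FF : ProperFilter F.
  split; first by rewrite /F /= setD0.
  split; first by rewrite /F /= setDT.
  - by move=> A B; rewrite /F /= setDIr => ? ?; exact: PU.
  - by move=> A B AB; apply: PS; exact: setDS.
have [|x [Kx clx]] := cK F FF; first by rewrite /F /= setDv.
have [U nU PU'] := Pnbhs _ Kx.
have [|y [+ Uy]] := clx (~` U) U _ nU; last exact.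
by rewrite /F /= setDE setCK; apply: PS PU'; exact: subIsetr.
Qed.

Section Dual.
Local Open Scope group_scope.
Context (G : boolInvSemigroup).
Implicit Types (e f g : G) (x y : dual G).

Let isG : is_inverse_semigroup G := @bis_inv G.

Definition dual_set e : set (dual G) := [set x | x e].

Lemma dual_idem x e : x e -> idem e. Proof. exact: (pf_idem (dptP x)). Qed.

Lemma dualM x e f : idem e -> idem f -> x (e * f) <-> x e /\ x f.
Proof.
move=> ee ff; split=> [xef|[xe xf]]; last exact: (pf_mul (dptP x)).
split; apply: (pf_up (dptP x) xef) => //; first exact: sle_mulr.
exact: sle_mull.
Qed.

Lemma dual_le x e f : idem f -> sle e f -> x e -> x f.
Proof. by move=> ff ef xe; exact: (pf_up (dptP x) xe). Qed.

Lemma dual_join x e f g : idem e -> idem f -> is_join_in (@idem G) e f g ->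
  x g <-> x e \/ x f.
Proof.
move=> ee ff efg; split; first exact: (pf_prime (dptP x)).
by have [gg eg fg _] := efg; move=> []; exact: dual_le.
Qed.

Lemma dual_zero x z : is_zero z -> ~ x z. Proof. exact: (pf_zero (dptP x)). Qed.

Lemma dual_diff e f : idem e -> idem f -> exists c,
  [/\ idem c, sle c e, is_zero (f * c) & forall x, x c <-> x e /\ ~ x f].
Proof.
move=> ee ff; have [c [cc ce fc efc]] := idem_diff ee ff.
exists c; split=> // x; have ef := idemM isG ee ff; split=> [xc|[xe nxf]].
  split; first exact: dual_le xc.
  by move=> xf; apply: (dual_zero (x := x) fc); apply/dualM.
by have [/(dualM _ ee ff)[]|] := (dual_join x ef cc efc).1 xe.
Qed.

Lemma dual_nbhs x (A : set (dual G)) :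
  nbhs x A <-> exists2 e, x e & dual_set e `<=` A.
Proof.
split=> [[_ [[D Dsub <-] [W DW Wx] sub]]|[e xe eA]].
- have [||C [[e ee ->] Cx CW]] := finI_from_base _ _ (Dsub _ DW) Wx.
  + have [e xe] := pf_ex (dptP x); exists (dual_set e); split=> //.
    by exists e => //; exact: dual_idem xe.
  + move=> _ _ [e ee ->] [f ff ->] xe xf; exists (dual_set (e * f)); split.
    * by exists (e * f) => //; exact: idemM.
    * exact/dualM.
    * by move=> y /dualM; apply.
  exists e => //; apply: subset_trans sub; apply: (subset_trans CW).
  by move=> y Wy; exists W.
- exists (dual_set e); split=> //; exists [set dual_set e].
    move=> _ ->; apply: (@finI_from1 _ _ _ id); exists e => //.
    exact: dual_idem xe.
  by rewrite bigcup_set1.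
Qed.

Lemma dual_set_open e : open (dual_set e).
Proof. by rewrite openE => x xe; apply/dual_nbhs; exists e. Qed.

(** An ultrafilter containing this set converges to the prime filter of the idempotents [f] whose
    [dual_set f] it contains; primeness is the dichotomy of ultrafilters. *)
Lemma dual_set_compact e : compact (dual_set e).
Proof.
rewrite compact_ultra => F FU Fe.
(* A point contains idempotents only, so the set is empty in the other case. *)
have [ee|nee] := pselect (idem e); last first.
  have [x] := @filter_ex _ F _ _ Fe.
  by move=> /dual_idem.
have xP : prime_filter [set f | idem f /\ F (dual_set f)].
  split.
  - by move=> f [].
  - by exists e.
  - by move=> z z0 [_ /(@filter_ex _ F _)[x /dual_zero]]; exact.
  - move=> f g [ff Ff] [gg Fg]; split; first exact: idemM.
    by apply: filterS (filterI Ff Fg) => x [xf xg]; apply/dualM.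
  - move=> f g [ff Ff] gg fg; split=> //.
    by apply: filterS Ff => x; exact: dual_le.
  - move=> f g h ff gg fgh [hh Fh].
    have [Ff|Ff] := in_ultra_setVsetC (dual_set f) FU; first by left.
    right; split=> //; apply: filterS (filterI Fh Ff) => x [xh nxf].
    by have [] := (dual_join x ff gg fgh).1 xh.
exists (Dual xP); split; first by split.
by move=> A /dual_nbhs[f [ff Ff] fA]; exact: filterS Ff.
Qed.

(** Prime filters are maximal thanks to relative complements: if [e] is in [y] but not in [x], and
    [f] is in [x], then the complement of [e] in [f] is in [x], hence in [y], which excludes [e]. *)
Lemma dual_sub x y : (forall e, x e -> y e) -> x = y.
Proof.
move=> sub; apply: dual_eq; apply/seteqP; split=> // e ye.
have [f xf] := pf_ex (dptP x); have ff := dual_idem xf.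
have ee := dual_idem ye; apply: contrapT => nxe.
have [c [cc _ _ cE]] := dual_diff ff ee.
by have /cE[] := sub _ ((cE x).2 (conj xf nxe)).
Qed.

Lemma dual_separated x y : x <> y -> exists2 e, x e & ~ y e.
Proof.
move=> xy; apply: contrapT => h; apply/xy/dual_sub => e xe.
by apply: contrapT => ye; apply: h; exists e.
Qed.

Lemma dual_hausdorff : hausdorff_space (dual G).
Proof.
move=> x y cl; apply: contrapT => /dual_separated[e xe nye].
have [f yf] := pf_ex (dptP y).
have [c [cc _ _ cE]] := dual_diff (dual_idem yf) (dual_idem xe).
have [||z [ze /cE[]]//] := cl (dual_set e) (dual_set c).
- by apply/dual_nbhs; exists e.
- by apply/dual_nbhs; exists c => //; apply/cE.
Qed.

Lemma dual_set_clopen e : clopen (dual_set e).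
Proof.
split; first exact: dual_set_open.
by apply: compact_closed; [exact: dual_hausdorff | exact: dual_set_compact].
Qed.

Lemma dual_boolean : boolean_space (dual G).
Proof.
split; last 1 first.
- apply: zero_dimension_totally_disconnected => x y /eqP /dual_separated.
  by move=> [e xe ye]; exists (dual_set e); split=> //; exact: dual_set_clopen.
- move=> x _; have [e xe] := pf_ex (dptP x).
  exists (dual_set e); last first.
    by split; [exact: dual_set_compact | exact: (dual_set_clopen e).2].
  by rewrite withinE; exists (dual_set e) => //; apply/dual_nbhs; exists e.
- exact: dual_hausdorff.
Qed.

(** The idempotents [g] with [g * e] below [f] form an ideal that contains [f]. If [e] is not below
    [f], this ideal misses [e], and a prime filter that separates them contains [e] but not [f]. *)
Lemma dual_set_le e f : idem e -> idem f ->
  dual_set e `<=` dual_set f -> sle e f.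
Proof.
move=> ee ff sub; apply/(sle_idemE ee ff); apply: contrapT => nfe.
pose I := [set g | idem g /\ sle (g * e) f].
have [||x [xe]] := @prime_filter_ex _ I e _ ee.
- split.
  + by move=> g [].
  + move=> z z0; split; first exact: is_zero_idem.
    by apply: is_zero_le; exact: is_zero_mull.
  + move=> g h [hh hef] gg gh; split=> //; apply: (sle_trans isG) hef.
    by apply: (sle_mul isG gh); exact: sle_refl.
  + move=> g h k [gg gef] [hh hef] ghk; have [kk _ _ _] := ghk; split=> //.
    rewrite (idemC isG kk ee).
    apply: (idem_join_le _ _ (is_join_mull gg hh ee ghk)); first exact: idemM.
    * exact: idemM.
    * by rewrite (idemC isG ee gg).
    * by rewrite (idemC isG ee hh).
- by move=> [_]; rewrite ee => /(sle_idemE ee ff).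
- move=> /(_ f); apply; first by split=> //; exact: sle_mulr.
  exact: sub.
Qed.

(** Finitely many idempotents have a join. This gives the properness of [dual_map] and the
    nondegeneracy of the map from a semigroup to the bisections of its germs. *)
Lemma dual_compact_bounded (K : set (dual G)) : compact K ->
  exists2 e, idem e & K `<=` dual_set e.
Proof.
move=> cK.
apply: (compact_ind (P := fun A => exists2 e, idem e & A `<=` dual_set e) cK).
- by have [z z0] := bis_zero G; exists z => //; exact: is_zero_idem.
- by move=> A B AB [e ee Be]; exists e => //; exact: subset_trans Be.
- move=> A B [e ee Ae] [f ff Bf]; have [g efg] := idem_join ee ff.
  have [gg _ _ _] := efg; exists g => // x ABx; apply/(dual_join x ee ff efg).
  by case: ABx => [/Ae|/Bf]; [left|right].
- move=> x _; have [e xe] := pf_ex (dptP x); exists (dual_set e).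
    by apply/dual_nbhs; exists e.
  by exists e => //; exact: dual_idem xe.
Qed.

End Dual.

(** * The groupoid of germs *)

Lemma compact_lift (X Y : topologicalType) (f : X -> Y) (U : set X) :
  open U -> {in U &, injective f} ->
  (forall V, open V -> V `<=` U -> open (f @` V)) ->
  compact (f @` U) -> compact U.
Proof.
move=> oU finj fopen cfU F FF FU.
have fFU : F (f @^-1` (f @` U)) by apply: filterS FU => x Ux; exists x.
have [_ [[x Ux <-] clx]] := cfU _ (fmap_proper_filter f FF) fFU.
exists x; split=> // A B FA nB.
have [||_ [[a [Aa Ua] <-] [b Bb ba]]] :=
    clx (f @` (A `&` U)) (f @` ((B `&` U)°)).
- have : F (f @^-1` (f @` (A `&` U))); last by [].
  by apply: filterS (filterI FA FU) => a Aa; exists a.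
- apply: open_nbhs_nbhs; split; last first.
    by exists x => //; apply: filterI => //; exact: open_nbhs_nbhs.
  apply: fopen; first exact: open_interior.
  by move=> z /interior_subset[].
move: Bb => /interior_subset[Bb Ub].
exists a; split=> //.
suff <- : b = a by [].
by apply: finj => //; rewrite inE.
Qed.

(** Continuity of a partial operation tested on boxes of neighborhoods, so that the subtype carrying
    the fiber product stays out of the later arguments. *)
Lemma on_fibprod_continuous (X Y Z W : topologicalType) (f : X -> Z)
  (g : Y -> Z) (m : forall x y, f x = g y -> W) :
  (forall x y h A, nbhs (m x y h) A -> exists U V,
    [/\ nbhs x U, nbhs y V & forall x' y' h', U x' -> V y' -> A (m x' y' h')]) ->
  continuous (on_fibprod m).
Proof.
move=> mc z A /mc[U [V [nU nV UV]]].
have : nbhs (val z) (U `*` V) by exists (U, V).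
move=> /(@initial_continuous _ _ (val : fibprod f g -> X * Y) z).
by apply: (@filterS _ (nbhs z)) => w [Uw Vw]; exact: UV.
Qed.

Section Germs.
Local Open Scope group_scope.
Context (G : boolInvSemigroup).
Implicit Types (s t e f : G) (x y : dual G) (g h : germ_groupoid G).

Let isG : is_inverse_semigroup G := @bis_inv G.

Lemma dual_ext x y : (forall e, idem e -> x e <-> y e) -> x = y.
Proof.
move=> xy; apply: dual_eq; apply/seteqP; split=> e h.
  by apply/(xy _ (dual_idem h)).
by apply/(xy _ (dual_idem h)).
Qed.

Lemma gdom_mkgerm s x (xs : x (sdom s)) :
  @gdom (germ_groupoid G) (mkgerm xs) = x.
Proof. exact: germ_domE. Qed.

Lemma gcod_mkgerm s x (xs : x (sdom s)) :
  @gcod (germ_groupoid G) (mkgerm xs) = phi xs.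
Proof. exact: germ_codE. Qed.

(** These are the sets [B s]. Later arguments reach germs mostly through membership in them, which
    hides chosen representatives and the membership proofs inside [mkgerm]. *)
Definition germ_set s : set (germ_groupoid G) :=
  [set g | exists x (xs : x (sdom s)), g = mkgerm xs].

Lemma germ_set_ex g : exists s, germ_set s g. Proof. exact: germP. Qed.

Lemma germ_set_dom s g : germ_set s g -> gdom g (sdom s).
Proof. by move=> [x [xs ->]]; rewrite gdom_mkgerm. Qed.

Lemma germ_set_inj s : {in germ_set s &, injective (@gdom (germ_groupoid G))}.
Proof.
move=> _ _ /set_mem[x [xs ->]] /set_mem[y [ys ->]].
by rewrite !gdom_mkgerm => xy; apply/eq_germ; split=> //;
  exists (sdom s); split=> //; exact: idem_dom.
Qed.

Lemma germ_set_eq s g h : germ_set s g -> germ_set s h -> gdom g = gdom h ->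
  g = h.
Proof. by move=> sg sh; apply: germ_set_inj (mem_set sg) (mem_set sh). Qed.

Lemma germ_set_at s x : x (sdom s) -> exists2 g, germ_set s g & gdom g = x.
Proof.
by move=> xs; exists (mkgerm xs); [exists x, xs | rewrite gdom_mkgerm].
Qed.

Lemma germ_set_le s t : sle s t -> germ_set s `<=` germ_set t.
Proof.
move=> st _ [x [xs ->]].
have xt : x (sdom t).
  by apply: dual_le xs; [exact: idem_dom | exact: sle_dom].
exists x, xt; apply/eq_germ; split=> //; exists (sdom s).
by split=> //; [exact: idem_dom | rewrite mul_dom// (sleP isG s t).1].
Qed.

Lemma germ_set_restrict s e g : idem e -> germ_set s g -> gdom g e ->
  germ_set (s * e) g.
Proof.
move=> ee [x [xs ->]]; rewrite gdom_mkgerm => xe.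
have xse : x (sdom (s * e)).
  by rewrite sdom_mulr//; apply/dualM => //; exact: idem_dom.
exists x, xse; apply/eq_germ; split=> //; exists e; split=> //.
by rewrite -mulgA ee.
Qed.

Lemma germ_set_common s t g : germ_set s g -> germ_set t g ->
  exists e, [/\ idem e, gdom g e & s * e = t * e].
Proof.
move=> [x [xs ->]] [y [yt /eq_germ[xy [e [ee xe st]]]]].
by exists e; rewrite gdom_mkgerm.
Qed.

Lemma germ_cod_set s g e : germ_set s g -> idem e ->
  gcod g e <-> gdom g (star s * e * s).
Proof.
move=> [x [xs ->]] ee; rewrite gdom_mkgerm gcod_mkgerm.
by split=> [[]|].
Qed.

Lemma germ_unit_set e x : x e -> germ_set e (gunit (x : gobj (germ_groupoid G))).
Proof. by move=> xe; exists x, (germ_unit_subproof xe); exact: germ_unitE. Qed.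

Lemma germ_dom_unit x : gdom (gunit (x : gobj (germ_groupoid G))) = x.
Proof.
have [e xe] := pf_ex (dptP x).
by rewrite (germ_unitE xe : gunit (x : gobj (germ_groupoid G)) = _) gdom_mkgerm.
Qed.

Lemma germ_cod_unit x : gcod (gunit (x : gobj (germ_groupoid G))) = x.
Proof.
have [e xe] := pf_ex (dptP x); have ee := dual_idem xe.
apply: dual_ext => f ff.
rewrite (germ_cod_set (germ_unit_set xe) ff) germ_dom_unit.
rewrite (star_idem isG ee) (idemC isG ee ff) -mulgA ee.
by split=> [/dualM[]|xf] //; apply/dualM.
Qed.

Lemma germ_inv_set s g : germ_set s g -> germ_set (star s) (ginv g).
Proof.
move=> [x [xs ->]]; rewrite /= germ_invE.
by exists (phi xs), (germ_inv_subproof xs).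
Qed.

Lemma germ_dom_inv g : gdom (ginv g) = gcod g.
Proof.
have [s [x [xs ->]]] := germ_set_ex g.
by rewrite (germ_invE xs : @ginv (germ_groupoid G) _ = _) gdom_mkgerm gcod_mkgerm.
Qed.

Lemma germ_cod_inv g : gcod (ginv g) = gdom g.
Proof.
have [s gs] := germ_set_ex g; apply: dual_ext => e ee.
have see := idem_conj isG (star s) ee.
rewrite (germ_cod_set (germ_inv_set gs) ee) germ_dom_inv (germ_cod_set gs see).
have -> : star s * (star (star s) * e * star s) * s = sdom s * (e * sdom s).
  by rewrite starK// /sdom !mulgA.
have ds := idem_dom isG s; have des := idemM isG ee ds.
split=> [/(dualM _ ds des)[_] /(dualM _ ee ds)[]//|ge].
by apply/dualM => //; split; [|apply/dualM => //; split=> //];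
  exact: germ_set_dom.
Qed.

Lemma germ_mul_set s t g h (p : gdom g = gcod h) : germ_set s g ->
  germ_set t h -> germ_set (s * t) (gmul g h p).
Proof.
move=> [x [xs gE]] [y [yt hE]]; subst g h.
have xy : x = phi yt by move: p; rewrite gdom_mkgerm gcod_mkgerm.
by subst x; exists y, (germ_mul_subproof xs); exact: germ_mulE.
Qed.

Lemma germ_dom_mul g h (p : gdom g = gcod h) : gdom (gmul g h p) = gdom h.
Proof.
have [s [x [xs gE]]] := germ_set_ex g; have [t [y [yt hE]]] := germ_set_ex h.
subst g h; have xy : x = phi yt by move: p; rewrite gdom_mkgerm gcod_mkgerm.
by subst x; rewrite (germ_mulE p : @gmul (germ_groupoid G) _ _ p = _) !gdom_mkgerm.
Qed.

Lemma germ_cod_mul g h (p : gdom g = gcod h) : gcod (gmul g h p) = gcod g.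
Proof.
have [s gs] := germ_set_ex g; have [t ht] := germ_set_ex h.
apply: dual_ext => e ee.
rewrite (germ_cod_set (germ_mul_set p gs ht) ee) germ_dom_mul.
rewrite (germ_cod_set gs ee) p (germ_cod_set ht); last exact: idem_conj.
by rewrite starM// !mulgA.
Qed.

Lemma germ_is_groupoid : is_groupoid (germ_groupoid G).
Proof.
have units s g : germ_set s g -> germ_set (sdom s) (gunit (gdom g)).
  by move=> gs; apply: germ_unit_set; exact: germ_set_dom.
have unitr s g : germ_set s g -> germ_set (sran s) (gunit (gcod g)).
  by move=> /germ_inv_set/units; rewrite germ_dom_inv sdom_star.
split.
- exact: germ_dom_unit.
- exact: germ_cod_unit.
- exact: germ_dom_mul.
- exact: germ_cod_mul.
- move=> g h k p q p' q'.
  have [s gs] := germ_set_ex g; have [t ht] := germ_set_ex h.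
  have [u ku] := germ_set_ex k.
  apply: (@germ_set_eq (s * (t * u))); first by do 2?apply: germ_mul_set.
    by rewrite mulgA; do 2?apply: germ_mul_set.
  by rewrite !germ_dom_mul.
- move=> g p; have [s gs] := germ_set_ex g.
  apply: (germ_set_eq _ gs); last by rewrite germ_dom_mul germ_dom_unit.
  by rewrite -(mul_dom isG s); apply: germ_mul_set => //; exact: units.
- move=> g p; have [s gs] := germ_set_ex g.
  apply: (germ_set_eq _ gs); last by rewrite germ_dom_mul.
  by rewrite -(mul_ran isG s); apply: germ_mul_set => //; exact: unitr.
- exact: germ_dom_inv.
- exact: germ_cod_inv.
- move=> g p; have [s gs] := germ_set_ex g.
  apply: (@germ_set_eq (sran s)); [|exact: unitr|].
    by apply: germ_mul_set => //; exact: germ_inv_set.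
  by rewrite germ_dom_mul germ_dom_inv germ_dom_unit.
- move=> g p; have [s gs] := germ_set_ex g.
  apply: (@germ_set_eq (sdom s)); [|exact: units|].
    by apply: germ_mul_set => //; exact: germ_inv_set.
  by rewrite germ_dom_mul germ_dom_unit.
Qed.

(** An open set of points in a basic set can be absorbed by restricting [s] to an idempotent. Two
    germ sets that share [g] come from elements with a common restriction [s' * e = t' * e] around
    it, whose germ set lies in both. *)
Lemma germ_nbhs g (A : set (germ_groupoid G)) :
  nbhs g A <-> exists2 s, germ_set s g & germ_set s `<=` A.
Proof.
have setE s (U : set (dual G)) :
    [set g | exists x (xs : x (sdom s)), U x /\ g = mkgerm xs] =
    germ_set s `&` @gdom (germ_groupoid G) @^-1` U.
  apply/seteqP; split=> [_ [x [xs [Ux ->]]]|_ [[x [xs ->]]]].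
    by split; [exists x, xs | rewrite /preimage/= germ_domE].
  by rewrite /preimage/= germ_domE => Ux; exists x, xs.
split=> [[_ [[D Dsub <-] [W DW Wg] sub]]|[s gs sA]].
- suff [s gs sW] : exists2 s, germ_set s g & germ_set s `<=` W.
    by exists s => // h /sW Wh; apply: sub; exists W.
  have refine C : (exists s (U : set (dual G)), open U /\ C =
      germ_set s `&` @gdom (germ_groupoid G) @^-1` U) -> C g ->
      exists2 s, germ_set s g & germ_set s `<=` C.
    move=> [s [U [oU ->]]] [gs Ug].
    have /dual_nbhs[e ge eU] : nbhs (gdom g : dual G) U.
      exact: open_nbhs_nbhs.
    have ee := dual_idem ge; exists (s * e); first exact: germ_set_restrict.
    move=> h hse; split; first exact: germ_set_le (sle_mulr _ ee) _ hse.
    apply: eU; have := germ_set_dom hse; rewrite sdom_mulr//.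
    by move=> /dualM[] //; exact: idem_dom.
  have [||C [[s [U [oU ->]]] Cg CW]] := finI_from_base _ _ (Dsub _ DW) Wg.
  + have [s gs] := germ_set_ex g; exists (germ_set s); split=> //.
    exists s, setT; split; first exact: openT.
    by rewrite setE preimage_setT setIT.
  + move=> A1 A2 [s [U [oU ->]]] [t [V [oV ->]]] Ag Bg.
    move: Ag Bg; rewrite !setE => Ag Bg.
    have [s' gs' s'A] := refine _ (ex_intro _ s (ex_intro _ U (conj oU erefl))) Ag.
    have [t' gt' t'B] := refine _ (ex_intro _ t (ex_intro _ V (conj oV erefl))) Bg.
    have [e [ee ge st]] := germ_set_common gs' gt'.
    exists (germ_set (s' * e)); split.
    * exists (s' * e), setT; split; first exact: openT.
      by rewrite setE preimage_setT setIT.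
    * exact: germ_set_restrict.
    * move=> h hse; split.
        by apply: s'A; exact: germ_set_le (sle_mulr _ ee) _ hse.
      by apply: t'B; apply: germ_set_le (sle_mulr t' ee) _ _; rewrite -st.
  move: Cg CW; rewrite setE => Cg CW.
  have [s' gs' s'C] := refine _ (ex_intro _ s (ex_intro _ U (conj oU erefl))) Cg.
  by exists s' => //; exact: subset_trans CW.
- exists (germ_set s); split=> //; exists [set germ_set s].
    move=> _ ->; apply: (@finI_from1 _ _ _ id); exists s, setT.
    by split; [exact: openT | rewrite setE preimage_setT setIT].
  by rewrite bigcup_set1.
Qed.

Lemma germ_set_open s : open (germ_set s).
Proof. by rewrite openE => g gs; apply/germ_nbhs; exists s. Qed.

Lemma germ_dom_image s : @gdom (germ_groupoid G) @` germ_set s =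
  dual_set (sdom s).
Proof.
apply/seteqP; split=> [_ [g gs <-]|x xs]; first exact: germ_set_dom.
by have [g gs <-] := germ_set_at xs; exists g.
Qed.

Lemma germ_dom_open (V : set (germ_groupoid G)) : open V ->
  open (@gdom (germ_groupoid G) @` V).
Proof.
rewrite !openE => oV _ [g Vg <-].
have /germ_nbhs[s gs sV] := oV _ Vg.
apply/dual_nbhs; exists (sdom s); first exact: germ_set_dom.
by rewrite -germ_dom_image; exact: image_subset.
Qed.

Lemma germ_dom_cts : continuous (@gdom (germ_groupoid G)).
Proof.
move=> g A /dual_nbhs[e ge eA]; have [s gs] := germ_set_ex g.
have ee := dual_idem ge.
apply/germ_nbhs; exists (s * e); first exact: germ_set_restrict.
move=> h hse; apply: eA; have := germ_set_dom hse.
by rewrite sdom_mulr// => /dualM[]//; exact: idem_dom.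
Qed.

Lemma germ_invK : involutive (@ginv (germ_groupoid G)).
Proof.
move=> g; have [s gs] := germ_set_ex g.
apply: (germ_set_eq _ gs).
  by rewrite -(starK isG s); do 2?apply: germ_inv_set.
by rewrite germ_dom_inv germ_cod_inv.
Qed.

Lemma germ_inv_cts : continuous (@ginv (germ_groupoid G)).
Proof.
move=> g A /germ_nbhs[s gs sA]; apply/germ_nbhs; exists (star s).
  by rewrite -(germ_invK g); exact: germ_inv_set.
by move=> h hs; apply: sA; rewrite -(starK isG s); exact: germ_inv_set.
Qed.

Lemma germ_cod_dom_inv : @gcod (germ_groupoid G) = 
  @gdom (germ_groupoid G) \o @ginv (germ_groupoid G).
Proof. by apply/funext => g; rewrite /comp germ_dom_inv. Qed.

Lemma germ_cod_cts : continuous (@gcod (germ_groupoid G)).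
Proof.
rewrite germ_cod_dom_inv => g.
by apply: continuous_comp; [exact: germ_inv_cts | exact: germ_dom_cts].
Qed.

(** If the unit at [x] is a germ of [s], then [s] agrees with an idempotent on some idempotent at
    [x], so the unit at every nearby point is a germ of [s] as well. *)
Lemma germ_unit_cts : continuous (@gunit (germ_groupoid G)).
Proof.
move=> x A /germ_nbhs[s xs sA].
have [e xe] := pf_ex (dptP x); have ee := dual_idem xe.
have [f [ff]] := germ_set_common xs (germ_unit_set xe).
rewrite germ_dom_unit => xf sfef.
apply/dual_nbhs; exists (e * f); first exact/dualM.
move=> y yef; apply: sA; apply: germ_set_le (sle_mulr s ff) _ _.
by rewrite sfef; exact: germ_unit_set.
Qed.

Lemma germ_set_compact s : compact (germ_set s).
Proof.
apply: (compact_lift (f := @gdom (germ_groupoid G))).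
- exact: germ_set_open.
- exact: germ_set_inj.
- by move=> V oV _; exact: germ_dom_open.
- by rewrite germ_dom_image; exact: dual_set_compact.
Qed.

Lemma germ_set_bisection s : compact_open_bisection (germ_set s).
Proof.
split; [exact: germ_set_compact | exact: germ_set_open | exact: germ_set_inj|].
move=> g h /set_mem/germ_inv_set gs /set_mem/germ_inv_set hs.
rewrite -!germ_dom_inv => gh; rewrite -(germ_invK g) -(germ_invK h).
by congr ginv; exact: germ_set_eq gs hs gh.
Qed.

Lemma germ_boolean : is_boolean_groupoid (germ_groupoid G).
Proof.
split.
- split; [exact: germ_is_groupoid | exact: germ_dom_cts | exact: germ_cod_cts
    | exact: germ_unit_cts | exact: germ_inv_cts |].
  apply: on_fibprod_continuous => g h p A /germ_nbhs[u ghu uA].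
  have [s gs] := germ_set_ex g; have [t ht] := germ_set_ex h.
  (* Near the product, [u] and [s * t] agree on [e]. Shrinking [t] to [t * e] places all nearby
     products in the germ set of [s * t * e = u * e]. *)
  have [e [ee + ue]] := germ_set_common ghu (germ_mul_set p gs ht).
  rewrite germ_dom_mul => he.
  exists (germ_set s), (germ_set (t * e)); split.
  + by apply/germ_nbhs; exists s.
  + by apply/germ_nbhs; exists (t * e) => //; exact: germ_set_restrict.
  + move=> g' h' p' gs' ht'; apply: uA.
    apply: germ_set_le (sle_mulr u ee) _ _; rewrite ue -mulgA.
    exact: germ_mul_set.
- move=> g; have [s gs] := germ_set_ex g; exists (germ_set s).
    by apply/germ_nbhs; exists s.
  exact: germ_set_compact.
- move=> g; have [s gs] := germ_set_ex g; exists (germ_set s); split=> //.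
  + exact: germ_set_open.
  + exact: germ_set_inj.
  + by apply: continuous_subspaceT; exact: germ_dom_cts.
  + by move=> V oV _; exact: germ_dom_open.
- move=> g; have [s gs] := germ_set_ex g; exists (germ_set s); split=> //.
  + exact: germ_set_open.
  + by have [_ _ _] := germ_set_bisection s.
  + by apply: continuous_subspaceT; exact: germ_cod_cts.
  + move=> V oV _; rewrite germ_cod_dom_inv -image_comp.
    have -> : @ginv (germ_groupoid G) @` V =
        @ginv (germ_groupoid G) @^-1` V.
      apply/seteqP; split=> [_ [h Vh <-]|h Vh]; first by rewrite /preimage/mkset germ_invK.
      by exists (ginv h) => //; rewrite germ_invK.
    by apply: germ_dom_open; apply: open_comp_cts => //; exact: germ_inv_cts.
- exact: dual_boolean.
Qed.

End Germs.

(** * Germs on morphisms *)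

Section GermAction.
Local Open Scope group_scope.
Context (H G : boolInvSemigroup) (j : bis_morphism H G).
Implicit Types (s e : H) (t f : G) (x y : dual G).
Implicit Types (eta : germ_groupoid H) (g : germ_groupoid G).

Let isG : is_inverse_semigroup G := @bis_inv G.
Let isH : is_inverse_semigroup H := @bis_inv H.
Let jP : is_bis_morphism j := bmorP j.

Lemma dual_mapE x e : idem e -> dual_map j x e <-> x (j e).
Proof. by move=> ee; split=> [[]|]. Qed.

Lemma germ_momentE g : moment (germ_action j) g = dual_map j (gcod g).
Proof. by []. Qed.

Lemma germ_act_set s t eta g (p : gdom eta = moment (germ_action j) g) :
  germ_set s eta -> germ_set t g ->
  germ_set (j s * t) (act (germ_action j) eta g p).
Proof.
move=> [x [xs etaE]] [y [yt gE]]; subst eta g.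
have xy : x = dual_map j (phi yt).
  by move: p; rewrite gdom_mkgerm germ_momentE gcod_mkgerm.
by subst x; exists y, (germ_act_subproof xs); exact: germ_actE.
Qed.

Lemma germ_dom_act eta g (p : gdom eta = moment (germ_action j) g) :
  gdom (act (germ_action j) eta g p) = gdom g.
Proof.
have [s [x [xs etaE]]] := germ_set_ex eta.
have [t [y [yt gE]]] := germ_set_ex g; subst eta g.
have xy : x = dual_map j (phi yt).
  by move: p; rewrite gdom_mkgerm germ_momentE gcod_mkgerm.
subst x; rewrite (germ_actE p : act (germ_action j) _ _ p = _).
by rewrite !gdom_mkgerm.
Qed.

Lemma germ_moment_act eta g (p : gdom eta = moment (germ_action j) g) :
  moment (germ_action j) (act (germ_action j) eta g p) = gcod eta.
Proof.
have [s es] := germ_set_ex eta; have [t gt] := germ_set_ex g.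
apply: dual_ext => e ee; have je := bmor_idem jP ee.
rewrite (dual_mapE _ ee) (germ_cod_set (germ_act_set p es gt) je).
have see := idem_conj isH s ee.
rewrite germ_dom_act (germ_cod_set es ee) p (dual_mapE _ see).
rewrite (germ_cod_set gt (bmor_idem jP see)).
by rewrite !(bmorM jP) starM// (bmor_star s jP) !mulgA.
Qed.

Lemma dual_map_cts : continuous (dual_map j).
Proof.
move=> x A /dual_nbhs[e [ee xe] eA]; apply/dual_nbhs; exists (j e) => //.
by move=> y ye; apply: eA; exact/dual_mapE.
Qed.

Lemma germ_moment0 : moment0 (germ_action j) = dual_map j.
Proof. by apply/funext => x; rewrite /moment0 germ_momentE germ_cod_unit. Qed.

Lemma germ_multiplier : is_proper_multiplier_action (germ_action j).
Proof.
have GG := germ_is_groupoid G; have GH := germ_is_groupoid H.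
split; last first.
  rewrite germ_moment0; split; first exact: dual_map_cts.
  (* The preimage of [K] is closed and lies in the compact set attached to [j e]. *)
  move=> K cK; have [e ee Ke] := dual_compact_bounded cK.
  apply: (subclosed_compact _ (@dual_set_compact _ (j e))).
    apply: preimage_closed; first by move=> x _; exact: dual_map_cts.
    by apply: compact_closed cK; exact: dual_hausdorff.
  by move=> x /Ke /dual_mapE; exact.
split.
- move=> g; apply: (@continuous_comp _ _ _ (@gcod (germ_groupoid G))).
    exact: germ_cod_cts.
  exact: dual_map_cts.
- apply: on_fibprod_continuous => eta g p A /germ_nbhs[u ghu uA].
  have [s es] := germ_set_ex eta; have [t gt] := germ_set_ex g.
  have [f [ff + ue]] := germ_set_common ghu (germ_act_set p es gt).
  rewrite germ_dom_act => gf.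
  exists (germ_set s), (germ_set (t * f)); split.
  + by apply/germ_nbhs; exists s.
  + by apply/germ_nbhs; exists (t * f) => //; exact: germ_set_restrict.
  + move=> eta' g' p' es' gt'; apply: uA.
    apply: germ_set_le (sle_mulr u ff) _ _; rewrite ue -mulgA.
    exact: germ_act_set.
- move=> g p; have [t gt] := germ_set_ex g.
  (* The unit at the moment of [g] is a germ of an idempotent [e], and [j e * t] is below [t]. *)
  have [e he] := pf_ex (dptP (moment (germ_action j) g)).
  have je := bmor_idem jP (dual_idem he).
  have := germ_act_set p (germ_unit_set he) gt.
  move=> /(germ_set_le (sle_mull isG t je)) h.
  by apply: germ_set_eq h gt _; rewrite germ_dom_act.
- exact: germ_moment_act.
- move=> eta eta' g p q p' q'.
  have [s es] := germ_set_ex eta; have [s' es'] := germ_set_ex eta'.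
  have [t gt] := germ_set_ex g.
  apply: (@germ_set_eq _ (j s * (j s' * t))).
  + by do 2?apply: germ_act_set.
  + by rewrite mulgA -(bmorM jP); apply: germ_act_set => //; exact: germ_mul_set.
  + by rewrite !germ_dom_act.
- by move=> g g' p; rewrite !germ_momentE germ_cod_mul.
- exact: germ_dom_act.
- move=> eta g g' p q p' q'.
  have [s es] := germ_set_ex eta; have [t gt] := germ_set_ex g.
  have [t' gt'] := germ_set_ex g'.
  apply: (@germ_set_eq _ (j s * (t * t'))).
  + by apply: germ_act_set => //; exact: germ_mul_set.
  + by rewrite mulgA; apply: germ_mul_set => //; exact: germ_act_set.
  + by rewrite germ_dom_act !germ_dom_mul.
Qed.

End GermAction.

Definition Germ (G : boolInvSemigroup) : boolGroupoid :=
  BoolGroupoid (@germ_boolean G).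

Definition Germ_map (H G : boolInvSemigroup) (j : bis_morphism H G) :
    multiplier (Germ H) (Germ G) :=
  @Multiplier (Germ H) (Germ G) (germ_action j) (germ_multiplier j).

Lemma Germ_functor : @is_functor bis_cat bgroupoid_cat Germ Germ_map.
Proof.
split.
- move=> G; apply: multiplier_eq => /=.
    apply/funext => g; rewrite /moment/=; apply: dual_ext => e ee.
    by rewrite dual_mapE.
  move=> eta g p q; have [s es] := germ_set_ex eta.
  have [t gt] := germ_set_ex g.
  apply: (@germ_set_eq _ (s * t)%g).
  + exact: (@germ_act_set _ _ (bis_idm G)).
  + exact: germ_mul_set.
  + by rewrite (@germ_dom_act _ _ (bis_idm G)) germ_dom_mul.
- move=> K H G j k; apply: multiplier_eq => /=.
    apply/funext => g.
    transitivity (dual_map k (dual_map j (gcod (g : germ_groupoid G)))).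
      apply: dual_ext => e ee; have ke := bmor_idem (bmorP k) ee.
      by split=> [[_ h]|[_ [_ h]]]; split.
    exact: (congr1 (fun f => f _) (esym (germ_moment0 k))).
  move=> kappa g p q; have [s ks] := germ_set_ex kappa.
  have [t gt] := germ_set_ex g.
  (* In the composed action [kappa] is first applied to a unit, a germ of [e]; the result is a germ
     of [k s * e], and the extra factor [e] disappears by monotonicity. *)
  have [e he] := pf_ex (dptP (moment (germ_action j) g)).
  have ee := dual_idem he.
  apply: (@germ_set_eq _ (j (k s) * t)%g).
  + exact: (@germ_act_set _ _ (bis_comp j k)).
  + apply: (@germ_set_le _ (j (k s * e) * t)%g).
      apply: (sle_mul (@bis_inv _)); last exact: sle_refl (@bis_inv _) _.
      by apply: (bmor_sle (bmorP j)); exact: sle_mulr.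
    exact: (germ_act_set _ (germ_act_set _ ks (germ_unit_set he)) gt).
  + by rewrite (@germ_dom_act _ _ (bis_comp j k)) germ_dom_act.
Qed.

(** * Boolean spaces *)

Lemma compact_separated (X : topologicalType) (A B : set X) :
  hausdorff_space X -> compact A -> compact B -> A `&` B = set0 ->
  exists U V, [/\ open U, open V, A `<=` U, B `<=` V & U `&` V = set0].
Proof.
move=> hX cA cB AB0.
have point x : ~ B x ->
    exists U V, [/\ open U, open V, U x, B `<=` V & U `&` V = set0].
  move=> nBx; apply: (compact_ind (P := fun S => exists U V,
      [/\ open U, open V, U x, S `<=` V & U `&` V = set0]) cB).
  - by exists setT, set0; split=> //; rewrite ?setI0//;
      [exact: openT | exact: open0].
  - move=> S T ST [U [V [oU oV Ux TV UV]]]; exists U, V.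
    by split=> //; exact: subset_trans TV.
  - move=> S T [U [V [oU oV Ux SV UV]]] [U' [V' [oU' oV' U'x TV' UV']]].
    exists (U `&` U'), (V `|` V'); split=> //.
    + exact: openI.
    + exact: openU.
    + by apply: setUSS.
    + rewrite setIUr setIAC UV set0I -setIA UV' setI0 setU0//.
  - move=> y By; have xy : x != y by apply/eqP => xy; apply: nBx; rewrite xy.
    move: hX; rewrite open_hausdorff => /(_ _ _ xy)[[U V]] /= [Ux Vy].
    move=> [oU oV /eqP UV]; exists V.
      by apply: open_nbhs_nbhs; split=> //; exact: set_mem.
    by exists U, V; split=> //; exact: set_mem.
apply: (compact_ind (P := fun S => exists U V,
    [/\ open U, open V, S `<=` U, B `<=` V & U `&` V = set0]) cA).
- by exists set0, setT; split=> //; rewrite ?set0I//;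
      [exact: open0 | exact: openT].
- move=> S T ST [U [V [oU oV TU BV UV]]]; exists U, V.
  by split=> //; exact: subset_trans TU.
- move=> S T [U [V [oU oV SU BV UV]]] [U' [V' [oU' oV' TU' BV' UV']]].
  exists (U `|` U'), (V `&` V'); split=> //.
  + exact: openU.
  + exact: openI.
  + by apply: setUSS.
  + by move=> z Bz; split; [exact: BV | exact: BV'].
  + by rewrite setIUl setIA UV set0I setICA UV' setI0 setU0.
- move=> x Ax; have [|U [V [oU oV Ux BV UV]]] := point x.
    by move=> Bx; have : (A `&` B) x by []; rewrite AB0.
  by exists U; [exact: open_nbhs_nbhs | exists U, V; split].
Qed.

Lemma closedD (X : topologicalType) (A B : set X) :
  closed A -> open B -> closed (A `\` B).
Proof. by move=> cA oB; rewrite setDE; apply: closedI => //; exact: open_closedC. Qed.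

(* In a compact Hausdorff space the intersection of the clopen neighborhoods of a
   point is connected; here the space is a compact neighborhood [W] of [x]. *)
Lemma boolean_space_basis (X : topologicalType) (x : X) (U : set X) :
  boolean_space X -> nbhs x U ->
  exists K, [/\ compact K, open K, K x & K `<=` U].
Proof.
move=> [lX hX dX] nU.
have [W nW [cW clW]] := lX x I.
have {}nW : nbhs x W by apply: (@filterS _ (nbhs x) _ _ _ _ nW) => y; exact.
(* The clopen subsets of the subspace [W] that contain [x], expressed through closedness in [X]. *)
pose F := [set C | [/\ C x, closed C, C `<=` W & closed (W `\` C)]].
have FW : F W by split=> //; [exact: nbhs_singleton | rewrite setDv; exact: closed0].
have FI C D : F C -> F D -> F (C `&` D).
  move=> [Cx cC CW cWC] [Dx cD DW cWD]; split=> //; first exact: closedI.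
    by move=> y [/CW].
  by rewrite setDIr; exact: closedU.
pose Q := \bigcap_(C in F) C.
have Qx : Q x by move=> C [].
have cQ : closed Q by apply: closed_bigI => C [].
have QW : Q `<=` W by move=> y; exact.
(* Compactness of [W] minus [O]: finitely many members of [F] already have their intersection inside
   [O]. *)
have FO O : open O -> Q `<=` O -> exists2 C, F C & C `<=` O.
  move=> oO QO.
  have cWO : compact (W `\` O).
    apply: (subclosed_compact _ cW); last by move=> y [].
    exact: closedD.
  have [||||C FC CWO] := compact_ind
      (P := fun S => exists2 C, F C & C `&` S = set0) cWO.
  - by exists W => //; rewrite setI0.
  - move=> A B AB [C FC CB]; exists C => //.
    by rewrite -subset0 -CB; exact: setIS.
  - move=> A B [C FC CA] [D FD DB]; exists (C `&` D); first exact: FI.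
    by rewrite setIUr setIAC CA set0I -setIA DB setI0 setU0.
  - move=> y [Wy nOy].
    have /existsNP[C /not_implyP[FC nCy]] : ~ Q y by move=> /QO.
    exists (~` C); last by exists C => //; rewrite setICr.
    apply: open_nbhs_nbhs; split=> //.
    by apply: closed_openC; case: FC.
  exists C => // y Cy; apply: contrapT => nOy.
  suff : (C `&` (W `\` O)) y by rewrite CWO.
  by split=> //; split=> //; case: FC => _ _ + _; exact.
(* Disjoint open sets covering [Q] cover some [C] in [F]; then [C] meets [U1] in a member of [F]
   again, so [Q] stays in the piece that contains [x]. *)
have split U1 U2 : open U1 -> open U2 -> U1 `&` U2 = set0 -> U1 x ->
    Q `<=` U1 `|` U2 -> Q `<=` U1.
  move=> o1 o2 U12 U1x /(FO _ (openU o1 o2))[C FC CU].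
  have [Cx cC CW cWC] := FC.
  have sub y : C y -> U1 y <-> ~ U2 y.
    move=> Cy; split=> [U1y U2y|nU2y]; last by case: (CU _ Cy).
    by have : (U1 `&` U2) y by []; rewrite U12.
  suff FCU : F (C `&` U1) by move=> y /(_ _ FCU)[].
  split=> //; last 2 first.
  - by move=> y [/CW].
  - have -> : W `\` (C `&` U1) = (W `\` C) `|` (C `\` U1).
      apply/seteqP; split=> y.
        move=> [Wy nCU]; have [Cy|] := pselect (C y); last by left.
        by right; split=> // U1y; apply: nCU.
      by move=> [[Wy nCy]|[Cy nU1y]]; split=> //; [move=> []|exact: CW|move=> []].
    by apply: closedU => //; apply: closedI => //; exact: open_closedC.
  have -> : C `&` U1 = C `\` U2.
    by apply/seteqP; split=> y [Cy h]; split=> //; exact/(sub _ Cy).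
  exact: closedD.
have Qconn : connected Q.
  move=> B [b Bb] [C oC BC] [D cD BD].
  have cB : compact B.
    by rewrite BD; apply: (subclosed_compact _ cW); [exact: closedI|move=> y [/QW]].
  have cQB : compact (Q `\` B).
    have -> : Q `\` B = Q `&` ~` C.
      by rewrite BC setDE setCI setIUr setICr set0U.
    apply: (subclosed_compact _ cW); last by move=> y [/QW].
    exact: closedD.
  have BQ : B `<=` Q by rewrite BC => y [].
  (* A relatively clopen [B] and its complement in [Q] get disjoint open neighborhoods; whichever
     contains [x] contains all of [Q]. *)
  have [|U1 [U2 [o1 o2 BU QU U12]]] := compact_separated hX cB cQB.
    by rewrite setDE setICA setICr setI0.
  have QU12 : Q `<=` U1 `|` U2.
    by move=> y Qy; have [/BU|nBy] := pselect (B y); [left | right; exact: QU].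
  have disj y : U1 y -> U2 y -> False.
    by move=> U1y U2y; have : (U1 `&` U2) y by []; rewrite U12.
  apply/seteqP; split=> // y Qy; apply: contrapT => nBy.
  have [Bx|nBx] := pselect (B x).
    by apply: (disj y); [exact: split (BU _ Bx) QU12 _ Qy | exact: QU].
  apply: (disj b); first exact: BU.
  have U2x : U2 x by exact: QU.
  have U21 : U2 `&` U1 = set0 by rewrite setIC.
  have QU21 : Q `<=` U2 `|` U1 by rewrite setUC.
  exact: (split _ _ o2 o1 U21 U2x QU21 _ (BQ _ Bb)).
have Qsub : Q `<=` [set x].
  by rewrite -(dX x I) => y Qy; exists Q.
have [||C FC CO] := FO ((U `&` W)°).
- exact: open_interior.
- by move=> y /Qsub ->; exact: filterI.
have [Cx cC CW cWC] := FC; exists C; split=> //.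
- exact: subclosed_compact CW.
(* [C] is open only relative to [W]; lying in an open subset of [W] makes it open in [X]. *)
- have -> : C = (U `&` W)° `\` (W `\` C).
    apply/seteqP; split=> y; first by move=> Cy; split; [exact: CO|move=> []].
    move=> [/interior_subset[_ Wy] nWC]; apply: contrapT => nCy.
    by apply: nWC.
  by apply: openI; [exact: open_interior | exact: closed_openC].
- by move=> y /CO/interior_subset[].
Qed.

Section BooleanSpace.
Context (X : topologicalType) (bX : boolean_space X).

Lemma boolean_space_diff (A B : set X) : compact A -> open A ->
  compact B -> open B -> compact (A `\` B) /\ open (A `\` B).
Proof.
have [_ hX _] := bX.
move=> cA oA cB oB; split; last first.
  by apply: openI => //; apply: closed_openC; exact: compact_closed.
apply: (subclosed_compact _ cA); last by move=> x [].
by apply: closedD => //; exact: compact_closed.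
Qed.

Lemma boolean_space_capture (A U : set X) : compact A -> open U -> A `<=` U ->
  exists K, [/\ compact K, open K, A `<=` K & K `<=` U].
Proof.
move=> cA oU AU.
apply: (compact_ind (P := fun S =>
    exists K, [/\ compact K, open K, S `<=` K & K `<=` U]) cA).
- by exists set0; split=> //; [exact: compact0 | exact: open0].
- by move=> S T ST [K [cK oK TK KU]]; exists K; split=> //; exact: subset_trans TK.
- move=> S T [K [cK oK SK KU]] [L [cL oL TL LU]]; exists (K `|` L); split.
  + exact: compactU.
  + exact: openU.
  + exact: setUSS.
  + by rewrite subUset.
- move=> x /AU Ux; have [|K [cK oK Kx KU]] := @boolean_space_basis X x U bX.
    exact: open_nbhs_nbhs.
  by exists K; [exact: open_nbhs_nbhs | exists K; split].
Qed.

End BooleanSpace.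

(** * The generalized Boolean algebra of compact open sets *)

Section CompactOpens.
Context (X : topologicalType) (bX : boolean_space X).

Record compact_opens := CompactOpen {
  co_set :> set X;
  co_compact : compact co_set;
  co_open : open co_set }.

HB.instance Definition _ := gen_eqMixin compact_opens.
HB.instance Definition _ := gen_choiceMixin compact_opens.

Implicit Types A B C : compact_opens.

Lemma co_eq A B : co_set A = co_set B -> A = B.
Proof.
by case: A B => [A cA oA] [B cB oB] /= AB; subst B;
   rewrite (Prop_irrelevance cA cB) (Prop_irrelevance oA oB).
Qed.

Definition co_bot := CompactOpen (@compact0 X) open0.

Definition co_join A B :=
  CompactOpen (compactU (@co_compact A) (@co_compact B))
    (openU (@co_open A) (@co_open B)).

Definition co_diff A B :=
  let h := boolean_space_diff bX (@co_compact A) (@co_open A)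
    (@co_compact B) (@co_open B) in
  CompactOpen h.1 h.2.

(** The double difference is the intersection; in this form compactness and openness come from
    [co_diff]. *)
Definition co_meet A B := co_diff A (co_diff A B).

Lemma co_meetE A B : co_meet A B = A `&` B :> set X.
Proof. by rewrite /= setDD. Qed.

Lemma co_leP A B : reflect (A `<=` B) (co_meet A B == A).
Proof.
apply: (iffP eqP) => [/(congr1 co_set)|AB]; last apply: co_eq.
  by rewrite co_meetE => /setIidPl.
by rewrite co_meetE; exact/setIidPl.
Qed.

(** The alias records the proof that [X] is Boolean in the type, since the lattice operations depend
    on it and instance inference has to recover it. *)
Definition co_lattice of boolean_space X := compact_opens.

HB.instance Definition _ := Choice.on (co_lattice bX).

Fact co_meetC : commutative (co_meet : (co_lattice bX) -> _ -> (co_lattice bX)).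
Proof. by move=> A B; apply: co_eq; rewrite !co_meetE setIC. Qed.
Fact co_joinC : commutative (co_join : (co_lattice bX) -> _ -> (co_lattice bX)).
Proof. by move=> A B; apply: co_eq; rewrite /= setUC. Qed.
Fact co_meetA : associative (co_meet : (co_lattice bX) -> _ -> (co_lattice bX)).
Proof. by move=> A B C; apply: co_eq; rewrite !co_meetE setIA. Qed.
Fact co_joinA : associative (co_join : (co_lattice bX) -> _ -> (co_lattice bX)).
Proof. by move=> A B C; apply: co_eq; rewrite /= setUA. Qed.
Fact co_joinKI B A : co_meet A (co_join A B) = A.
Proof. by apply: co_eq; rewrite co_meetE /=; apply/setIidPl; exact: subsetUl. Qed.
Fact co_meetKU B A : co_join A (co_meet A B) = A.
Proof. by apply: co_eq; rewrite /= setDD; apply/setUidPl; exact: subIsetl. Qed.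
Fact co_meetUl :
  @left_distributive (co_lattice bX) (co_lattice bX) co_meet co_join.
Proof. by move=> A B C; apply: co_eq; rewrite co_meetE /= !setDD setIUl. Qed.
Fact co_meetxx : idempotent_op (co_meet : (co_lattice bX) -> _ -> (co_lattice bX)).
Proof. by move=> A; apply: co_eq; rewrite co_meetE setIid. Qed.

HB.instance Definition _ := @Order.isMeetJoinDistrLattice.Build
  Order.default_display (co_lattice bX)
  (fun A B => co_meet A B == A) (fun A B => (B != A) && (co_meet A B == A))
  co_meet co_join (fun _ _ => erefl) (fun _ _ => erefl)
  co_meetC co_joinC co_meetA co_joinA co_joinKI co_meetKU co_meetUl co_meetxx.

Fact co_le0 (A : (co_lattice bX)) : ((co_bot : (co_lattice bX)) <= A)%O.
Proof. exact/co_leP. Qed.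

HB.instance Definition _ := Order.hasBottom.Build
  Order.default_display (co_lattice bX) co_le0.

Fact co_diffKI (A B : (co_lattice bX)) :
  (B `&` (co_diff A B : (co_lattice bX)))%O = \bot%O.
Proof.
apply: co_eq; rewrite [LHS]co_meetE /=.
by rewrite setDE setICA setICr setI0.
Qed.

Fact co_joinIB (A B : (co_lattice bX)) :
  ((A `&` B) `|` (co_diff A B : (co_lattice bX)))%O = A.
Proof.
by apply: co_eq; rewrite [LHS]/= setDD; exact: setUIDK.
Qed.

HB.instance Definition _ := Order.BDistrLattice_hasSectionalComplement.Build
  Order.default_display (co_lattice bX) co_diffKI co_joinIB.

End CompactOpens.

(** * Bisections *)

Section GroupoidTheory.
Context (G : groupoid_data) (gG : is_groupoid G).
Implicit Types g h k : G.

Lemma gmul_unitr g x (p : gdom g = gcod (gunit x)) : gmul g (gunit x) p = g.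
Proof.
have xg : x = gdom g by rewrite p (gcod_unit gG).
by subst x; exact: gmul1.
Qed.

Lemma gmul_unitl g x (p : gdom (gunit x) = gcod g) : gmul (gunit x) g p = g.
Proof.
have xg : x = gcod g by rewrite -p (gdom_unit gG).
by subst x; exact: g1mul.
Qed.

Lemma gmulK g h p q : gmul (gmul g h p) (ginv h) q = g.
Proof.
have r : gdom h = gcod (ginv h) by rewrite (gcod_inv gG).
have r' : gdom g = gcod (gmul h (ginv h) r) by rewrite (gcod_mul gG).
have u : gdom g = gcod (gunit (gcod h)) by rewrite (gcod_unit gG).
rewrite -(gmulA gG p r r' q) -[RHS](gmul_unitr u).
by apply: gmul_congr => //; exact: gmulV.
Qed.

Lemma gmulVK g h p q : gmul (ginv g) (gmul g h p) q = h.
Proof.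
have r : gdom (ginv g) = gcod g by rewrite (gdom_inv gG).
have r' : gdom (gmul (ginv g) g r) = gcod h by rewrite (gdom_mul gG).
have u : gdom (gunit (gdom g)) = gcod h by rewrite (gdom_unit gG).
rewrite (gmulA gG r p q r') -[RHS](gmul_unitl u).
by apply: gmul_congr => //; exact: gmulVl.
Qed.

Lemma gmul_injr g g' h p p' : gmul g h p = gmul g' h p' -> g = g'.
Proof.
move=> e; have q : gdom (gmul g h p) = gcod (ginv h).
  by rewrite (gdom_mul gG) (gcod_inv gG).
have q' : gdom (gmul g' h p') = gcod (ginv h) by rewrite -e.
by rewrite -(gmulK q) -(gmulK q'); exact: gmul_congr.
Qed.

Lemma gmul_injl g h h' p p' : gmul g h p = gmul g h' p' -> h = h'.
Proof.
move=> e; have q : gdom (ginv g) = gcod (gmul g h p).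
  by rewrite (gcod_mul gG) (gdom_inv gG).
have q' : gdom (ginv g) = gcod (gmul g h' p') by rewrite -e.
by rewrite -(gmulVK q) -(gmulVK q'); exact: gmul_congr.
Qed.

Lemma ginvK : involutive (@ginv G).
Proof.
move=> g; have p : gdom (ginv (ginv g)) = gcod (ginv g).
  by rewrite (gdom_inv gG).
have q : gdom g = gcod (ginv g) by rewrite (gcod_inv gG).
apply: (gmul_injr (p := p) (p' := q)).
by rewrite (gmulV gG) (gmulVl gG) (gdom_inv gG).
Qed.

Lemma gmul_inv_uniq g h p q : gmul (gmul g h p) g q = g -> h = ginv g.
Proof.
move=> e; have u : gdom (gunit (gcod g)) = gcod g by rewrite (gdom_unit gG).
have gh : gmul g h p = gunit (gcod g).
  by apply: (gmul_injr (p := q) (p' := u)); rewrite e gmul_unitl.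
have r : gdom g = gcod (ginv g) by rewrite (gcod_inv gG).
by apply: (gmul_injl (p := p) (p' := r)); rewrite gh (gmulV gG).
Qed.

Lemma gmul_idem g p : gmul g g p = g -> g = gunit (gdom g).
Proof.
have u : gdom g = gcod (gunit (gdom g)) by rewrite (gcod_unit gG).
move=> e; apply: (gmul_injl (p := p) (p' := u)).
by rewrite e gmul_unitr.
Qed.

End GroupoidTheory.

(** * The Boolean inverse semigroup of compact open bisections *)

Section BisTheory.
Local Open Scope group_scope.
Context (G : boolGroupoid).
Implicit Types (S T U E F : Bis G) (W : set (gobj G)) (g h k : G).

Let gG : is_groupoid G := tgroupoid (btgroupoid (bgdataP G)).
Let bG : boolean_space (gobj G) := boolean_obj (bgdataP G).

Lemma gdom_continuous : continuous (@gdom G).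
Proof. exact: gdom_cts (btgroupoid (bgdataP G)). Qed.

Lemma gunit_continuous : continuous (@gunit G).
Proof. exact: gunit_cts (btgroupoid (bgdataP G)). Qed.

Lemma ginv_continuous : continuous (@ginv G).
Proof. exact: ginv_cts (btgroupoid (bgdataP G)). Qed.

Lemma Bis_compact S : compact S. Proof. by case: (bisectP S). Qed.
Lemma Bis_open S : open S. Proof. by case: (bisectP S). Qed.

Lemma Bis_dom_inj S g h : bisect S g -> bisect S h -> gdom g = gdom h -> g = h.
Proof.
by move=> Sg Sh; case: (bisectP S) => _ _ /(_ g h); rewrite !inE => + _; exact.
Qed.

Lemma Bis_cod_inj S g h : bisect S g -> bisect S h -> gcod g = gcod h -> g = h.
Proof.
by move=> Sg Sh; case: (bisectP S) => _ _ _ /(_ g h); rewrite !inE; exact.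
Qed.

Definition Bis_unit W (cW : compact W) (oW : open W) : Bis G :=
  Bisection (unit_bisection cW oW).

Lemma ginv_bisection S : compact_open_bisection (@ginv G @` S).
Proof.
split.
- apply: continuous_compact; last exact: Bis_compact.
  exact: continuous_subspaceT ginv_continuous.
- have -> : @ginv G @` S = @ginv G @^-1` S.
    apply/seteqP; split=> [_ [g Sg <-]|g Sg].
      by rewrite /preimage/mkset (ginvK gG).
    by exists (ginv g) => //; rewrite (ginvK gG).
  by apply: open_comp_cts; [exact: ginv_continuous | exact: Bis_open].
- move=> _ _ /set_mem[g Sg <-] /set_mem[h Sh <-].
  by rewrite !(gdom_inv gG) => /(Bis_cod_inj Sg Sh) ->.
- move=> _ _ /set_mem[g Sg <-] /set_mem[h Sh <-].
  by rewrite !(gcod_inv gG) => /(Bis_dom_inj Sg Sh) ->.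
Qed.

Definition Bis_inv S : Bis G := Bisection (ginv_bisection S).

Lemma Bis_invK : involutive Bis_inv.
Proof.
move=> S; apply: Bis_eq; apply/seteqP; split=> [_ [_ [g Sg <-] <-]|g Sg] /=.
  by rewrite (ginvK gG).
exists (ginv g); last by rewrite (ginvK gG).
by exists g.
Qed.

(** In a product of arrows of [S], of its inverse and of [S], injectivity of the domain and codomain
    maps forces all three factors to come from the same arrow. *)
Lemma Bis_mulVK S : S * Bis_inv S * S = S.
Proof.
apply: Bis_eq; apply/seteqP; split=> g.
  move=> [hl' [k [p [[h [l' [q [Sh [l Sl lE] hlE]]]] Sk ->]]]].
  subst l' hl'.
  have hl : h = l.
    by apply: (Bis_dom_inj Sh Sl); rewrite q (gcod_inv gG).
  have lk : l = k.
    apply: (Bis_cod_inj Sl Sk).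
    by rewrite -p (gdom_mul gG) (gdom_inv gG).
  subst h k; have u : gdom (gunit (gcod l)) = gcod l by rewrite (gdom_unit gG).
  suff -> : gmul (gmul l (ginv l) q) l p = l by [].
  by rewrite -[RHS](g1mul gG u); apply: gmul_congr => //; exact: gmulV.
move=> Sg.
have p : gdom g = gcod (ginv g) by rewrite (gcod_inv gG).
have q : gdom (gmul g (ginv g) p) = gcod g.
  by rewrite (gdom_mul gG) (gdom_inv gG).
exists (gmul g (ginv g) p), g, q; split=> //.
  by exists g, (ginv g), p; split=> //; exists g.
have u : gdom (gunit (gcod g)) = gcod g by rewrite (gdom_unit gG).
rewrite -[LHS](g1mul gG u); apply: gmul_congr => //.
by rewrite (gmulV gG).
Qed.

Lemma Bis_is_inverse : is_inverse_semigroup (Bis G).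
Proof.
move=> S; exists (Bis_inv S); split.
  split; first exact: Bis_mulVK.
  by rewrite -{2}(Bis_invK S) Bis_mulVK.
(* This half of the uniqueness argument serves twice: for [S], [T] it gives one inclusion, and for
   [T], [S], after inversion, the other. *)
have main S' T' : S' * T' * S' = S' -> Bis_inv S' `<=` T'.
  move=> STS _ [g Sg <-].
  have : bisect (S' * T' * S') g by rewrite STS.
  move=> [hl [k [p [[h [l [q [Sh Tl hlE]]]] Sk gE]]]]; subst hl.
  have gh : g = h.
    by apply: (Bis_cod_inj Sg Sh); rewrite gE !(gcod_mul gG).
  have gk : g = k by apply: (Bis_dom_inj Sg Sk); rewrite gE (gdom_mul gG).
  subst h k; suff <- : l = ginv g by [].
  exact: (gmul_inv_uniq gG (esym gE)).
move=> T [STS TST]; apply: Bis_eq; apply/seteqP; split; first exact: main.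
move=> g Tg; exists (ginv g); last exact: ginvK.
by apply: (main _ _ TST); exists g.
Qed.

Let isB := Bis_is_inverse.

Lemma Bis_starE S : star S = Bis_inv S.
Proof.
apply: (star_uniq isB); split; first exact: Bis_mulVK.
by rewrite -{2}(Bis_invK S) Bis_mulVK.
Qed.

(** If [E * E = E], an arrow of [E] is a product of two arrows of [E], both equal to it by
    injectivity of codomain and domain; an arrow with [g g = g] is a unit. *)
Lemma Bis_idemP E : idem E <-> E `<=` range (@gunit G).
Proof.
split=> [EE g Eg|sub].
  have : bisect (E * E) g by rewrite EE.
  move=> [h [k [p [Eh Ek gE]]]].
  have gh : g = h by apply: (Bis_cod_inj Eg Eh); rewrite gE (gcod_mul gG).
  have gk : g = k by apply: (Bis_dom_inj Eg Ek); rewrite gE (gdom_mul gG).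
  subst h k; exists (gdom g) => //; apply/esym.
  exact: (gmul_idem gG (esym gE)).
apply: Bis_eq; apply/seteqP; split=> g.
  move=> [h [k [p [Eh Ek ->]]]]; have [x _ xh] := sub _ Eh; subst h.
  by rewrite gmul_unitl.
move=> Eg; have [x _ xg] := sub _ Eg; subst g.
have p : gdom (gunit x) = gcod (gunit x).
  by rewrite (gdom_unit gG) (gcod_unit gG).
by exists (gunit x), (gunit x), p; split=> //; rewrite gmul_unitl.
Qed.

Lemma Bis_unit_idem W (cW : compact W) (oW : open W) : idem (Bis_unit cW oW).
Proof. by apply/Bis_idemP => _ [x _ <-]; exists x. Qed.

Lemma Bis_mul_unitr S W (cW : compact W) (oW : open W) g :
  bisect (S * Bis_unit cW oW) g <-> bisect S g /\ W (gdom g).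
Proof.
split=> [[h [k [p [Sh [x Wx xk] ->]]]]|[Sg Wg]].
  subst k.  by rewrite gmul_unitr// p (gcod_unit gG).
have p : gdom g = gcod (gunit (gdom g)) by rewrite (gcod_unit gG).
by exists g, (gunit (gdom g)), p; split=> //; [exists (gdom g) | rewrite gmul_unitr].
Qed.

(** A bisection contained in [T] is the restriction of [T] to its own domain, a set of units that is
    compact and open because [gdom] is a local homeomorphism. *)
Lemma Bis_sleP S T : sle S T <-> S `<=` T.
Proof.
split=> [[E /Bis_idemP EE ->] _ [g [h [p [Tg Eh ->]]]]|ST].
  by have [x _ xh] := EE _ Eh; subst h; rewrite gmul_unitr.
have cW : compact (@gdom G @` S).
  apply: continuous_compact; last exact: Bis_compact.
  exact: continuous_subspaceT gdom_continuous.
have oW : open (@gdom G @` S).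
  exact: lhomeo_open (gdom_lhomeo (bgdataP G)) (Bis_open S).
exists (Bis_unit cW oW); first exact: Bis_unit_idem.
apply: Bis_eq; apply/seteqP; split=> g.
  by move=> Sg; apply/Bis_mul_unitr; split; [exact: ST | exists g].
move=> /Bis_mul_unitr[Tg [h Sh hg]].
by rewrite -(Bis_dom_inj (ST _ Sh) Tg hg).
Qed.

Definition Bis0 : Bis G := Bis_unit (@compact0 _) open0.

Lemma Bis_zeroP S : is_zero S <-> S `<=` set0.
Proof.
have z0 (T : Bis G) : T `<=` set0 -> is_zero T.
  move=> T0 U; split; apply: Bis_eq; apply/seteqP; split=> g.
  - by move=> [h [k [p [/T0]]]].
  - by move=> /T0.
  - by move=> [h [k [p [_ /T0]]]].
  - by move=> /T0.
split; last exact: z0.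
move=> S0; have Bis00 : Bis0 `<=` set0 by move=> _ [x []].
by rewrite (is_zero_uniq S0 (z0 _ Bis00)).
Qed.

Definition Bis_units E : set (gobj G) := @gunit G @^-1` E.

Lemma Bis_unitsK E : idem E -> @gunit G @` Bis_units E = E.
Proof.
move=> /Bis_idemP EE; apply/seteqP; split=> [_ [x Ex <-]//|g Eg].
by have [x _ xg] := EE _ Eg; exists x => //; rewrite /Bis_units /preimage/mkset xg.
Qed.

Lemma Bis_units_open E : open (Bis_units E).
Proof. by apply: open_comp_cts; [exact: gunit_continuous | exact: Bis_open]. Qed.

Lemma Bis_units_compact E : idem E -> compact (Bis_units E).
Proof.
move=> EE; have -> : Bis_units E = @gdom G @` E.
  rewrite -[in RHS](Bis_unitsK EE) image_comp; apply/seteqP; split=> [x Ex|].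
    by exists x => //=; rewrite (gdom_unit gG).
  by move=> _ [x Ex <-]; rewrite /= (gdom_unit gG).
apply: continuous_compact; last exact: Bis_compact.
exact: continuous_subspaceT gdom_continuous.
Qed.

Lemma gunit_inj : injective (@gunit G).
Proof. by move=> x y xy; rewrite -(gdom_unit gG x) xy (gdom_unit gG). Qed.

Lemma Bis_unitsE W (cW : compact W) (oW : open W) :
  Bis_units (Bis_unit cW oW) = W.
Proof.
apply/seteqP; split=> [x [y Wy /gunit_inj <-]//|x Wx].
by exists x.
Qed.

Lemma Bis_boolean_idempotents : boolean_idempotents (Bis G).
Proof.
pose phi (E : @idem (Bis G)) : co_lattice bG :=
  CompactOpen (Bis_units_compact (set_mem (valP E))) (@Bis_units_open (val E)).
pose psi (W : co_lattice bG) : @idem (Bis G) :=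
  exist (fun E => E \in @idem (Bis G)) _ (mem_set (Bis_unit_idem (@co_compact _ W) (@co_open _ W))).
exists Order.default_display, (co_lattice bG), phi; split.
  exists psi.
    move=> E; apply: val_inj; apply: Bis_eq.
    exact: Bis_unitsK (set_mem (valP E)).
  by move=> W; apply: co_eq; exact: Bis_unitsE.
move=> E F; rewrite Bis_sleP; split=> [EF|/co_leP EF].
  by apply/co_leP => x; exact: EF.
rewrite -(Bis_unitsK (set_mem (valP E))) -(Bis_unitsK (set_mem (valP F))).
exact: image_subset.
Qed.

Lemma BisU_join (A : set (Bis G)) S T U : A U -> U = S `|` T :> set G ->
  is_join_in A S T U.
Proof.
move=> AU UE; split=> //.
- by apply/Bis_sleP; rewrite UE; exact: subsetUl.
- by apply/Bis_sleP; rewrite UE; exact: subsetUr.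
- by move=> V AV /Bis_sleP SV /Bis_sleP TV; apply/Bis_sleP; rewrite UE subUset.
Qed.

(** Emptiness of the two products of the orthogonality condition means that [S] and [T] have
    disjoint codomains and disjoint domains, so their union is still a bisection. *)
Lemma Bis_orthogonal_join S T : orthogonal S T ->
  exists U : Bis G, U = S `|` T :> set G.
Proof.
rewrite /orthogonal !Bis_starE => -[/Bis_zeroP ST /Bis_zeroP TS].
have disjd g h : bisect S g -> bisect T h -> gdom g <> gdom h.
  move=> Sg Th gh; have p : gdom g = gcod (ginv h) by rewrite (gcod_inv gG).
  by apply: (TS (gmul g (ginv h) p)); exists g, (ginv h), p; split=> //; exists h.
have disjc g h : bisect S g -> bisect T h -> gcod g <> gcod h.
  move=> Sg Th gh; have p : gdom (ginv g) = gcod h by rewrite (gdom_inv gG).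
  by apply: (ST (gmul (ginv g) h p)); exists (ginv g), h, p; split=> //; exists g.
have UP : compact_open_bisection (S `|` T).
  split.
  - by apply: compactU; exact: Bis_compact.
  - by apply: openU; exact: Bis_open.
  - move=> g h /set_mem[Sg|Tg] /set_mem[Sh|Th] gh.
    + exact: Bis_dom_inj Sg Sh gh.
    + by case: (disjd _ _ Sg Th).
    + by case: (disjd _ _ Sh Tg).
    + exact: Bis_dom_inj Tg Th gh.
  - move=> g h /set_mem[Sg|Tg] /set_mem[Sh|Th] gh.
    + exact: Bis_cod_inj Sg Sh gh.
    + by case: (disjc _ _ Sg Th).
    + by case: (disjc _ _ Sh Tg).
    + exact: Bis_cod_inj Tg Th gh.
by exists (Bisection UP).
Qed.

Lemma Bis_boolean : is_boolean_inverse_semigroup (Bis G).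
Proof.
split; [exact: isB | | exact: Bis_boolean_idempotents |].
  by exists Bis0; apply/Bis_zeroP => _ [x []].
move=> S T /Bis_orthogonal_join[U UE].
by exists U; exact: BisU_join.
Qed.

(** The union is itself a compact open set of units, hence a join among idempotents, and joins are
    unique. *)
Lemma Bis_idem_joinE E F K : idem E -> idem F ->
  is_join_in (@idem (Bis G)) E F K -> K = E `|` F :> set G.
Proof.
move=> EE FF EFK.
have cW := compactU (Bis_units_compact EE) (Bis_units_compact FF).
have oW := openU (@Bis_units_open E) (@Bis_units_open F).
have UE : Bis_unit cW oW = E `|` F :> set G.
  by rewrite /= image_setU !Bis_unitsK.
have h := BisU_join (Bis_unit_idem cW oW) UE.
by rewrite (is_join_uniq isB EFK h).
Qed.

End BisTheory.

(** * Bisections on multiplier actions *)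

Section BisMap.
Context (H G : boolGroupoid) (a : multiplier H G).
Implicit Types (S T : Bis H) (eta : H) (g h : G).

Let gG : is_groupoid G := tgroupoid (btgroupoid (bgdataP G)).
Let gH : is_groupoid H := tgroupoid (btgroupoid (bgdataP H)).
Let aM : is_multiplier_action a := (mactP a).1.

(* An action that commutes with right multiplication is determined by its
   restriction to the units. *)
Lemma act_unitr eta g (p : gdom eta = moment a g)
    (p' : gdom eta = moment0 a (gcod g))
    (q : gdom (act a eta (gunit (gcod g)) p') = gcod g) :
  act a eta g p = gmul (act a eta (gunit (gcod g)) p') g q.
Proof.
have r : gdom (gunit (gcod g)) = gcod g by rewrite (gdom_unit gG).
have p'' : gdom eta = moment a (gmul (gunit (gcod g)) g r).
  by rewrite (g1mul gG).
rewrite -(actC aM r p' p'' q); apply: act_congr => //.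
by rewrite (g1mul gG).
Qed.

(** The action preserves domains, so the unit acted upon can only be the one at [gdom g]. *)
Lemma Bis_mapP S g : bisect (Bis_map a S) g <->
  exists eta (p : gdom eta = moment0 a (gdom g)),
    bisect S eta /\ g = act a eta (gunit (gdom g)) p.
Proof.
split=> [[eta [h [p [Se [x _ xh] gE]]]]|[eta [p [Se gE]]]].
  subst h.
  have xg : x = gdom g by rewrite gE (dom_act aM) (gdom_unit gG).
  by subst x; exists eta, p.
by exists eta, (gunit (gdom g)), p; split=> //; exists (gdom g).
Qed.

Lemma Bis_map_act S eta g (p : gdom eta = moment a g) (T' : Bis G) :
  bisect S eta -> bisect T' g -> bisect (Bis_map a S * T')%g (act a eta g p).
Proof.
move=> Se Tg; have p' : gdom eta = moment0 a (gcod g) by rewrite -moment_cod.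
have q : gdom (act a eta (gunit (gcod g)) p') = gcod g.
  by rewrite (dom_act aM) (gdom_unit gG).
exists (act a eta (gunit (gcod g)) p'), g, q; split=> //; last exact: act_unitr.
apply/Bis_mapP; exists eta.
have r : gdom eta = moment0 a (gdom (act a eta (gunit (gcod g)) p')).
  by rewrite q.
by exists r; split=> //; apply: act_congr => //; rewrite q.
Qed.

Lemma Bis_map_units S x : idem S ->
  bisect (Bis_map a S) (gunit x) <-> bisect S (gunit (moment0 a x)).
Proof.
move=> /Bis_idemP SS; rewrite Bis_mapP; split=> [[eta [p [Se _]]]|Sx].
  have [y _ ye] := SS _ Se; subst eta.
  by move: p; rewrite (gdom_unit gH) (gdom_unit gG) => <-.
have p : gdom (gunit (moment0 a x)) = moment0 a (gdom (gunit x)).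
  by rewrite (gdom_unit gG) (gdom_unit gH).
exists (gunit (moment0 a x)), p; split=> //.
have q : gdom (gunit (moment a (gunit x))) = moment a (gunit x).
  by rewrite (gdom_unit gH).
rewrite -[LHS](act_unit aM q); apply: act_congr => //.
by rewrite (gdom_unit gG).
Qed.

Lemma Bis_map_idem S : idem S -> idem (Bis_map a S).
Proof.
move=> /Bis_idemP SS; apply/Bis_idemP => g /Bis_mapP[eta [p [Se ->]]].
have [y _ ye] := SS _ Se; subst eta.
exists (gdom g) => //; have q := p; rewrite (gdom_unit gH) in q.
have q' : gdom (gunit (moment a (gunit (gdom g)))) = moment a (gunit (gdom g)).
  by rewrite (gdom_unit gH).
rewrite -[LHS](act_unit aM q'); apply: act_congr => //.
by rewrite q.
Qed.

Lemma Bis_map_morphism : @is_bis_morphism (BoolInvSemigroup (@Bis_boolean H))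
  (BoolInvSemigroup (@Bis_boolean G)) (Bis_map a).
Proof.
split=> /=.
- move=> S T; apply: Bis_eq; apply/seteqP; split=> g.
    move=> /Bis_mapP[st [p [[s [t [q [Ss Tt stE]]]] ->]]]; subst st.
    have p' : gdom t = moment0 a (gdom g) by rewrite -p (gdom_mul gH).
    have r : gdom s = moment a (act a t (gunit (gdom g)) p').
      by rewrite (moment_act aM).
    (* An arrow [(s t) x] is [s (t x)], and [t x] belongs to the image of [T]. *)
    rewrite -(actA aM q p' r p); apply: Bis_map_act => //.
    apply/Bis_mapP; exists t.
    have r' : gdom t = moment0 a (gdom (act a t (gunit (gdom g)) p')).
      by rewrite (dom_act aM) (gdom_unit gG).
    exists r'; split=> //; apply: act_congr => //.
    by rewrite (dom_act aM) (gdom_unit gG).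
  move=> [h [k [p [/Bis_mapP[s [q [Ss hE]]] /Bis_mapP[t [r [Tt kE]]] ->]]]].
  have kt : moment a k = gcod t by rewrite kE (moment_act aM).
  have q' : gdom s = gcod t by rewrite q p -moment_cod.
  have q2 : gdom s = moment a k by rewrite kt.
  have q3 : gdom s = moment0 a (gcod k) by rewrite -moment_cod.
  have q4 : gdom (act a s (gunit (gcod k)) q3) = gcod k.
    by rewrite (dom_act aM) (gdom_unit gG).
  (* Here [h] is [s] applied to the unit at [gcod k], so multiplying by [k] is acting by [s] on [k];
     as [k] is [t] applied to a unit, associativity yields [s t] applied to that unit. *)
  have hkE : gmul h k p = act a s k q2.
    rewrite (act_unitr q2 q4); apply: gmul_congr => //.
    by rewrite hE; apply: act_congr => //; rewrite p.
  apply/Bis_mapP; exists (gmul s t q').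
  have r' : gdom (gmul s t q') = moment0 a (gdom (gmul h k p)).
    by rewrite (gdom_mul gH) (gdom_mul gG).
  exists r'; split; first by exists s, t, q'.
  have r2 : gdom t = moment a (gunit (gdom (gmul h k p))).
    by rewrite (gdom_mul gG).
  have r3 : gdom s = moment a (act a t (gunit (gdom (gmul h k p))) r2).
    by rewrite (moment_act aM).
  rewrite -(actA aM q' r2 r3 r'); apply: (etrans hkE); apply: act_congr => //.
  by apply: (etrans kE); apply: act_congr => //; rewrite (gdom_mul gG).
- by move=> S /Bis_zeroP S0; apply/Bis_zeroP => g /Bis_mapP[eta [p [/S0]]].
- move=> E F K EE FF EFK; have KE := Bis_idem_joinE EE FF EFK.
  have [KK _ _ _] := EFK; apply: BisU_join; first exact: Bis_map_idem.
  apply/seteqP; split=> g.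
    move=> /Bis_mapP[eta [p []]]; rewrite KE => -[Ee|Fe] gE.
      by left; apply/Bis_mapP; exists eta, p.
    by right; apply/Bis_mapP; exists eta, p.
  by move=> [|] /Bis_mapP[eta [p [Se gE]]]; apply/Bis_mapP; exists eta, p;
    split=> //; rewrite KE; [left | right].
(* Nondegeneracy: the anchor maps the units of [E] onto a compact set, which some compact open [W]
   contains. *)
- move=> E EE; have [_ [cm _]] := mactP a.
  have cm0 : compact (moment0 a @` Bis_units E).
    apply: continuous_compact; last exact: Bis_units_compact.
    exact: continuous_subspaceT.
  have [W [cW oW EW _]] :=
    boolean_space_capture (boolean_obj (bgdataP H)) cm0 openT (@subsetT _ _).
  exists (Bis_unit cW oW); first exact: Bis_unit_idem.
  apply/Bis_sleP => g Eg; have [x _ xg] := (Bis_idemP E).1 EE _ Eg; subst g.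
  apply/Bis_map_units; first exact: Bis_unit_idem.
  by exists (moment0 a x) => //; apply: EW; exists x.
Qed.

End BisMap.

Definition BisObj (G : boolGroupoid) : boolInvSemigroup :=
  BoolInvSemigroup (@Bis_boolean G).

Definition Bis_mor (H G : boolGroupoid) (a : multiplier H G) :
    bis_morphism (BisObj H) (BisObj G) :=
  @BisMorphism (BisObj H) (BisObj G) (Bis_map a) (Bis_map_morphism a).

Lemma Bis_functor : @is_functor bgroupoid_cat bis_cat BisObj Bis_mor.
Proof.
split.
- move=> G; have gG := tgroupoid (btgroupoid (bgdataP G)).
  apply: bis_morphism_eq; apply/funext => S /=.
  apply: Bis_eq; apply/seteqP; split=> g /=.
    move=> [h [k [p [Sh [x _ xk] ->]]]]; subst k.
    have -> : act (multiplier_id G) h (gunit x) p = h by exact: gmul_unitr.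
    exact: Sh.
  move=> Sg; have p := esym (gcod_unit gG (gdom g)).
  exists g, (gunit (gdom g)), p; split; [exact: Sg | by exists (gdom g) |].
  by apply/esym; exact: gmul_unitr.
- move=> K H G a b; have gG := tgroupoid (btgroupoid (bgdataP G)).
  have gH := tgroupoid (btgroupoid (bgdataP H)).
  have [aM _] := mactP a; have [bM _] := mactP b.
  apply: bis_morphism_eq; apply/funext => S.
  apply: Bis_eq; apply/seteqP; split=> g.
    move=> [k [h [p [Sk [x _ xh] ->]]]]; subst h.
    exists (act b k (gunit (moment a (gunit x))) p), (gunit x).
    exists (action_comp_subproof p); split; [|by exists x|by []].
    by exists k, (gunit (moment a (gunit x))), p; split;
      [exact: Sk | exists (moment a (gunit x)) | ].
  move=> [eta [h [p [[k [l [q [Sk [y _ yl] etaE]]]] [x _ xh] ->]]]].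
  subst eta h l; have yx : y = moment a (gunit x).
    by rewrite -p (dom_act bM) (gdom_unit gH).
  subst y; exists k, (gunit x), q; split; [exact: Sk | by exists x |].
  exact: act_congr.
Qed.

(** * The germ bisections of an inverse semigroup *)

(** The natural map [s |-> B s] starts at the identity functor, whereas the equivalence asks for one
    that ends there. *)
Lemma naturally_isomorphic_sym (C D : category) (F G : functor C D) :
  naturally_isomorphic F G -> naturally_isomorphic G F.
Proof.
move=> [eta [etaI etaN]].
pose inv a := sval (cid (etaI a)).
have invl a : Defs.comp (inv a) (eta a) = idm _ by case: (svalP (cid (etaI a))).
have invr a : Defs.comp (eta a) (inv a) = idm _ by case: (svalP (cid (etaI a))).
exists inv; split=> [a|a b f]; first by exists (eta a).
rewrite -[LHS]comp_idr -(invr a) Defs.compA -(Defs.compA (inv b)) -etaN.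
by rewrite (Defs.compA (inv b)) invl comp_idl.
Qed.

(** The inverse of a multiplicative bijection is multiplicative, so it preserves idempotents and the
    order, and with them zero and joins. *)
Lemma bis_isomorphism (H G : boolInvSemigroup) (j : bis_morphism H G) :
  bijective j -> @isomorphism bis_cat H G j.
Proof.
move=> [k jK kK]; have jP := bmorP j; have j_inj := can_inj jK.
have isH := @bis_inv H; have isG := @bis_inv G.
have kM s t : k (s * t)%g = (k s * k t)%g.
  by apply: j_inj; rewrite (bmorM jP) !kK.
have kI e : idem e -> idem (k e) by move=> ee; rewrite /idem/= -kM ee.
have kle s t : sle s t -> sle (k s) (k t).
  by move=> [e ee ->]; exists (k e); [exact: kI | exact: kM].
have kP : is_bis_morphism k.
  split=> //.
  - move=> z z0 s; split; apply: j_inj; rewrite (bmorM jP) kK.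
      by rewrite (z0 _).1.
    by rewrite (z0 _).2.
  - move=> e f g ee ff [gg eg fg glub]; split; [exact: kI | exact: kle..|].
    move=> v vv /(bmor_sle jP) ev /(bmor_sle jP) fv; rewrite -(jK v).
    apply: kle; apply: glub; first exact: bmor_idem jP vv.
      by rewrite -(kK e).
    by rewrite -(kK f).
  - move=> e ee; exists (j e); first exact: bmor_idem jP ee.
    by rewrite jK; exact: sle_refl.
exists (BisMorphism kP); split; apply: bis_morphism_eq; apply/funext => s.
  exact: jK.
exact: kK.
Qed.

Section GermBisections.
Local Open Scope group_scope.
Context (G : boolInvSemigroup).
Implicit Types (s t e f z : G) (g h : germ_groupoid G).

Let isG := @bis_inv G.

Lemma germ_set_mul s t g : germ_set (s * t) g -> exists k h (p : gdom k = gcod h),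
  [/\ germ_set s k, germ_set t h & g = gmul k h p].
Proof.
move=> gst; have := germ_set_dom gst; rewrite sdomM => gd.
have ds := idem_dom isG s.
have gt : gdom g (sdom t).
  apply: dual_le gd; first exact: idem_dom.
  rewrite /sdom -(mulgA (star t)); apply: sle_mul => //; first exact: sle_refl.
  exact: (sle_mull isG t ds).
have [h ht hg] := germ_set_at gt.
have hs : gcod h (sdom s) by rewrite (germ_cod_set ht ds) hg.
have [k ks kh] := germ_set_at hs.
exists k, h, kh; split=> //.
by apply: germ_set_eq gst (germ_mul_set kh ks ht) _; rewrite germ_dom_mul.
Qed.

Lemma germ_set_empty s : germ_set s `<=` set0 -> is_zero s.
Proof.
move=> s0; apply: (is_zero_dom isG).
have [z z0] := bis_zero G; apply: (le_is_zero z0).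
apply: dual_set_le; [exact: idem_dom | exact: is_zero_idem |].
by move=> x xs; have [g /s0] := germ_set_at xs.
Qed.

Lemma germ_set_zero z : is_zero z -> germ_set z `<=` set0.
Proof.
move=> z0 g /germ_set_dom; apply: dual_zero.
by rewrite /sdom; exact: is_zero_mulr.
Qed.

(** By [join_agree] the idempotents on which [s] and [t] agree form an ideal. If it misses [sdom s],
    a prime filter through [sdom s] avoiding it is a point where the germ of [s] is not a germ of
    [t]. *)
Lemma germ_set_sle s t : germ_set s `<=` germ_set t -> sle s t.
Proof.
move=> st; apply/(sleP isG); apply: contrapT => nst.
pose I := [set e | idem e /\ s * e = t * e].
have ds := idem_dom isG s.
have [||x [xs xI]] := @prime_filter_ex _ I _ _ ds.
- split.
  + by move=> e [].
  + by move=> z z0; split; [exact: is_zero_idem | rewrite !(z0 _).2].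
  + move=> e f [ff sf] ee /(sle_idemE ee ff) ef; split=> //.
    by rewrite -ef !mulgA sf.
  + move=> e f g [ee se] [ff sf] efg; have [gg _ _ _] := efg.
    by split=> //; exact: join_agree efg se sf.
- by move=> [_ h]; apply: nst; rewrite -h mul_dom.
- have [g gs gx] := germ_set_at xs.
  have [e [ee ge se]] := germ_set_common gs (st _ gs).
  by apply: (xI e); [split | rewrite -gx].
Qed.

Definition germ_bisection s : BisObj (Germ G) :=
  @Bisection (Germ G) _ (germ_set_bisection s).

Lemma germ_bisection_morphism : is_bis_morphism germ_bisection.
Proof.
split.
- move=> s t; apply: Bis_eq; apply/seteqP; split=> g; first exact: germ_set_mul.
  by move=> [k [h [p [ks ht ->]]]]; exact: germ_mul_set.
- by move=> z /germ_set_zero z0; apply/Bis_zeroP.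
- move=> e f g ee ff efg; have [gg eg fg _] := efg; apply: BisU_join.
    apply: Bis_eq; apply/seteqP; split=> h.
      move=> [k [l [p [/= kg lg ->]]]].
      by rewrite -gg; exact: germ_mul_set.
    by rewrite /= -{1}gg; exact: germ_set_mul.
  apply/seteqP; split=> h; last first.
    by move=> []; exact: germ_set_le.
  move=> hg; have := germ_set_dom hg; rewrite sdom_idem//.
  have h' a : idem a -> sle a g -> gdom h a -> germ_set a h.
    by move=> aa /(sle_idemE aa gg) ga ha; rewrite -ga; exact: germ_set_restrict.
  by move=> /(dual_join _ ee ff efg)[]; [left | right]; exact: h'.
- move=> E EE; have [e ee Ee] := dual_compact_bounded (Bis_units_compact EE).
  exists e => //; apply/Bis_sleP => g Eg.
  have [x _ xg] := (Bis_idemP E).1 EE _ Eg; rewrite -xg.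
  by apply: germ_unit_set; apply: Ee; rewrite /Bis_units /preimage/mkset xg.
Qed.

Definition germ_bis_mor : bis_morphism G (BisObj (Germ G)) :=
  BisMorphism germ_bisection_morphism.

(* Two germ bisections inside a common bisection can be made orthogonal by
   removing from one of them the domain of the other, and then joined. *)
Lemma germ_set_union (S : BisObj (Germ G)) s t : germ_set s `<=` bisect S ->
  germ_set t `<=` bisect S -> exists u, germ_set u = germ_set s `|` germ_set t.
Proof.
move=> sS tS; have ds := idem_dom isG s; have dt := idem_dom isG t.
have [c [cc ct _ cE]] := dual_diff dt ds.
have tcS g : germ_set (t * c) g -> bisect S g.
  by move=> /(germ_set_le (sle_mulr t cc))/tS.
have dtc : sdom (t * c) = c.
  by rewrite sdom_mulr//; exact/(sle_idemE cc dt).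
have disj g h : germ_set s g -> germ_set (t * c) h -> g <> h.
  move=> /germ_set_dom gs /germ_set_dom; rewrite dtc => /cE[_ nhs] gh.
  by apply: nhs; rewrite -gh.
have orth : orthogonal s (t * c).
  (* A germ of either product would give arrows of [s] and of [t * c] with a common codomain, or a
     common domain. Both lie in [S], so they would coincide, although their domains are disjoint. *)
  split; apply: germ_set_empty => g /germ_set_mul[k [h [p [ks ht _]]]].
    have ks' : germ_set s (ginv k).
      by rewrite -(starK isG s); exact: germ_inv_set.
    apply: (disj _ _ ks' ht).
    apply: (@Bis_cod_inj (Germ G) S) => //; [exact: sS | exact: tcS |].
    by rewrite -p; exact: germ_cod_inv.
  have ht' : germ_set (t * c) (ginv h).
    by rewrite -(starK isG (t * c)); exact: germ_inv_set.
  apply: (disj _ _ ks ht').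
  apply: (@Bis_dom_inj (Germ G) S) => //; [exact: sS | exact: tcS |].
  by rewrite p; apply/esym; exact: germ_dom_inv.
have [_ _ _ joins] := bsortP G.
have [u stu] := joins _ _ orth; have [_ su tu _] := stu.
have dtc' := idem_dom isG (t * c).
have [f fE] := idem_join ds dtc'.
exists u; apply/seteqP; split=> g.
  (* The domain of [u] is the join of the two domains, so primeness of the point decides which of
     [s] and [t * c] has the germ. *)
  move=> gu; have := germ_set_dom gu.
  rewrite (orthogonal_join_dom stu fE) => /(dual_join _ ds dtc' fE)[gd|gd].
    by left; rewrite -((sleP isG s u).1 su); exact: germ_set_restrict.
  right; apply: (germ_set_le (sle_mulr t cc)).
  by rewrite -((sleP isG _ _).1 tu); exact: germ_set_restrict.
move=> [/(germ_set_le su)//|gt].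
(* Over the domain of [s] the germs of [s] and [t] coincide, as both lie in [S]; elsewhere the point
   contains [c]. *)
have [gs|ngs] := pselect (gdom g (sdom s)).
  have [h hs hg] := germ_set_at gs; apply: (germ_set_le su).
  suff <- : h = g by [].
  by apply: (@Bis_dom_inj (Germ G) S); [exact: sS | exact: tS |].
apply: (germ_set_le tu); apply: germ_set_restrict => //.
by apply/cE; split=> //; exact: germ_set_dom.
Qed.

Lemma germ_bisection_bij : bijective germ_bisection.
Proof.
suff surj S : exists s, germ_bisection s = S.
  exists (fun S => sval (cid (surj S))); last first.
    by move=> S; exact: svalP (cid (surj S)).
  move=> s; case: cid => t /= /(congr1 (@bisect _)) /= ts.
  by apply: (sle_anti isG); apply: germ_set_sle; rewrite ts.
suff [s [Ss sS]] : exists s, bisect S `<=` germ_set s /\ germ_set s `<=` bisect S.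
  by exists s; apply: Bis_eq; apply/seteqP.
(* The inclusion in [S] is carried through the induction because unions of germ bisections exist
   only inside a common bisection. *)
apply: (compact_ind (P := fun A =>
  exists s, A `<=` germ_set s /\ germ_set s `<=` bisect S) (@Bis_compact _ S)).
- by have [z z0] := bis_zero G; exists z; split=> // g /(germ_set_zero z0).
- by move=> A B AB [s [Bs sS]]; exists s; split=> //; exact: subset_trans Bs.
- move=> A B [s [As sS]] [t [Bt tS]].
  have [u uE] := germ_set_union sS tS; exists u; rewrite uE; split.
    exact: setUSS.
  by rewrite subUset.
- move=> g Sg; have /germ_nbhs[s gs sS] : nbhs (g : germ_groupoid G) (bisect S).
    by apply: open_nbhs_nbhs; split; [exact: (@Bis_open _ S) |].
  exists (germ_set s); last by exists s; split.
  by apply/germ_nbhs; exists s.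
Qed.

End GermBisections.

(** Applying a germ of [s] to the unit at [x] gives the germ of [j s * e] at [x], for any idempotent
    [e] of [x], which is also the germ of [j s]. *)
Lemma germ_bisection_natural (H G : boolInvSemigroup) (j : bis_morphism H G)
  (s : H) : germ_bisection (j s) = Bis_map (Germ_map j) (germ_bisection s).
Proof.
have isG := @bis_inv G; have jP := bmorP j.
apply: Bis_eq; apply/seteqP; split=> g.
  move=> gs; apply/Bis_mapP.
  have xs : dual_map j (gdom (g : germ_groupoid G)) (sdom s).
    split; first exact: (idem_dom (@bis_inv H)).
    by rewrite -bmor_sdom; exact: germ_set_dom.
  have [eta es eE] := germ_set_at xs.
  have p : gdom eta = moment0 (Germ_map j) (gdom g).
    by rewrite eE; exact: (congr1 (fun f => f _) (esym (germ_moment0 j))).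
  exists eta, p; split=> //.
  have [e ge] := pf_ex (dptP (gdom (g : germ_groupoid G))).
  have := germ_act_set p es (germ_unit_set ge).
  move=> /(germ_set_le (sle_mulr (j s) (dual_idem ge))) h.
  by apply: germ_set_eq gs h _; rewrite germ_dom_act germ_dom_unit.
move=> /Bis_mapP[eta [p [es ->]]].
have [e ge] := pf_ex (dptP (gdom (g : germ_groupoid G))).
apply: (germ_set_le (sle_mulr (j s) (dual_idem ge))).
exact: germ_act_set p es (germ_unit_set ge).
Qed.

(** * The germs of the bisections of a groupoid *)

Record is_gfunctor (A B : groupoid_data) (f0 : gobj A -> gobj B) (f : A -> B)
  : Prop := IsGFunctor {
    gf_cts0 : continuous f0;
    gf_cts : continuous f;
    gf_dom : forall g, gdom (f g) = f0 (gdom g);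
    gf_cod : forall g, gcod (f g) = f0 (gcod g);
    gf_unit : forall x, f (gunit x) = gunit (f0 x);
    gf_mul : forall g h p q, f (gmul g h p) = gmul (f g) (f h) q }.

(** * Isomorphisms of topological groupoids as multiplier actions *)

Section IsoAction.
Context (A B : boolGroupoid) (f0 : gobj A -> gobj B) (f : A -> B)
  (k0 : gobj B -> gobj A).
Hypothesis fP : is_gfunctor f0 f.
Hypothesis k0_cts : continuous k0.
Hypotheses (f0K : cancel f0 k0) (k0K : cancel k0 f0).

Let gB : is_groupoid B := tgroupoid (btgroupoid (bgdataP B)).
Let gA : is_groupoid A := tgroupoid (btgroupoid (bgdataP A)).

Lemma iso_action_subproof eta (g : B) : gdom eta = k0 (gcod g) ->
  gdom (f eta) = gcod g.
Proof. by move=> p; rewrite (gf_dom fP) p k0K. Qed.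

(** The anchor of an action runs against the map of arrows, so it is built from the inverse [k0] on
    units, while arrows are transported by [f]. *)
Definition iso_action : action_data A B :=
  @ActionData A B (fun g => k0 (gcod g))
    (fun eta g p => gmul (f eta) g (iso_action_subproof p)).

Lemma iso_action_proper : is_proper_multiplier_action iso_action.
Proof.
have [_ gdc gcc guc gic gmc] := btgroupoid (bgdataP B).
split; last first.
  have -> : moment0 iso_action = k0.
    by apply/funext => x; rewrite /moment0 /= (gcod_unit gB).
  (* Preimages under [k0] are images under its continuous inverse [f0], hence compact. *)
  split=> // K cK; have -> : k0 @^-1` K = f0 @` K.
    apply/seteqP; split=> [x Kx|_ [x Kx <-]]; first by exists (k0 x).
    by rewrite /preimage/mkset f0K.
  by apply: continuous_compact cK; exact: continuous_subspaceT (gf_cts0 fP).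
split.
- by move=> g; apply: (@continuous_comp _ _ _ (@gcod B)); [exact: gcc | exact: k0_cts].
- pose F := fibprod (@gdom A) (moment iso_action).
  have h (z : F) : gdom (f (val z).1) = gcod (val z).2.
    exact: iso_action_subproof (set_mem (valP z)).
  have -> : on_fibprod (@act _ _ iso_action) =
      on_fibprod (@gmul B) \o (fun z : F => fibpair (h z)).
    by apply/funext => z; rewrite /= on_fibprodE; exact: gmul_congr.
  move=> z; apply: continuous_comp; last exact: gmc.
  apply: fibpair_continuous; last exact: fibprod_snd.
  move=> w; apply: (@continuous_comp _ _ _ (fun z : F => (val z).1) f).
    exact: fibprod_fst.
  exact: (gf_cts fP).
- move=> g p; have q : gdom (gunit (gcod g)) = gcod g by rewrite (gdom_unit gB).
  rewrite -[RHS](g1mul gB q); apply: gmul_congr => //.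
  by rewrite (gf_unit fP) /= k0K.
- by move=> eta g p; rewrite /= (gcod_mul gB) (gf_cod fP) f0K.
- move=> eta eta' g p q p' q' /=.
  have r : gdom (f eta) = gcod (f eta').
    by rewrite (gf_dom fP) (gf_cod fP) p.
  have r' : gdom (gmul (f eta) (f eta') r) = gcod g.
    by rewrite (gdom_mul gB); exact: iso_action_subproof.
  rewrite (gmulA gB r (iso_action_subproof q) _ r').
  by apply: gmul_congr => //; apply/esym; exact: (gf_mul fP).
- by move=> g g' p; rewrite /= (gcod_mul gB).
- by move=> eta g p; rewrite /= (gdom_mul gB).
- by move=> *; exact: (gmulA gB).
Qed.

Definition iso_multiplier : multiplier A B := Multiplier iso_action_proper.

End IsoAction.

(** The composite sends [eta] and [g] to the product of [k (f eta)] and [g], since [f eta] is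
    multiplied by a unit before [k] is applied; with [fK] this is multiplication in [A]. *)
Lemma iso_multiplierK (A B : boolGroupoid) (f0 : gobj A -> gobj B) (f : A -> B)
    (k0 : gobj B -> gobj A) (k : B -> A) (fP : is_gfunctor f0 f)
    (kP : is_gfunctor k0 k) (f0K : cancel f0 k0) (k0K : cancel k0 f0)
    (fK : cancel f k) :
  multiplier_comp (iso_multiplier kP (gf_cts0 fP) k0K f0K)
    (iso_multiplier fP (gf_cts0 kP) f0K k0K) = multiplier_id A.
Proof.
have gB := tgroupoid (btgroupoid (bgdataP B)).
apply: multiplier_eq.
  by apply/funext => g; rewrite /= /moment0 /= (gcod_unit gB) f0K.
move=> eta g p q; apply: gmul_congr => //.
rewrite -[RHS]fK; congr k.
exact: (gmul_unitr gB).
Qed.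

(** * A Boolean groupoid and the germs of its bisections *)

Section BisGerm.
Context (G : boolGroupoid).
Implicit Types (S T : BisObj G) (g h : G) (x y : gobj G).

Let gG : is_groupoid G := tgroupoid (btgroupoid (bgdataP G)).
Let bG : boolean_space (gobj G) := boolean_obj (bgdataP G).
Let isB : is_inverse_semigroup (BisObj G) := @bis_inv (BisObj G).

(** On a small open set [W] around [g] both [gdom] and [gcod] are injective. Restricting [W] to a
    compact open [K] inside its domain makes it a copy of [K] by [gdom], hence compact. *)
Lemma Bis_basis g (O : set G) : open O -> O g ->
  exists S, bisect S g /\ bisect S `<=` O.
Proof.
move=> oO Og.
have [U [oU Ug Uinj _ Uopen]] := gdom_lhomeo (bgdataP G) g.
have [V [oV Vg Vinj _ _]] := gcod_lhomeo (bgdataP G) g.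
pose W := O `&` U `&` V.
have oW : open W by apply: openI => //; exact: openI.
have odW : open (@gdom G @` W) by apply: Uopen => // z [[]].
have [|K [cK oK Kg KW]] := boolean_space_basis (x := gdom g) (U := @gdom G @` W) bG.
  by apply: open_nbhs_nbhs; split=> //; exists g.
pose S := W `&` @gdom G @^-1` K.
have oS : open S by apply: openI => //; exact: (open_comp_cts (@gdom_continuous G) oK).
have Sd : {in S &, injective (@gdom G)}.
  by move=> h k /set_mem[[[_ Uh] _] _] /set_mem[[[_ Uk] _] _];
    apply: Uinj; exact: mem_set.
have bS : compact_open_bisection S.
  split=> //; last first.
    by move=> h k /set_mem[[_ Vh] _] /set_mem[[_ Vk] _];
      apply: Vinj; exact: mem_set.
  apply: (compact_lift (f := @gdom G)) => //.
    by move=> Z oZ _; exact: lhomeo_open (gdom_lhomeo (bgdataP G)) oZ.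
  have -> : @gdom G @` S = K; last by [].
  apply/seteqP; split=> [_ [h [_ Kh] <-]//|x Kx].
  by have [h Wh hx] := KW _ Kx; exists h => //; split=> //; rewrite /preimage/mkset hx.
by exists (Bisection bS); split=> // z [[[]]].
Qed.

Lemma hat_prime_filter x :
  prime_filter [set E : BisObj G | idem E /\ bisect E (gunit x)].
Proof.
split.
- by move=> E [].
- have [K [cK oK Kx _]] := boolean_space_basis (U := setT) bG (@filterT _ (nbhs x) _).
  by exists (Bis_unit cK oK); split; [exact: Bis_unit_idem | exists x].
- by move=> Z /Bis_zeroP Z0 [_ /Z0].
- move=> E F [EE Ex] [FF Fx]; split; first exact: idemM.
  have p : gdom (gunit x) = gcod (gunit x).
    by rewrite (gdom_unit gG) (gcod_unit gG).
  by exists (gunit x), (gunit x), p; split=> //; rewrite gmul_unitr.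
- by move=> E F [EE Ex] FF /Bis_sleP EF; split=> //; exact: EF.
- move=> E F K EE FF /(Bis_idem_joinE EE FF) KE [_]; rewrite KE.
  by move=> [Ex|Fx]; [left | right].
Qed.

Definition hat x : dual (BisObj G) := Dual (hat_prime_filter x).

Lemma hatE E x : idem E -> hat x E <-> bisect E (gunit x).
Proof. by move=> EE; split=> [[]|]. Qed.

Lemma hat_inj : injective hat.
Proof.
move=> x y xy; have [_ hG _] := bG.
apply: hG => A B nA nB.
have [K [cK oK Kx KA]] := boolean_space_basis bG nA.
exists y; split; last exact: nbhs_singleton.
apply: KA; have : hat x (Bis_unit cK oK).
  by apply/hatE; [exact: Bis_unit_idem | exists x].
by rewrite xy => -[_ [z Kz /(@gunit_inj G) <-]].
Qed.

(** The unit sets of the members of [p] generate a filter in a compact space; a cluster point lies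
    in each of them, as they are closed. Its filter therefore contains [p], and inclusion of prime
    filters is equality. *)
Lemma hat_surj (p : dual (BisObj G)) : exists x, hat x = p.
Proof.
have [_ hG _] := bG.
have [E pE] := pf_ex (dptP p); have EE := dual_idem pE.
pose P := filter_from [set F : BisObj G | p F] (@Bis_units G).
have PP : ProperFilter P.
  apply: filter_from_proper.
    apply: filter_from_filter; first by exists E.
    move=> F K pF pK; exists (F * K)%g; first exact: (pf_mul (dptP p)).
    move=> x; have FF := dual_idem pF; have KK := dual_idem pK.
    have FK := idemM isB FF KK; move=> /(hatE _ FK)/(dualM _ FF KK)[].
    by move=> /(hatE _ FF) ? /(hatE _ KK).
  move=> F pF; apply: contrapT => F0; apply: (pf_zero (dptP p) _ pF).
  apply/Bis_zeroP => g Fg; apply: F0.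
  have [x _ xg] := (Bis_idemP F).1 (dual_idem pF) _ Fg.
  by exists x; rewrite /Bis_units /preimage/mkset xg.
have [|x [Ex clx]] := Bis_units_compact EE PP; first by exists E.
exists x; apply/esym; apply: dual_sub => F pF; have FF := dual_idem pF.
apply/(hatE _ FF).
have cF : closed (Bis_units F) by apply: compact_closed => //; exact: Bis_units_compact.
apply: cF => B nB; have [|y [Fy By]] := clx (Bis_units F) B _ nB.
  by exists F.
by exists y.
Qed.

Lemma hat_dom S g : bisect S g -> hat (gdom g) (sdom S).
Proof.
move=> Sg; apply/hatE; first exact: idem_dom.
rewrite /sdom Bis_starE.
have p : gdom (ginv g) = gcod g by rewrite (gdom_inv gG).
by exists (ginv g), g, p; split=> //; [exists g | rewrite (gmulVl gG)].
Qed.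

Lemma hat_dom_ex S x : hat x (sdom S) -> exists2 g, bisect S g & gdom g = x.
Proof.
move=> /hatE -/(_ (idem_dom isB S)).
move=> [h [g [p [_ Sg xE]]]]; exists g => //.
by rewrite -(gdom_mul gG p) -xE (gdom_unit gG).
Qed.

(** Two bisections through [g] contain a third one through [g], so they have the same germ there.
    Conversely a germ common to [S0] and [S] provides an idempotent at [gdom g] on which they agree,
    which puts [g] in [S]. *)
Lemma germ_at_ex g : exists h : Germ (BisObj G),
  (forall S, germ_set S h <-> bisect S g) /\ gdom h = hat (gdom g).
Proof.
have [S0 [S0g _]] := Bis_basis openT (I : setT g).
have [h0 h0S h0g] := germ_set_at (hat_dom S0g).
have mem S : bisect S g -> germ_set S h0.
  move=> Sg.
  have [|R [Rg RS]] := Bis_basis (O := bisect S0 `&` bisect S) _ (conj S0g Sg).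
    by apply: openI; exact: Bis_open.
  have [h hR hg] := germ_set_at (hat_dom Rg).
  have RS0 : sle R S0 by apply/Bis_sleP => z /RS[].
  have {}RS : sle R S by apply/Bis_sleP => z /RS[].
  suff -> : h0 = h by exact: germ_set_le RS _ hR.
  by apply: germ_set_eq h0S (germ_set_le RS0 hR) _; rewrite h0g.
exists h0; split=> // S; split=> [h0S'|]; last exact: mem.
have [E [EE]] := germ_set_common h0S h0S'.
rewrite h0g => /(hatE _ EE) Eg SE.
have : bisect (S0 * E)%g g.
  have p : gdom g = gcod (gunit (gdom g)) by rewrite (gcod_unit gG).
  by exists g, (gunit (gdom g)), p; split=> //; rewrite gmul_unitr.
rewrite SE; apply: (Bis_sleP _ _).1; exact: sle_mulr.
Qed.

Definition germ_at g : Germ (BisObj G) := sval (cid (germ_at_ex g)).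

Lemma germ_at_set S g : germ_set S (germ_at g) <-> bisect S g.
Proof. by rewrite /germ_at; case: cid => h [/= + _]; exact. Qed.

Lemma germ_at_dom g : gdom (germ_at g) = hat (gdom g).
Proof. by rewrite /germ_at; case: cid => h [/=]. Qed.

Lemma Bis_at g : exists S, bisect S g.
Proof. by have [S [Sg _]] := Bis_basis openT (I : setT g); exists S. Qed.

Lemma germ_at_inj : injective germ_at.
Proof.
move=> g h gh; have [S Sg] := Bis_at g.
have /germ_at_set Sh : germ_set S (germ_at h) by rewrite -gh; exact/germ_at_set.
by apply: (Bis_dom_inj Sg Sh); apply: hat_inj; rewrite -!germ_at_dom gh.
Qed.

Lemma germ_at_surj (k : Germ (BisObj G)) : exists g, germ_at g = k.
Proof.
have [S kS] := germ_set_ex k; have [x xk] := hat_surj (gdom k).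
have [|g Sg gx] := @hat_dom_ex S x; first by rewrite xk; exact: germ_set_dom.
exists g; apply: (germ_set_eq ((germ_at_set _ _).2 Sg) kS).
by rewrite germ_at_dom gx.
Qed.

Lemma germ_at_unit x : germ_at (gunit x) = gunit (hat x : gobj (Germ (BisObj G))).
Proof.
have [E [EE Ex]] := pf_ex (dptP (hat x)).
apply: (germ_set_eq ((germ_at_set _ _).2 Ex)).
  exact: germ_unit_set (conj EE Ex : hat x E).
by rewrite germ_at_dom germ_dom_unit (gdom_unit gG).
Qed.

(** For [S] through [g], conjugation by [g] shows that the product [star S * E * S] contains the
    unit at [gdom g] exactly when [E] contains the unit at [gcod g]. *)
Lemma germ_at_cod g : gcod (germ_at g) = hat (gcod g).
Proof.
have [S Sg] := Bis_at g; apply: dual_ext => E EE.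
have EEc := idem_conj isB S EE.
rewrite (germ_cod_set ((germ_at_set _ _).2 Sg) EE) germ_at_dom.
rewrite (hatE _ EE) (hatE _ EEc) Bis_starE; split.
  move=> [sE [k [p [[s' [e [q [[s Ss ss] Ee sEE]]]] Sk gE]]]].
  subst sE s'; have [y _ ye] := (Bis_idemP E).1 EE _ Ee; subst e.
  have gk : gdom k = gdom g by rewrite -(gdom_mul gG p) -gE (gdom_unit gG).
  have {}gk := Bis_dom_inj Sk Sg gk; subst k.
  suff -> : gcod g = y by [].
  by rewrite -p (gdom_mul gG) (gdom_unit gG).
move=> Eg.
have q : gdom (ginv g) = gcod (gunit (gcod g)).
  by rewrite (gdom_inv gG) (gcod_unit gG).
have p : gdom (gmul (ginv g) (gunit (gcod g)) q) = gcod g.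
  by rewrite (gdom_mul gG) (gdom_unit gG).
exists (gmul (ginv g) (gunit (gcod g)) q), g, p; split=> //.
  by exists (ginv g), (gunit (gcod g)), q; split=> //; exists g.
have r : gdom (ginv g) = gcod g by rewrite (gdom_inv gG).
rewrite -(gmulVl gG r); apply: gmul_congr => //.
by rewrite gmul_unitr.
Qed.

Lemma germ_at_mul g h (p : gdom g = gcod h)
    (q : gdom (germ_at g) = gcod (germ_at h)) :
  germ_at (gmul g h p) = gmul (germ_at g) (germ_at h) q.
Proof.
have [S Sg] := Bis_at g; have [T Th] := Bis_at h.
apply: (@germ_set_eq _ (S * T)%g).
- by apply/germ_at_set; exists g, h, p.
- by apply: germ_mul_set; exact/germ_at_set.
- by rewrite germ_at_dom germ_dom_mul germ_at_dom (gdom_mul gG).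
Qed.

Lemma germ_at_cts : continuous germ_at.
Proof.
move=> g A /germ_nbhs[S /germ_at_set Sg SA].
apply: (@filterS _ (nbhs g) _ (bisect S)).
  by move=> h Sh; apply: SA; exact/germ_at_set.
by apply: open_nbhs_nbhs; split=> //; exact: Bis_open.
Qed.

Lemma hat_cts : continuous hat.
Proof.
move=> x A /dual_nbhs[E [EE Ex] EA].
apply: (@filterS _ (nbhs x) _ (Bis_units E)).
  by move=> y Ey; apply: EA; exact/hatE.
by apply: open_nbhs_nbhs; split=> //; exact: Bis_units_open.
Qed.

Lemma germ_at_gfunctor : @is_gfunctor G (Germ (BisObj G)) hat germ_at.
Proof.
split; [exact: hat_cts | exact: germ_at_cts | exact: germ_at_dom
  | exact: germ_at_cod | exact: germ_at_unit | exact: germ_at_mul].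
Qed.

Definition unhat (p : dual (BisObj G)) : gobj G := sval (cid (hat_surj p)).

Lemma unhatK : cancel unhat hat.
Proof. by move=> p; exact: svalP (cid (hat_surj p)). Qed.

Lemma hatK : cancel hat unhat.
Proof. by move=> x; apply: hat_inj; rewrite unhatK. Qed.

Definition germ_val (k : Germ (BisObj G)) : G := sval (cid (germ_at_surj k)).

Lemma germ_valK : cancel germ_val germ_at.
Proof. by move=> k; exact: svalP (cid (germ_at_surj k)). Qed.

Lemma germ_atK : cancel germ_at germ_val.
Proof. by move=> g; apply: germ_at_inj; rewrite germ_valK. Qed.

(** Continuity uses the bases of compact open sets and bisections, on which [hat] and [germ_at] are
    controlled by membership; the algebraic identities are transported through the injectivity of
    [hat] and [germ_at]. *)
Lemma germ_val_gfunctor : @is_gfunctor (Germ (BisObj G)) G unhat germ_val.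
Proof.
split.
- move=> p A; have [x <-] := hat_surj p; rewrite hatK => nA.
  have [K [cK oK Kx KA]] := boolean_space_basis bG nA.
  apply/dual_nbhs; exists (Bis_unit cK oK).
    by apply/hatE; [exact: Bis_unit_idem | exists x].
  move=> q; have [y <-] := hat_surj q; move=> /hatE -/(_ (Bis_unit_idem _ _)).
  by move=> [z Kz /(@gunit_inj G) <-]; rewrite /preimage/mkset hatK; exact: KA.
- move=> k A; have [g <-] := germ_at_surj k; rewrite germ_atK nbhsE.
  move=> [O [oO Og] OA]; have [S [Sg SO]] := Bis_basis oO Og.
  apply/germ_nbhs; exists S; first exact/germ_at_set.
  move=> k'; have [h <-] := germ_at_surj k'; move=> /germ_at_set Sh.
  by rewrite /preimage/mkset germ_atK; apply: OA; exact: SO.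
- by move=> k; apply: hat_inj; rewrite -germ_at_dom unhatK germ_valK.
- by move=> k; apply: hat_inj; rewrite -germ_at_cod unhatK germ_valK.
- by move=> p; apply: germ_at_inj; rewrite germ_at_unit unhatK germ_valK.
- move=> k k' p q; apply: germ_at_inj; rewrite germ_valK.
  have r : gdom (germ_at (germ_val k)) = gcod (germ_at (germ_val k')).
    by rewrite !germ_valK.
  by rewrite (germ_at_mul q r); apply: gmul_congr; rewrite germ_valK.
Qed.

Definition germ_val_multiplier : multiplier (Germ (BisObj G)) G :=
  iso_multiplier germ_val_gfunctor (gf_cts0 germ_at_gfunctor) unhatK hatK.

Lemma germ_val_isomorphism :
  @isomorphism bgroupoid_cat (Germ (BisObj G)) G germ_val_multiplier.
Proof.
exists (iso_multiplier germ_at_gfunctor (gf_cts0 germ_val_gfunctor) hatK unhatK).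
split.
  exact: (iso_multiplierK germ_val_gfunctor germ_at_gfunctor unhatK hatK germ_valK).
exact: (iso_multiplierK germ_at_gfunctor germ_val_gfunctor hatK unhatK germ_atK).
Qed.

End BisGerm.

(** An action is determined on units, so it suffices to compare the germ [germ_at eta] acting on the
    unit at [hat (gcod g)] with [germ_at] of [eta] acting on the unit at [gcod g]. For any [S]
    through [eta], both are germs of [Bis_map a S] at the same point. *)
Lemma germ_val_natural (H G : boolGroupoid) (a : multiplier H G) :
  multiplier_comp (germ_val_multiplier G) (Germ_map (Bis_mor a)) =
  multiplier_comp a (germ_val_multiplier H).
Proof.
have gG := tgroupoid (btgroupoid (bgdataP G)).
have gH := tgroupoid (btgroupoid (bgdataP H)).
have [aM _] := mactP a.
have hatE' x : dual_map (Bis_mor a) (hat x) = hat (moment0 a x).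
  apply: dual_ext => E EE; have aE : idem (Bis_map a E) := Bis_map_idem a EE.
  by rewrite (dual_mapE _ _ EE) (hatE _ aE) (hatE _ EE) Bis_map_units.
apply: multiplier_eq.
  apply/funext => g.
  transitivity (dual_map (Bis_mor a) (hat (gcod g))).
    exact: (congr1 (fun f => f _) (germ_moment0 (Bis_mor a))).
  rewrite hatE' -moment_cod.
  by rewrite /= /moment0 /= (gcod_unit gH).
move=> kappa g p q; pose eta := germ_val kappa.
have kE : kappa = germ_at eta by rewrite germ_valK.
have etag : gdom eta = moment a g.
  apply: hat_inj; rewrite -germ_at_dom -kE q.
  by rewrite /= /moment0 /= (gcod_unit gH).
have etag' : gdom eta = moment0 a (gcod g) by rewrite -moment_cod.
have r : gdom (act a eta (gunit (gcod g)) etag') = gcod g.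
  by rewrite (dom_act aM) (gdom_unit gG).
transitivity (gmul _ g r); last first.
  rewrite -(act_unitr etag r); apply: act_congr => //.
  by apply/esym; exact: (gmul_unitr gH).
apply: gmul_congr => //; apply: germ_at_inj; rewrite germ_valK.
have [S Seta] := Bis_at eta.
have kS : germ_set S kappa by rewrite kE; exact/germ_at_set.
have [E Eg] := pf_ex (dptP (hat (gcod g))).
have EE := dual_idem Eg.
apply: (@germ_set_eq _ (Bis_map a S : BisObj G)).
- have := germ_act_set (j := Bis_mor a) p kS (germ_unit_set Eg).
  exact: (germ_set_le (sle_mulr _ EE)).
- apply/germ_at_set; apply/Bis_mapP; exists eta.
  have r' : gdom eta = moment0 a (gdom (act a eta (gunit (gcod g)) etag')).
    by rewrite r.
  by exists r'; split=> //; apply: act_congr => //; rewrite r.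
- by rewrite germ_at_dom r germ_dom_act germ_dom_unit.
Qed.

Theorem theoremA10 :
  exists (GermP : forall G : boolInvSemigroup,
            is_boolean_groupoid (germ_groupoid G))
         (BisP : forall G : boolGroupoid,
            is_boolean_inverse_semigroup (Bis G)),
  let Germ_ob (G : boolInvSemigroup) : boolGroupoid :=
    BoolGroupoid (GermP G) in
  let Bis_ob (G : boolGroupoid) : boolInvSemigroup :=
    BoolInvSemigroup (BisP G) in
  exists (Germ_mapP : forall (H G : boolInvSemigroup) (j : bis_morphism H G),
            is_proper_multiplier_action (germ_action j))
         (Bis_mapP : forall (H G : boolGroupoid) (a : multiplier H G),
            is_bis_morphism (Bis_map a : Bis_ob H -> Bis_ob G)),
  let Germ_hom (H G : boolInvSemigroup) (j : bis_morphism H G) :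
      multiplier (Germ_ob H) (Germ_ob G) :=
    @Multiplier (Germ_ob H) (Germ_ob G) (germ_action j) (Germ_mapP H G j) in
  let Bis_hom (H G : boolGroupoid) (a : multiplier H G) :
      bis_morphism (Bis_ob H) (Bis_ob G) :=
    @BisMorphism (Bis_ob H) (Bis_ob G) (Bis_map a) (Bis_mapP H G a) in
  exists (GermF : @is_functor bis_cat bgroupoid_cat Germ_ob Germ_hom)
         (BisF : @is_functor bgroupoid_cat bis_cat Bis_ob Bis_hom),
    equivalence_of_categories (Functor GermF) (Functor BisF).
Proof.
exists germ_boolean, Bis_boolean => Germ_ob Bis_ob.
exists germ_multiplier, Bis_map_morphism => Germ_hom Bis_hom.
exists Germ_functor, Bis_functor; split.
  apply: naturally_isomorphic_sym; exists germ_bis_mor; split.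
    by move=> G; apply: bis_isomorphism; exact: germ_bisection_bij.
  move=> H G j; apply: bis_morphism_eq; apply/funext => s.
  exact: germ_bisection_natural.
exists germ_val_multiplier; split; first exact: germ_val_isomorphism.
exact: germ_val_natural.
Qed.
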